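(* For every integer $d\ge2$ there exist a constant $\rho_d\in(0,\pi/2)$ and an integer $n_0$ such that for all $n\ge n_0$ and all $u>\sqrt{k_n^d/s_d}\,\cos\rho_d$, $$\mathbb P_{\mu_n^d}\Big\{\sup_{x\in S^d}\Phi_n^d(x)>u\Big\}\ =\ \kappa\;\mathbb E_{\mu_n^d}\big\{\chi\big(A_n^d(u)\big)\big\},$$ where $\kappa=1/2$ if $n$ is even and $\kappa=1$ if $n$ is odd, and $\chi(A)$ denotes the Euler characteristic of the set $A$.
   Context: $S^d\subset\mathbb R^{d+1}$ is the unit sphere with its standard round metric, volume measure $V_{g_{S^d}}$, total area $s_d=\frac{2\pi^{(d+1)/2}}{\Gamma((d+1)/2)}$, and Laplacian $\Delta_d$. For $n\ge1$, let $\mathcal H_n^d$ be the space of real functions $\phi$ on $S^d$ with $\Delta_d\phi=-n(n+d-1)\phi$. Its dimension is $k_n^d=\frac{2n+d-1}{n+d-1}\binom{n+d-1}{d-1}$. Let $\phi_1^{n,d},\dots,\phi_{k_n^d}^{n,d}$ be an $L^2(S^d,V_{g_{S^d}})$-orthonormal basis of $\mathcal H_n^d$. A random spherical harmonic under the spherical ensemble is $\Phi_n^d=\sum_{j=1}^{k_n^d}a_j\phi_j^{n,d}$, where $a=(a_1,\dots,a_{k_n^d})$ is uniformly distributed on the unit sphere $S^{k_n^d-1}\subset\mathbb R^{k_n^d}$. Probability and expectation under this ensemble are denoted $\mathbb P_{\mu_n^d}$ and $\mathbb E_{\mu_n^d}$. For $u>0$ the excursion set is $A_n^d(u)=\{x\in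 S^d:\Phi_n^d(x)>u\}$. The Euler characteristic of the empty set is $0$. *)

(* Defs.v *)
From HB Require Import structures.
From mathcomp Require Import all_boot all_order all_algebra.
From mathcomp Require Import all_classical all_reals all_analysis.
From mathcomp Require Import measurable_realfun.

Set Implicit Arguments.
Unset Strict Implicit.
Unset Printing Implicit Defensive.
Import Order.TTheory GRing.Theory Num.Theory.
Import numFieldNormedType.Exports.

Local Open Scope classical_set_scope.
Local Open Scope ring_scope.

Section singular_homology.
Context (R : realType) (X : topologicalType).

Definition std_simplex (k : nat) : set 'rV[R]_k.+1 :=
  [set t | (forall i, 0 <= t 0 i) /\ \sum_i t 0 i = 1].
Arguments std_simplex : clear implicits.

Definition face_row (k : nat) (i : 'I_k.+2) (t : 'rV[R]_k.+1) : 'rV[R]_k.+2 :=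
  \row_j (if unlift i j is Some l then t 0 l else 0).

Lemma face_row_simplex (k : nat) (i : 'I_k.+2) (t : 'rV[R]_k.+1) :
  std_simplex k t -> std_simplex k.+1 (face_row i t).
Proof.
move=> [t0 t1]; split=> [j|].
  by rewrite mxE; case: unlift => [l|]; rewrite ?t0.
rewrite (bigD1_ord i) //= mxE unlift_none add0r -[RHS]t1.
by apply: eq_bigr => j _; rewrite mxE liftK.
Qed.

Definition face_map (k : nat) (i : 'I_k.+2) (t : std_simplex k) :
    std_simplex k.+1 :=
  SigSub (mem_set (face_row_simplex i (set_valP t))).

Definition singular_simplex (k : nat) : choiceType :=
  set_type [set s : std_simplex k -> X | continuous s].

Definition simplex_fun (k : nat) (s : singular_simplex k) :
    std_simplex k -> X := sval s.

(* Formal linear combinations of simplices are encoded by their coefficient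
   functions; being a chain additionally requires finite support. *)
Definition is_chain (k : nat) (c : singular_simplex k -> rat) : Prop :=
  finite_set [set s | c s != 0].

(* The coefficient at [t] of \sum_s c s \sum_i (-1)^i (s o face_map i). *)
Definition boundary (k : nat) (c : singular_simplex k.+1 -> rat) :
    singular_simplex k -> rat :=
  fun t => \sum_(i < k.+2) (-1) ^+ i *
    \sum_(s \in [set s | simplex_fun s \o face_map i = simplex_fun t]) c s.

Definition is_cycle (k : nat) : (singular_simplex k -> rat) -> Prop :=
  if k is k'.+1 then fun c => is_chain c /\ (forall t, boundary c t = 0)
  else fun c => is_chain c.

Definition is_boundary (k : nat) (c : singular_simplex k -> rat) : Prop :=
  exists2 e, is_chain e & forall t, c t = boundary e t.

(* The classes of the cycles [z_0, ..., z_(b-1)] form a basis of H_k(X; Q). *)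
Definition homology_basis (k b : nat) (z : 'I_b -> singular_simplex k -> rat) :
    Prop :=
  [/\ forall j, is_cycle (z j),
      forall c, is_cycle c -> exists q : 'I_b -> rat,
        is_boundary (fun s => c s - \sum_j q j * z j s) &
      forall q : 'I_b -> rat, is_boundary (fun s => \sum_j q j * z j s) ->
        forall j, q j = 0].

Definition is_betti (k b : nat) : Prop :=
  exists z : 'I_b -> singular_simplex k -> rat, homology_basis z.

Definition is_euler_char (e : int) : Prop :=
  exists (N : nat) (b : nat -> nat),
    [/\ forall k, is_betti k (b k),
        forall k, (N <= k)%N -> b k = 0%N &
        e = \sum_(k < N) (-1) ^+ k * (b k)%:Z].

(* Junk value 0 if the homology of X is not finite-dimensional. *)
Definition euler_char : int := xget 0 is_euler_char.

End singular_homology.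
Arguments euler_char R X : clear implicits.

Section lebesgue_tuple.
Context (R : realType).
Local Notation RR := (measurableTypeR R).

Lemma product_sigma_finite d1 d2 (T1 : measurableType d1)
    (T2 : measurableType d2) (m1 : {sigma_finite_measure set T1 -> \bar R})
    (m2 : {sigma_finite_measure set T2 -> \bar R}) :
  sigma_finite setT (m1 \x m2)%E.
Proof.
have /sigma_finiteP[F [TF ndF Foo]] := sigma_finiteT m1.
have /sigma_finiteP[G [TG ndG Goo]] := sigma_finiteT m2.
exists (fun n => F n `*` G n).
  rewrite -setXTT TF TG predeqE => -[x y]; split.
    move=> [/= [n _ Fnx] [k _ Gky]]; exists (maxn n k) => //; split.
    - by move: x Fnx; exact/subsetPset/ndF/leq_maxl.
    - by move: y Gky; exact/subsetPset/ndG/leq_maxr.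
  by move=> [n _ []/= ? ?]; split; exists n.
move=> k; have [? ?] := Foo k; have [? ?] := Goo k.
split; first exact: measurableX.
by rewrite product_measure1E// lte_mul_pinfty// ge0_fin_numE.
Qed.

Section step.
Context (n : nat) (m : {sigma_finite_measure set (n.-tuple RR) -> \bar R}).

Definition cons_pair (p : RR * n.-tuple RR) : n.+1.-tuple RR :=
  [tuple of p.1 :: p.2].

Lemma measurable_cons_pair : measurable_fun [set: RR * n.-tuple RR] cons_pair.
Proof. exact: measurable_cons. Qed.

HB.instance Definition _ :=
  isMeasurableFun.Build _ _ _ _ cons_pair measurable_cons_pair.

Definition lebesgue_cons : set (n.+1.-tuple RR) -> \bar R :=
  pushforward (lebesgue_measure \x m)%E cons_pair.

HB.instance Definition _ := Measure.copy lebesgue_cons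
  (measure_function_pushforward__canonical__measure_function_Measure
     (lebesgue_measure \x m)%E measurable_cons_pair).

Lemma lebesgue_cons_sigma_finite : sigma_finite setT lebesgue_cons.
Proof.
have [F TF mF] := product_sigma_finite (@lebesgue_measure R) m.
pose h (t : n.+1.-tuple RR) : RR * n.-tuple RR := (thead t, [tuple of behead t]).
have mh : measurable_fun setT h.
  apply: measurable_fun_pair; first exact: measurable_tnth.
  exact: measurable_behead.
have hK p : h (cons_pair p) = p.
  case: p => x t; rewrite /h /cons_pair; congr pair; exact/val_inj.
exists (fun i => h @^-1` F i).
  by rewrite -preimage_bigcup -TF preimage_setT.
move=> i; have [mFi Foo] := mF i; split.
  by rewrite -[X in measurable X]setTI; exact: mh.
rewrite /lebesgue_cons /pushforward -comp_preimage.
by rewrite (_ : h \o cons_pair = id) //; apply/funext => p; exact: hK.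
Qed.

HB.instance Definition _ := Measure_isSigmaFinite.Build _ _ _ lebesgue_cons
  lebesgue_cons_sigma_finite.

End step.

Fixpoint lebesgue_tuple (n : nat) :
    {sigma_finite_measure set (n.-tuple RR) -> \bar R} :=
  if n is n'.+1 then lebesgue_cons (lebesgue_tuple n')
  else dirac [tuple].

End lebesgue_tuple.

Section sphere_measure.
Context (R : realType) (n : nat).
Local Notation RR := (measurableTypeR R).

Definition tuple_norm (t : n.-tuple RR) : R :=
  Num.sqrt (\sum_(i < n) (tnth t i : R) ^+ 2).

Definition tuple_normalize (t : n.-tuple RR) : n.-tuple RR :=
  [tuple (tnth t i : R) / tuple_norm t | i < n].

Lemma measurable_tuple_norm :
  measurable_fun [set: n.-tuple RR] (tuple_norm : _ -> R).
Proof.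
apply: (@measurableT_comp _ _ _ _ _ _ (@Num.sqrt R)).
  by apply: continuous_measurable_fun; exact: sqrt_continuous.
apply: measurable_sum => i; apply: measurable_funX.
exact: measurable_tnth.
Qed.

Lemma measurable_tuple_normalize :
  measurable_fun [set: n.-tuple RR] tuple_normalize.
Proof.
apply/measurable_fun_tnthP => i.
rewrite (_ : _ \o _ = fun t => (tnth t i : R) * tuple_norm t `^ (-1)).
  apply: measurable_funM; first exact: measurable_tnth.
  apply: (@measurableT_comp _ _ _ _ _ _ (fun x : R => x `^ (-1))).
    exact: measurable_powR.
  exact: measurable_tuple_norm.
apply/funext => t /=; rewrite tnth_mktuple powR_inv1 //.
exact: sqrtr_ge0.
Qed.

Definition punctured_ball : set (n.-tuple RR) :=
  [set t | 0 < tuple_norm t <= 1].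

Lemma measurable_punctured_ball : measurable punctured_ball.
Proof.
rewrite (_ : punctured_ball = tuple_norm @^-1` `]0, 1]).
  rewrite -[X in measurable X]setTI; apply: measurable_tuple_norm => //.
by apply/seteqP; split => t /=; rewrite in_itv.
Qed.

Definition cone_measure : set (n.-tuple RR) -> \bar R :=
  pushforward (mrestr (lebesgue_tuple R n) measurable_punctured_ball)
    tuple_normalize.

HB.instance Definition _ := Measure.copy cone_measure
  (measure_function_pushforward__canonical__measure_function_Measure
    (mrestr (lebesgue_tuple R n) measurable_punctured_ball)
    measurable_tuple_normalize).

(* A |-> n * Leb {t | 0 < |t| <= 1, t / |t| \in A}: by integration in polar
   coordinates this is the Riemannian volume of A in the round sphere. *)
Definition sphere_measure : {measure set (n.-tuple RR) -> \bar R} :=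
  mscale n%:R%:nng cone_measure.

Definition unit_tuple : set (n.-tuple RR) := [set t | tuple_norm t = 1].

(* The sphere here is S^(n-1), of total area 2 pi^(n/2) / Gamma(n/2). *)
Definition sphere_area : R := fine (sphere_measure unit_tuple).

(* [sphere_measure] normalized to mass 1; the Dirac mass is only the fallback
   required by [mnormalize] for the degenerate case n = 0. *)
Definition uniform_sphere : probability (n.-tuple RR) R :=
  mnormalize sphere_measure (\d_ [tuple of nseq n (0 : RR)]).

End sphere_measure.
Arguments sphere_area R n : clear implicits.
Arguments uniform_sphere R n : clear implicits.
Arguments sphere_measure R n : clear implicits.
Arguments unit_tuple R n : clear implicits.

Section spherical_harmonics.
Context (R : realType) (d : nat).
Local Notation E := 'rV[R]_d.+1.
Implicit Types phi : E -> R.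

Definition eucl_norm (x : E) : R := Num.sqrt (\sum_i x 0 i ^+ 2).

(* Real functions on S^d are represented by functions on R^(d+1), of which
   only the values on [unit_sphere] matter. *)
Definition unit_sphere : set E := [set x | eucl_norm x = 1].

Definition radial_ext phi : E -> R := fun x => phi ((eucl_norm x)^-1 *: x).

Definition partial (i : 'I_d.+1) (f : E -> R) : E -> R :=
  fun x => 'D_(delta_mx 0 i) f x.

Definition C1_at (f : E -> R) (x : E) : Prop :=
  {for x, continuous f} /\
  forall i, derivable f x (delta_mx 0 i) /\ {for x, continuous (partial i f)}.

Definition sphere_C2 phi : Prop :=
  forall x, x != 0 -> C1_at (radial_ext phi) x /\
    forall i, C1_at (partial i (radial_ext phi)) x.

(* The Laplace-Beltrami operator of the round sphere: on S^d it is the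
   Euclidean Laplacian of the extension that is constant along rays. *)
Definition sphere_laplacian phi : E -> R :=
  fun x => \sum_i partial i (partial i (radial_ext phi)) x.

Definition spherical_harmonic (n : nat) phi : Prop :=
  sphere_C2 phi /\
  forall x, unit_sphere x ->
    sphere_laplacian phi x = - (n * (n + d - 1))%:R * phi x.

(* The dimension of the space of spherical harmonics of degree n; the
   division is exact. *)
Definition harmonic_dim (n : nat) : nat :=
  ((2 * n + d - 1) * 'C(n + d - 1, d - 1)) %/ (n + d - 1).

Definition row_of_tuple (t : d.+1.-tuple (measurableTypeR R)) : E :=
  \row_i (tnth t i : R).

Definition sphere_inner phi psi : R :=
  \int[sphere_measure R d.+1]_(t in unit_tuple R d.+1)
    (phi (row_of_tuple t) * psi (row_of_tuple t)).

Definition orthonormal_harmonic_basis (n k : nat) (phi : 'I_k -> E -> R) :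
    Prop :=
  [/\ forall j, spherical_harmonic n (phi j),
      forall i j, sphere_inner (phi i) (phi j) = (i == j)%:R &
      forall psi, spherical_harmonic n psi -> exists c : 'I_k -> R,
        forall x, unit_sphere x -> psi x = \sum_j c j * phi j x].

Definition random_harmonic (k : nat) (phi : 'I_k -> E -> R)
    (a : k.-tuple (measurableTypeR R)) : E -> R :=
  fun x => \sum_j (tnth a j : R) * phi j x.

Definition excursion_set (f : E -> R) (u : R) : set E :=
  [set x | unit_sphere x /\ u < f x].

End spherical_harmonics.
Arguments unit_sphere R d : clear implicits.

(* Main.v *)
(** The evaluation map x |-> (phi_1 x, ..., phi_k x) sends S^d into a sphere of
    radius N = sqrt (k / s_d), and the inner product of the images of x and y is
    N^2 G(x . y), where G is the Gegenbauer polynomial of degree n normalized by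
    G(1) = 1.  If |a| = 1 and the wave <a, phi> exceeds N cos rho at x, then a is
    close to the image of x divided by N, so that the wave is close to N G(x . _).
    Quantitative bounds on G that are uniform in n then show that the excursion
    set lies within distance O(1/n) of x, and of -x when n is even, and that the
    wave has negative second differences along the great arcs joining two of its
    points.  A minimum along such an arc is thus attained at an endpoint, and the
    excursion set is star-shaped, or the union of two antipodal star-shaped sets.
    Hence its Euler characteristic is 1 / kappa as soon as it is not empty, for
    every unit vector a. *)
Require Import Defs.
From HB Require Import structures.
From mathcomp Require Import all_boot all_order all_algebra.
From mathcomp Require Import polyrcf.
From mathcomp Require Import ring lra zify.
Set Implicit Arguments.
Unset Strict Implicit.
Unset Printing Implicit Defensive.
Import Order.TTheory GRing.Theory Num.Theory.
Local Open Scope ring_scope.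

(** * Gegenbauer polynomials *)

(** The natural scale is [l = n (n + d - 1)], since [G'(1) = l / d]. On the window
    [1 - z <= 1 / (10 l)] the derivative keeps at least half of this value, and across it the energy
    [G^2 + (1 - z^2) G'^2 / l] grows by at least [1 / (80 d)]. Hence [|G| <= 1 - 1 / (160 d)]
    outside the window, a gap free of [n]. The constant [eta] is half of this gap, and
    [cos rho = 1 - eta^2 / 2] because unit vectors with a larger inner product are less than [eta]
    apart. Taking [n >= 3] keeps [l - 2 d - 2] positive, so that the energy also controls [G'']. The
    kernel of inner products is known only through an orthonormal basis of eigenfunctions.
    Identifying it with [G] takes the invariance of the sphere measure under reflections, which
    makes the kernel zonal, and a uniqueness argument for the zonal equation, which is singular at
    both poles. Second differences suit the arcs because, for a step of cosine [c], the second
    difference of the evaluation map has norm at most [3 N l (1 - c)], the order of the decrease of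
    [N G] itself, so that an error [eta] times this norm is absorbed whatever [n] is. *)

Section gegenbauer.
Variable R : rcfType.
Implicit Types (p G : {poly R}) (d l z : R) (n : nat).

(** Eigenvalue equation of a zonal function on the [d]-sphere, in the height [z]. The parameters are
    free because the derivative of a solution solves the same equation with [d + 2] and [l - d]. *)
Definition gegenbauer_eq d l G :=
  (1 - 'X^2) * G^`()^`() - d *: ('X * G^`()) + l *: G = 0.

Lemma gegenbauer_eqE d l G z : gegenbauer_eq d l G ->
  (1 - z ^+ 2) * G^`()^`().[z] - d * (z * G^`().[z]) + l * G.[z] = 0.
Proof. by move=> /(congr1 (horner^~ z)); rewrite !hornerE. Qed.

Lemma gegenbauer_eq_deriv d l G :
  gegenbauer_eq d l G -> gegenbauer_eq (d + 2) (l - d) G^`().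
Proof.
move=> /(congr1 (@deriv _)); rewrite /gegenbauer_eq deriv0 => <-.
rewrite !derivE -!mul_polyC !(rmorphD, rmorphN, rmorph_nat) /=.
ring.
Qed.

(** Sonin's function. The equation turns its derivative into [2 (d - 1) z G'^2 / l], so it grows on
    [[0, 1]]; it dominates [G^2] on [[-1, 1]], with equality at [1]. *)
Definition energy l G := G ^+ 2 + l^-1 *: ((1 - 'X^2) * G^`() ^+ 2).

Lemma energyE l G z :
  (energy l G).[z] = G.[z] ^+ 2 + l^-1 * ((1 - z ^+ 2) * G^`().[z] ^+ 2).
Proof. by rewrite /energy !hornerE. Qed.

Lemma energy_deriv d l G z : l != 0 -> gegenbauer_eq d l G ->
  (energy l G)^`().[z] = 2 * (d - 1) * z * G^`().[z] ^+ 2 / l.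
Proof.
move=> l0 /(gegenbauer_eqE z) H; rewrite /energy !derivE !hornerE.
(* Adding [- 2 G' / l] times the equation eliminates [G'']. *)
rewrite -[LHS]addr0 -[X in _ + X](mulr0 (- (2 * G^`().[z] / l))) -H.
rewrite /=.
by field.
Qed.

Lemma energy_homo d l G (a b : R) : 0 < l -> 1 <= d -> gegenbauer_eq d l G ->
  0 <= a -> a <= b -> (energy l G).[a] <= (energy l G).[b].
Proof.
move=> l0 d1 H a0 ab.
apply: (@ler_hornerW _ a b) => //; rewrite ?in_itv /= ?lexx ?ab //.
move=> x; rewrite in_itv /= => /andP[ax _].
rewrite (energy_deriv _ _ H) ?gt_eqF//.
have x0 : 0 <= x by apply: le_trans (ltW ax).
apply: divr_ge0 (ltW l0); apply: mulr_ge0 (sqr_ge0 _); apply: mulr_ge0 x0.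
by rewrite mulr_ge0 ?ler0n// subr_ge0.
Qed.

Lemma gegenbauer_le_energy l G z : 0 < l -> `|z| <= 1 ->
  G.[z] ^+ 2 <= (energy l G).[z].
Proof.
move=> l0 z1; rewrite energyE lerDl mulr_ge0 ?invr_ge0 ?(ltW l0)//.
by rewrite mulr_ge0 ?sqr_ge0// subr_ge0 -real_normK ?num_real// expr_le1.
Qed.

Lemma gegenbauer_bound d l G z : 0 < l -> 1 <= d -> gegenbauer_eq d l G ->
  (forall y, `|G.[- y]| = `|G.[y]|) -> `|z| <= 1 -> `|G.[z]| <= `|G.[1]|.
Proof.
move=> l0 d1 H par.
wlog z0 : z / 0 <= z.
  move=> W; case: (leP 0 z) => [/W//|zn] z1.
  by rewrite -par W ?normrN// oppr_ge0 ltW.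
move=> z1; have z1' : z <= 1 by rewrite -[z]ger0_norm.
rewrite -ler_sqr ?nnegrE// !real_normK ?num_real//.
apply: le_trans (gegenbauer_le_energy G l0 z1) _.
apply: le_trans (energy_homo l0 d1 H z0 z1') _.
by rewrite energyE expr1n subrr mul0r mulr0 addr0.
Qed.

Lemma horner_eq0_itv p : (forall z, 0 <= z <= 1 -> p.[z] = 0) -> p = 0.
Proof.
move=> H; apply/eqP/negPn/negP => p0.
suff : (size [seq k.+1%:R^-1 : R | k <- iota 0 (size p)] < size p)%N.
  by rewrite size_map size_iota ltnn.
apply: max_poly_roots => //.
  apply/allP => _ /mapP[k _ ->]; apply/rootP/H.
  by rewrite invr_ge0 ler0n invf_le1 ?ltr0n// ler1n.
rewrite map_inj_uniq ?iota_uniq// => i j /invr_inj /eqP.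
by rewrite eqr_nat => /eqP [].
Qed.

(** If [G(1) = 0], the energy vanishes at [1], hence on [[0, 1]], and [G] has too many roots. This
    permits normalizing by the value at [1]. *)
Lemma gegenbauer_neq0 d l G : 0 < l -> 1 <= d -> gegenbauer_eq d l G ->
  G != 0 -> G.[1] != 0.
Proof.
move=> l0 d1 H; apply: contraNneq => G1; apply/eqP/horner_eq0_itv => z.
move=> /andP[z0 z1]; apply/eqP; rewrite -sqrf_eq0 eq_le sqr_ge0 andbT.
have zn : `|z| <= 1 by rewrite ger0_norm.
apply: le_trans (gegenbauer_le_energy G l0 zn) _.
apply: le_trans (energy_homo l0 d1 H z0 z1) _.
by rewrite energyE expr1n subrr mul0r mulr0 addr0 G1 expr0n.
Qed.

Section existence.
Variables (d n : nat).
Hypothesis hd : (0 < d)%N.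
Hypothesis hn : (0 < n)%N.

(** Coefficient of [X^(n - 2m)] in a monic solution, chosen to cancel what the second derivative of
    the previous monomial creates in that degree. Descending from the leading term keeps the
    divisors [2m (2n - 2m + d - 1)] nonzero. *)
Fixpoint gegenbauer_coef (m : nat) : R :=
  if m is m'.+1 then
    - gegenbauer_coef m' * ((n - m'.*2)%:R * (n - m'.*2).-1%:R) /
      ((m.*2)%:R * (n + (n - m.*2) + d - 1)%:R)
  else 1.

Definition gegenbauer_pre : {poly R} :=
  \sum_(m < (n./2).+1) gegenbauer_coef m *: 'X^(n - m.*2).

Lemma gegenbauer_preP :
  gegenbauer_eq d%:R (n%:R * (n%:R + d%:R - 1)) gegenbauer_pre.
Proof.
pose D (G : {poly R}) := (1 - 'X^2) * G^`()^`() - d%:R *: ('X * G^`())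
   + (n%:R * (n%:R + d%:R - 1)) *: G.
have DD p q : D (p + q) = D p + D q.
  by rewrite /D !derivD !mulrDr !scalerDr; ring.
have DZ a p : D (a *: p) = a *: D p.
  by rewrite /D !derivZ -!mul_polyC; ring.
have D0 : D 0 = 0 by rewrite /D !deriv0 !mulr0 !scaler0 subrr add0r.
have DX j : D 'X^j = (j%:R * j.-1%:R) *: 'X^(j.-2)
    + ((n%:R - j%:R) * (n%:R + j%:R + d%:R - 1)) *: 'X^j.
  have EX : 'X * ('X^j)^`() = j%:R *: 'X^j :> {poly R}.
    case: j => [|j]; first by rewrite expr0 -polyC1 derivC mulr0 scale0r.
    by rewrite derivXn /= -scaler_nat -scalerAr -exprS.
  have EX2 : 'X^2 * ('X^j)^`()^`() = (j%:R * (j%:R - 1)) *: 'X^j :> {poly R}.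
    move/(congr1 (@deriv _)): (EX); rewrite derivM derivX mul1r derivZ.
    move/(congr1 ( *%R 'X)); rewrite mulrDr EX mulrA -expr2 -scalerAr EX scalerA.
    by move=> E; rewrite mulrBr mulr1 scalerBl -E addrC addKr.
  have E2 : ('X^j)^`()^`() = (j%:R * j.-1%:R) *: 'X^(j.-2) :> {poly R}.
    by rewrite derivXn derivMn derivXn -scaler_nat -(scaler_nat j.-1) scalerA.
  rewrite /D EX mulrBl mul1r EX2 E2 !scalerA -addrA -addrA; congr (_ + _).
  rewrite -!scaleNr -!scalerDl; congr (_ *: _); ring.
(* The sum truncated at [M] solves the equation up to one monomial, whose factor [j (j - 1)] with
   [j = n - 2M] vanishes for [M = n./2], where [j] is [0] or [1]. *)
suff H M : (M <= n./2)%N -> D (\sum_(m < M.+1) gegenbauer_coef m *: 'X^(n - m.*2))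
   = (gegenbauer_coef M * ((n - M.*2)%:R * (n - M.*2).-1%:R)) *: 'X^((n - M.*2).-2).
  rewrite /gegenbauer_eq -/(D _) H// [X in _ * X](_ : _ = 0) ?mulr0 ?scale0r//.
  have -> : (n - n./2.*2)%N = odd n by lia.
  by case: (odd n); rewrite /= ?mulr0 ?mul0r.
elim: M => [|M IH] hM.
  by rewrite big_ord1 DZ DX /= subn0 subrr mul0r scale0r addr0 scalerA.
rewrite big_ord_recr /= DD IH ?(ltnW hM)// DZ DX /=.
set c := gegenbauer_coef M; set j := (n - M.*2)%N.
have -> : (n - M.+1.*2)%N = j.-2 by rewrite /j; lia.
rewrite scalerDr addrCA [X in _ + X](_ : _ = 0) ?addr0 ?scalerA//.
rewrite -scalerDl [X in X *: _](_ : _ = 0) ?scale0r//.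
have -> : n%:R - j.-2%:R = (M.+1.*2)%:R :> R.
  by rewrite -natrB; [congr (_%:R); rewrite /j; lia|rewrite /j; lia].
have -> : n%:R + j.-2%:R + d%:R - 1 = (n + j.-2 + d - 1)%:R :> R.
  by rewrite natrB ?natrD//; lia.
rewrite divfK; last first.
  rewrite mulf_neq0// pnatr_eq0; lia.
by rewrite mulNr addrN.
Qed.

Lemma gegenbauer_pre_neq0 : gegenbauer_pre != 0.
Proof.
clear hd.
apply/eqP => /(congr1 (fun p : {poly R} => p`_n)).
rewrite coef0 coef_sum big_ord_recl /= coefZ mul1r subn0 coefXn eqxx.
rewrite big1 ?addr0 => [/eqP|i _]; first by rewrite oner_eq0.
by rewrite coefZ coefXn (_ : _ == _ = false) ?mulr0//; rewrite /bump /=; lia.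
Qed.

Lemma gegenbauer_pre_parity z :
  gegenbauer_pre.[- z] = (-1) ^+ n * gegenbauer_pre.[z].
Proof.
clear hd hn.
rewrite !horner_sum mulr_sumr; apply: eq_bigr => i _.
rewrite !hornerZ !hornerXn (exprNn z) [RHS]mulrCA; congr (_ * (_ * _)).
rewrite -signr_odd -[RHS]signr_odd; congr ((-1) ^+ nat_of_bool _); case: i => /= m; lia.
Qed.

End existence.
End gegenbauer.

(** * Mean value estimates for polynomials *)

Lemma poly_lipschitz (R : rcfType) (p : {poly R}) (a b B : R) :
  (forall x, Num.min a b <= x <= Num.max a b -> `|p^`().[x]| <= B) ->
  `|p.[b] - p.[a]| <= B * `|b - a|.
Proof.
wlog ab : a b / a < b.
  move=> W H; have [ab|ba|->] := ltgtP a b.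
  - exact: W.
  - by rewrite distrC (distrC b); apply: W => // x; rewrite minC maxC; exact: H.
  - by rewrite !subrr normr0 mulr0.
move=> H; have [c + ->] := poly_mvt p ab.
rewrite in_itv /= => /andP[ac cb]; rewrite normrM ler_wpM2r// H//.
by rewrite min_l ?max_r ?(ltW ac) ?(ltW cb)// ltW.
Qed.

(** The Lipschitz bound is used for [p'] and then for [p] minus its tangent. This loses the factor
    1/2 of Taylor's formula, which the later constants can afford. *)
Lemma poly_taylor1 (R : rcfType) (p : {poly R}) (a b B : R) :
  (forall x, Num.min a b <= x <= Num.max a b -> `|p^`()^`().[x]| <= B) ->
  `|p.[b] - p.[a] - p^`().[a] * (b - a)| <= B * (b - a) ^+ 2.
Proof.
move=> H; pose q := p - p^`().[a] *: 'X.
have -> : p.[b] - p.[a] - p^`().[a] * (b - a) = q.[b] - q.[a].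
  by rewrite /q !hornerE; ring.
rewrite -[(b - a) ^+ 2]real_normK ?num_real// expr2 mulrA.
apply: poly_lipschitz => x xab.
rewrite /q !derivE !hornerE.
have xa : `|x - a| <= `|b - a| /\ forall y, Num.min a x <= y <= Num.max a x ->
    Num.min a b <= y <= Num.max a b.
  move: xab; case: (leP a b) => ab /andP[x1 x2].
    rewrite !ger0_norm ?subr_ge0// lerB//; split=> // y.
    by rewrite min_l// max_r// => /andP[-> /le_trans ->].
  rewrite !ler0_norm ?subr_le0 ?(ltW ab)// lerN2 lerB//; split=> // y.
  by rewrite min_r// max_l// => /andP[/(le_trans x1) -> ->].
apply: le_trans (_ : B * `|x - a| <= _).
  by apply: poly_lipschitz => y /xa.2/H.
rewrite ler_wpM2l ?xa.1//; apply: le_trans (H x xab); exact: normr_ge0.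
Qed.

(** * Bounds on the normalized polynomial, uniform in the degree *)

Section normalized.
Variables (R : rcfType) (d n : nat).
Hypothesis hd : (1 < d)%N.
Hypothesis hn : (2 < n)%N.

Variable l : R.
Hypothesis hl : l = n%:R * (n%:R + d%:R - 1).
Let P := gegenbauer_pre R d n.

Definition gegenbauer : {poly R} := (P.[1])^-1 *: P.
Let G := gegenbauer.

Let d2 : 2 <= d%:R :> R. Proof. by rewrite (ler_nat R 2). Qed.
Let n3 : 3 <= n%:R :> R. Proof. by rewrite (ler_nat R 3). Qed.
Let l0 : 0 < l.
Proof. have := d2; have := n3; rewrite hl => *; apply: mulr_gt0; lra. Qed.
(** Keeps [l - 2 d - 2 = (n - 2) (n + d + 1)] positive. It is the last coefficient of the equation
    of [G''], to which the energy argument is applied too. *)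
Let ld : 3 * d%:R + 6 <= l.
Proof.
have -> : l = 3 * d%:R + 6 + (n%:R - 3) * (d%:R + n%:R + 2).
  by rewrite hl; ring.
have := d2; have := n3 => *; rewrite lerDl mulr_ge0//; lra.
Qed.

Lemma gegenbauerP : gegenbauer_eq d%:R l G.
Proof.
have := gegenbauer_preP R (ltnW hd) (ltn_trans (isT : (0 < 2)%N) hn).
rewrite /gegenbauer_eq -/P -hl => H.
rewrite /G /gegenbauer !derivZ -[RHS](scaler0 _ (P.[1])^-1) -H -!mul_polyC.
ring.
Qed.

Lemma gegenbauer1 : G.[1] = 1.
Proof.
rewrite /G /gegenbauer hornerZ mulVf//.
apply: (@gegenbauer_neq0 R d%:R l) => //; last by apply: gegenbauer_pre_neq0; lia.
- have := d2; lra.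
- by rewrite hl; apply: gegenbauer_preP; lia.
Qed.

Lemma gegenbauerN z : G.[- z] = (-1) ^+ n * G.[z].
Proof. by rewrite !hornerZ gegenbauer_pre_parity mulrCA. Qed.

Lemma gegenbauer_compN : G \Po (- 'X) = (-1) ^+ n *: G.
Proof.
apply/eqP; rewrite -subr_eq0; apply/eqP/horner_eq0_itv => z _.
rewrite hornerD hornerN horner_comp hornerN hornerX gegenbauerN.
by rewrite (hornerZ ((-1) ^+ n) G) subrr.
Qed.

Lemma gegenbauer_deriv_compN : G^`() \Po (- 'X) = (-1) ^+ n.+1 *: G^`().
Proof.
have := congr1 (@deriv _) gegenbauer_compN; rewrite deriv_comp (derivZ ((-1) ^+ n)) => H.
rewrite exprS -scalerA -H !derivE mulrN1; by rewrite scalerN scaleN1r opprK.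
Qed.

Lemma gegenbauer_deriv2_compN : G^`()^`() \Po (- 'X) = (-1) ^+ n *: G^`()^`().
Proof.
have := congr1 (@deriv _) gegenbauer_deriv_compN; rewrite deriv_comp (derivZ ((-1) ^+ n.+1)).
by rewrite !derivE mulrN1 exprS mulN1r scaleNr => /oppr_inj.
Qed.

Let normN (p : {poly R}) k y : p \Po (- 'X) = (-1) ^+ k *: p ->
  `|p.[- y]| = `|p.[y]|.
Proof.
move=> /(congr1 (fun q : {poly R} => `|q.[y]|)); rewrite horner_comp !hornerE => ->.
by rewrite normrM normrX normrN1 expr1n mul1r.
Qed.

Lemma gegenbauer_deriv1 : G^`().[1] = l / d%:R.
Proof.
have := gegenbauer_eqE 1 gegenbauerP; rewrite gegenbauer1 => H.
have d0 : d%:R != 0 :> R by rewrite pnatr_eq0; lia.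
by apply: (mulfI d0); rewrite mulrCA divff//; lra.
Qed.

Lemma gegenbauer_deriv2_1 :
  G^`()^`().[1] = (l - d%:R) * l / (d%:R * (d%:R + 2)).
Proof.
have := gegenbauer_eqE 1 (gegenbauer_eq_deriv gegenbauerP).
rewrite gegenbauer_deriv1 => H.
have d0 : d%:R != 0 :> R by rewrite pnatr_eq0; lia.
have d1 : d%:R + 2 != 0 :> R by have := d2 => *; lra.
apply: (mulfI d1); transitivity ((l - d%:R) * (l / d%:R)); first by lra.
by field; apply/andP.
Qed.

Lemma gegenbauer_deriv_le z : `|z| <= 1 -> `|G^`().[z]| <= l / d%:R.
Proof.
move=> z1; have := @gegenbauer_bound _ (d%:R + 2) (l - d%:R) G^`() z.
have d2' := d2; have ld' := ld.
rewrite gegenbauer_deriv1 [`|l / _|]ger0_norm; last first.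
  by rewrite divr_ge0 ?ler0n// ltW.
apply=> //; [lra|lra|exact/gegenbauer_eq_deriv/gegenbauerP|].
move=> y; exact/normN/gegenbauer_deriv_compN.
Qed.

Lemma gegenbauer_deriv2_le z : `|z| <= 1 ->
  `|G^`()^`().[z]| <= l ^+ 2 / (d%:R * (d%:R + 2)).
Proof.
move=> z1; have d2' := d2; have ld' := ld; have l0' := l0.
apply: le_trans (_ : (l - d%:R) * l / (d%:R * (d%:R + 2)) <= _); last first.
  apply: ler_wpM2r; first by rewrite invr_ge0 mulr_ge0//; lra.
  rewrite expr2 ler_wpM2r//; lra.
have := @gegenbauer_bound _ (d%:R + 2 + 2) (l - d%:R - (d%:R + 2)) G^`()^`() z.
rewrite gegenbauer_deriv2_1 [`|_ / _|]ger0_norm; last first.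
  by rewrite divr_ge0 ?mulr_ge0//; lra.
apply=> //; [lra|lra|exact/gegenbauer_eq_deriv/gegenbauer_eq_deriv/gegenbauerP|].
move=> y; exact/normN/gegenbauer_deriv2_compN.
Qed.


Let inv10 : 0 < (10 * l)^-1 <= 1 / 60.
Proof.
have := l0; have := ld; have := d2 => *; rewrite invr_gt0 mulr_gt0//=.
by rewrite mul1r lef_pV2 ?posrE ?mulr_gt0//; lra.
Qed.

(** As [G''] is at most [l^2 / (d (d + 2))], over a length [1 / (10 l)] the derivative moves by at
    most the fraction [1 / (10 (d + 2))] of its value [l / d] at [1], whatever [n] is. *)
Lemma gegenbauer_near1 z : 1 - (10 * l)^-1 <= z <= 1 ->
  l / (2 * d%:R) <= G^`().[z] /\ 0 <= G.[z].
Proof.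
move=> /andP[z0 z1]; have := inv10 => /andP[i0 i1].
have bnd x : Num.min 1 z <= x <= Num.max 1 z -> `|x| <= 1.
  rewrite min_r// max_l// => /andP[zx x1]; rewrite ger0_norm//; lra.
have d2' := d2; have l0' := l0.
have H1 : `|G.[z] - G.[1]| <= l / d%:R * `|z - 1|.
  by apply: poly_lipschitz => x /bnd; apply: gegenbauer_deriv_le.
have H2 : `|G^`().[z] - G^`().[1]| <= l ^+ 2 / (d%:R * (d%:R + 2)) * `|z - 1|.
  by apply: poly_lipschitz => x /bnd; apply: gegenbauer_deriv2_le.
have zl : `|z - 1| <= (10 * l)^-1 by rewrite distrC ger0_norm; lra.
have ll : l * (10 * l)^-1 = 1 / 10 by field; rewrite gt_eqF.
split.
- have {}H2 : `|G^`().[z] - l / d%:R| <= l / (2 * d%:R).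
    rewrite -gegenbauer_deriv1; apply: le_trans H2 _.
    apply: le_trans (_ : l ^+ 2 / (d%:R * (d%:R + 2)) * (10 * l)^-1 <= _).
      by rewrite ler_wpM2l// divr_ge0 ?sqr_ge0// mulr_ge0//; lra.
    have -> : l ^+ 2 / (d%:R * (d%:R + 2)) * (10 * l)^-1
        = l / (2 * d%:R) * (2 / (10 * (d%:R + 2))).
      by field; rewrite !gt_eqF//; lra.
    rewrite ler_piMr ?divr_ge0 ?mulr_ge0//; [lra..|].
    by rewrite ler_pdivrMr; lra.
  have -> : l / (2 * d%:R) = l / d%:R - l / (2 * d%:R).
    by field; rewrite gt_eqF//; lra.
  by move: H2; rewrite ler_norml => /andP[+ _]; lra.
- move: H1; rewrite gegenbauer1 ler_norml => /andP[H1 _].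
  have : l / d%:R * `|z - 1| <= l / d%:R * (10 * l)^-1.
    by rewrite ler_wpM2l// divr_ge0//; lra.
  have -> : l / d%:R * (10 * l)^-1 = (10 * d%:R)^-1.
    by field; rewrite !gt_eqF//; lra.
  have : (10 * d%:R)^-1 <= 1 :> R by rewrite invf_le1; lra.
  lra.
Qed.

(** In the window the energy has derivative at least [l / (8 d)], from [z >= 1/2], [d - 1 >= d / 2]
    and [G' >= l / (2 d)]. Over the length [1 / (10 l)] it thus gains [1 / (80 d)] before reaching
    [1] at the endpoint; a square root halves this gain. *)
Lemma gegenbauer_gap z : `|z| <= 1 - (10 * l)^-1 ->
  `|G.[z]| <= 1 - (160 * d%:R)^-1.
Proof.
wlog z0 : z / 0 <= z.
  move=> W; case: (leP 0 z) => [/W//|zn] z1.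
  by rewrite -(normN _ gegenbauer_compN) W ?normrN// oppr_ge0 ltW.
rewrite ger0_norm// => z1; have := inv10 => /andP[i0 i1].
have d2' := d2; have l0' := l0.
set t := (10 * l)^-1 in z1 i0 i1.
have d1 : 1 <= d%:R :> R by lra.
have Ez : (energy l G).[z] <= (energy l G).[1 - t].
  exact: (energy_homo l0 d1 gegenbauerP).
have t1 : 1 - t < 1 by lra.
have [x + Ex] := poly_mvt (energy l G) t1.
rewrite in_itv /= => /andP[x0 x1].
have E1 : (energy l G).[1] = 1.
  by rewrite energyE gegenbauer1 !expr1n subrr mul0r mulr0 addr0.
have [Gx _] : l / (2 * d%:R) <= G^`().[x] /\ 0 <= G.[x].
  by apply: gegenbauer_near1; rewrite !ltW.
have E'x : l / (8 * d%:R) <= (energy l G)^`().[x].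
  rewrite (energy_deriv _ _ gegenbauerP) ?gt_eqF// ler_pdivlMr//.
  have -> : l / (8 * d%:R) * l = (d%:R / 2) * (l / (2 * d%:R)) ^+ 2.
    by field; rewrite gt_eqF//; lra.
  apply: ler_pM.
  - by rewrite divr_ge0.
  - exact: sqr_ge0.
  - have : (1/2) * (d%:R / 2) <= x * (d%:R - 1) by apply: ler_pM; lra.
    lra.
  - by rewrite ler_sqr ?nnegrE//; [rewrite divr_ge0//; lra|apply: le_trans Gx; rewrite divr_ge0//; lra].
have Gz : G.[z] ^+ 2 <= 1 - (80 * d%:R)^-1.
  apply: le_trans (gegenbauer_le_energy G l0 _) _; first by rewrite ger0_norm; lra.
  apply: le_trans Ez _.
  have : l / (8 * d%:R) * t <= (energy l G)^`().[x] * (1 - (1 - t)).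
    by rewrite (_ : 1 - (1 - t) = t) ?ler_wpM2r//; lra.
  rewrite -Ex E1.
  have -> : l / (8 * d%:R) * t = (80 * d%:R)^-1.
    by rewrite /t; field; rewrite !gt_eqF//; lra.
  lra.
have [e0 e1] : 0 < (160 * d%:R)^-1 :> R /\ (160 * d%:R)^-1 <= 1 :> R.
  by rewrite invr_gt0 invf_le1; lra.
rewrite -ler_sqr ?nnegrE//; last lra.
rewrite real_normK ?num_real//; apply: le_trans Gz _.
have -> : (80 * d%:R)^-1 = 2 * (160 * d%:R)^-1 :> R by field; rewrite gt_eqF//; lra.
have := sqr_ge0 ((160 * d%:R)^-1 : R); rewrite !expr2; lra.
Qed.

(** The left side is the squared norm, divided by [N^2], of the second difference of the evaluation
    map along an arc with step of cosine [c]; the endpoints have inner product [2 c^2 - 1]. The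
    linear Taylor terms at [1] leave only [4 (l / d) (1 - c)^2], and [7 = 2 + 1 + 4] collects this
    term and the two remainders. *)
Lemma gegenbauer_diff2_norm c : 0 <= c <= 1 ->
  6 - 8 * G.[c] + 2 * G.[2 * c ^+ 2 - 1] <= 7 * l ^+ 2 * (1 - c) ^+ 2.
Proof.
move=> /andP[c0 c1]; set y := 2 * c ^+ 2 - 1.
have d2' := d2; have l0' := l0; have ld' := ld.
have c2 : 0 <= c ^+ 2 <= 1 by rewrite sqr_ge0 expr_le1.
have yb : -1 <= y <= 1 by rewrite /y; lra.
pose B : R := l ^+ 2 / (d%:R * (d%:R + 2)).
have T x : -1 <= x <= 1 -> `|G.[x] - 1 - l / d%:R * (x - 1)| <= B * (x - 1) ^+ 2.
  move=> x1; have := @poly_taylor1 _ G 1 x B.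
  rewrite gegenbauer1 gegenbauer_deriv1; apply=> t tx; apply: gegenbauer_deriv2_le.
  rewrite ler_norml; move: tx; rewrite min_r ?max_l; lra.
have B0 : 0 <= B by rewrite divr_ge0 ?sqr_ge0// mulr_ge0//; lra.
have B8 : B <= l ^+ 2 / 8.
  rewrite ler_wpM2l ?sqr_ge0// lef_pV2 ?posrE ?mulr_gt0//; try lra.
  have : 2 * 4 <= d%:R * (d%:R + 2) :> R by apply: ler_pM; lra.
  lra.
have := T c; have := T y; rewrite yb c1 (_ : -1 <= c) ?ler_norml; last lra.
move=> /(_ isT) /andP[_ Ty] /(_ isT) /andP[Tc _].
have e1 : 0 <= (1 - c) ^+ 2 by exact: sqr_ge0.
have Ey : (y - 1) ^+ 2 <= 16 * (1 - c) ^+ 2.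
  have -> : y - 1 = - (2 * (1 + c) * (1 - c)) by rewrite /y; ring.
  rewrite sqrrN exprMn ler_wpM2r// (_ : 16 = 4 ^+ 2) ?ler_sqr ?nnegrE; last by ring.
    lra.
  lra.
  lra.
have BE : B * (y - 1) ^+ 2 <= 16 * (B * (1 - c) ^+ 2).
  by rewrite [leRHS]mulrCA ler_wpM2l.
have -> : 6 - 8 * G.[c] + 2 * G.[y] =
    4 * (l / d%:R) * (1 - c) ^+ 2 - 8 * (G.[c] - 1 - l / d%:R * (c - 1)) +
    2 * (G.[y] - 1 - l / d%:R * (y - 1)).
  by rewrite /y; ring.
have ldd : l / d%:R * (1 - c) ^+ 2 <= l ^+ 2 / 2 * (1 - c) ^+ 2.
  rewrite ler_wpM2r// ler_pdivrMr; last lra.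
  have : l * 1 <= l * (d%:R / 2 * l) by rewrite ler_wpM2l//; nra.
  by rewrite expr2; lra.
have BE2 : B * (1 - c) ^+ 2 <= l ^+ 2 / 8 * (1 - c) ^+ 2 by rewrite ler_wpM2r.
have e2 : (c - 1) ^+ 2 = (1 - c) ^+ 2 by ring.
move: Tc; rewrite e2; lra.
Qed.

(** Here [z] is the cosine of the distance to the centre of an arc, and [z c + w], [z c - w] are the
    cosines of the distances to its ends. The linear term of the expansion at [z] is at most
    [- 1.755 (l / d) (1 - c)], and the remainder at most a quarter of [(l / d) (1 - c)]. *)
Lemma gegenbauer_diff2 z c w :
  1 - (10 * l)^-1 <= z <= 1 -> 1 - (10 * l)^-1 <= c <= 1 ->
  w ^+ 2 = (1 - z ^+ 2) * (1 - c ^+ 2) ->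
  G.[z * c + w] + G.[z * c - w] - 2 * G.[z] <= - (l / d%:R) * (1 - c).
Proof.
move=> /andP[z0 z1] /andP[c0 c1] ew.
have d2' := d2; have l0' := l0; have ld' := ld.
have := inv10; set t := (10 * l)^-1 in z0 c0 * => /andP[i0 i1].
have lt : l * t = 1 / 10 by rewrite /t; field; rewrite gt_eqF.
pose B : R := l ^+ 2 / (d%:R * (d%:R + 2)).
have B0 : 0 <= B by rewrite divr_ge0 ?sqr_ge0// mulr_ge0//; lra.
have T x : `|x| <= 1 -> G.[x] - G.[z] - G^`().[z] * (x - z) <= B * (x - z) ^+ 2.
  move=> x1; apply: le_trans (ler_norm _) _.
  apply: poly_taylor1 => y yx; apply: gegenbauer_deriv2_le.
  rewrite ler_norml; move: yx x1; rewrite ler_norml.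
  by case: (leP z x) => _; lra.
(* [z c + s] is the cosine of a sum or a difference of two angles. Without angles, this is the
   inequality of the means for [a] and [b], since [(z c s)^2 = a b]. *)
have zcw s : s ^+ 2 = w ^+ 2 -> `|z * c + s| <= 1.
  move=> es; rewrite -(@expr_le1 _ 2)// real_normK ?num_real//.
  have z2 : 0 <= z ^+ 2 <= 1 by rewrite sqr_ge0 expr_le1//; lra.
  have c2 : 0 <= c ^+ 2 <= 1 by rewrite sqr_ge0 expr_le1//; lra.
  pose a := z ^+ 2 * (1 - c ^+ 2); pose b := c ^+ 2 * (1 - z ^+ 2).
  have ab0 : 0 <= a + b by rewrite addr_ge0// mulr_ge0//; lra.
  have : 2 * (z * c * s) <= a + b.
    apply: le_trans (ler_norm _) _.
    rewrite -ler_sqr ?nnegrE// real_normK ?num_real//.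
    have -> : (2 * (z * c * s)) ^+ 2 = (a + b) ^+ 2 - (a - b) ^+ 2.
      by rewrite !exprMn es ew /a /b; ring.
    by rewrite gerBl sqr_ge0.
  have -> : (z * c + s) ^+ 2 = z ^+ 2 * c ^+ 2 + 2 * (z * c * s) + s ^+ 2 by ring.
  rewrite es ew /a /b; nra.
have Tp := T _ (zcw w erefl).
have Tm := T _ (zcw (- w) (sqrrN w)).
have [G'z _] : l / (2 * d%:R) <= G^`().[z] /\ 0 <= G.[z].
  by apply: gegenbauer_near1; rewrite z0.
have G'z2 : l / d%:R * (39 / 40) <= G^`().[z].
  have H2 : `|G^`().[z] - G^`().[1]| <= B * `|z - 1|.
    apply: poly_lipschitz => x; rewrite min_r// max_l// => /andP[zx x1].
    by apply: gegenbauer_deriv2_le; rewrite ger0_norm//; lra.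
  have zt : B * `|z - 1| <= B * t.
    by rewrite ler_wpM2l// distrC ger0_norm; lra.
  have Bt : B * t <= l / d%:R * (1 / 40).
    have -> : B * t = l / d%:R * (1 / (10 * (d%:R + 2))).
      by rewrite /B /t; field; rewrite !gt_eqF//; lra.
    rewrite ler_wpM2l ?divr_ge0 ?(ltW l0)//.
    by rewrite !mul1r lef_pV2 ?posrE; lra.
  by move: H2; rewrite gegenbauer_deriv1 ler_norml; lra.
have sumT : G.[z * c + w] + G.[z * c - w] - 2 * G.[z] <=
    - (2 * z * (1 - c)) * G^`().[z] + B * (2 * z ^+ 2 * (1 - c) ^+ 2 + 2 * w ^+ 2).
  by move: Tp Tm; lra.
apply: le_trans sumT _.
have ld0 : 0 <= l / d%:R by rewrite divr_ge0//; lra.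
have first : (2 * (9 / 10) * (1 - c)) * (l / d%:R * (39 / 40)) <= (2 * z * (1 - c)) * G^`().[z].
  apply: ler_pM => //; first by rewrite mulr_ge0//; lra.
    by rewrite mulr_ge0//; lra.
  by rewrite ler_wpM2r//; lra.
have second : B * (2 * z ^+ 2 * (1 - c) ^+ 2 + 2 * w ^+ 2) <= l / d%:R * (1 - c) * (1 / 4).
  have -> : 2 * z ^+ 2 * (1 - c) ^+ 2 + 2 * w ^+ 2 =
      (1 - c) * (2 * z ^+ 2 * (1 - c) + 2 * (1 - z) * ((1 + z) * (1 + c))).
    by rewrite ew; ring.
  have z2 : z ^+ 2 <= 1 by rewrite expr_le1//; lra.
  have H1 : 2 * z ^+ 2 * (1 - c) + 2 * (1 - z) * ((1 + z) * (1 + c)) <= 10 * t.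
    have : z ^+ 2 * (1 - c) <= 1 * t by apply: ler_pM => //; rewrite ?sqr_ge0//; lra.
    have : (1 - z) * ((1 + z) * (1 + c)) <= t * 4.
      apply: ler_pM => //; [lra|by rewrite mulr_ge0//; lra|lra|].
      by rewrite (_ : 4 = 2 * 2); [apply: ler_pM; lra|ring].
    lra.
  apply: le_trans (_ : B * ((1 - c) * (10 * t)) <= _).
    by rewrite ler_wpM2l// ler_wpM2l//; lra.
  have -> : B * ((1 - c) * (10 * t)) = l / d%:R * (1 - c) * (1 / (d%:R + 2)).
    by rewrite /B /t; field; rewrite !gt_eqF//; lra.
  apply: ler_wpM2l; first by rewrite mulr_ge0// subr_ge0.
  by rewrite !mul1r lef_pV2 ?posrE; lra.
have := mulr_ge0 ld0 (_ : 0 <= 1 - c); rewrite subr_ge0 => /(_ c1); nra.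
Qed.

End normalized.

From mathcomp Require Import all_classical all_reals all_analysis.
From mathcomp Require Import measurable_realfun.
Import Order.TTheory GRing.Theory Num.Theory.
Import numFieldNormedType.Exports.
Local Open Scope classical_set_scope.
Local Open Scope ring_scope.

(** * Rational homology of star-shaped spaces *)

Section chain_push.
Implicit Types T U V : choiceType.

Definition finsupp T (c : T -> rat) := finite_set [set s | c s != 0].

(** An explicit list carrying the support, through which sums over sets become sums over lists. *)
Definition supported T (S : seq T) (c : T -> rat) :=
  uniq S /\ forall s, s \notin S -> c s = 0.

Lemma finsuppP T (c : T -> rat) : finsupp c <-> exists S, supported S c.
Proof.
split=> [/finite_seqP[X cX]|[S [_ cS]]].
  exists (undup X); split=> [|s]; first exact: undup_uniq.
  rewrite mem_undup => sX; apply/eqP/negP => /negP c0.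
  have : [set s | c s != 0] s by [].
  by rewrite cX /= => sX'; move: sX; rewrite sX'.
apply: (@sub_finite_set _ _ [set` S]); last exact: finite_seq.
move=> s /= c0; apply/negP => /negP /cS cs; by rewrite cs eqxx in c0.
Qed.

(** Linear extension of [F] to formal combinations. The boundary is an alternating sum of pushes
    along faces and the cone operator is a push, so chain identities reduce to identities between
    maps of simplices. *)
Definition push T U (F : T -> U) (c : T -> rat) (u : U) : rat :=
  \sum_(s \in [set s | F s = u]) c s.

Lemma pushE T U (F : T -> U) S c u : supported S c ->
  push F c u = \sum_(s <- S | F s == u) c s.
Proof.
move=> [uS cS]; rewrite bigfs//; last by move=> s _ /cS.
rewrite /push (_ : [set s | F s = u] = [set` fun i => F i == u])//.
by apply/seteqP; split => s /= /eqP.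
Qed.

Lemma push_supported T U (F : T -> U) S c : supported S c ->
  supported (undup (map F S)) (push F c).
Proof.
move=> cS; split=> [|u]; first exact: undup_uniq.
rewrite mem_undup => uS; rewrite (pushE _ _ cS) big1_seq// => s /andP[/eqP Fs sS].
by move: uS; rewrite -Fs map_f.
Qed.

Lemma push_finsupp T U (F : T -> U) c : finsupp c -> finsupp (push F c).
Proof.
by move=> /finsuppP[S cS]; apply/finsuppP; exists (undup (map F S)); exact: push_supported.
Qed.

Lemma push_comp T U V (F : T -> U) (G : U -> V) c : finsupp c ->
  push G (push F c) = push (G \o F) c.
Proof.
move=> /finsuppP[S cS]; apply/funext => v.
rewrite (pushE _ _ (push_supported F cS)) (pushE _ _ cS).
under eq_bigr do rewrite (pushE _ _ cS).
rewrite big_mkcond/= [RHS]big_mkcond/=.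
transitivity (\sum_(u <- undup (map F S)) \sum_(s <- S)
    if (G u == v) && (F s == u) then c s else 0).
  apply: eq_bigr => u _; case: (G u == v) => /=; first by rewrite big_mkcond.
  by rewrite big1.
rewrite exchange_big/=; apply: eq_big_seq => s sS.
rewrite (bigD1_seq (F s)) ?undup_uniq ?mem_undup ?map_f//= eqxx andbT.
by rewrite big1 ?addr0// => u /negbTE; rewrite eq_sym => ->; rewrite andbF.
Qed.

Lemma push_id T c : push (@id T) c = c.
Proof.
apply/funext => t; rewrite /push.
rewrite (_ : [set s | s = t] = [set t]) ?fsbig_set1//.
Qed.

Lemma finsuppD T (c e : T -> rat) : finsupp c -> finsupp e -> finsupp (c \+ e).
Proof.
move=> fc fe; apply: (@sub_finite_set _ _ ([set s | c s != 0] `|` [set s | e s != 0])).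
  move=> s /=; apply: contraPP => /not_orP[/negP + /negP +].
  by rewrite !negbK => /eqP -> /eqP ->; rewrite addr0 eqxx.
by rewrite finite_setU.
Qed.

Lemma finsuppZ T a (c : T -> rat) : finsupp c -> finsupp (fun s => a * c s).
Proof.
apply: sub_finite_set => s /=; apply: contraNN => /eqP ->.
by rewrite mulr0.
Qed.

Lemma finsupp0 T : finsupp (fun _ : T => 0).
Proof.
by rewrite /finsupp (_ : [set _ | _] = set0)//; apply/seteqP; split => s //=; rewrite eqxx.
Qed.

Lemma pushD T U (F : T -> U) (c e : T -> rat) : finsupp c -> finsupp e ->
  push F (fun s => c s + e s) = (fun u => push F c u + push F e u).
Proof.
move=> /finsuppP[S [uS cS]] /finsuppP[S' [uS' cS']].
have c1 : supported (undup (S ++ S')) c.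
  split=> [|s]; first exact: undup_uniq.
  by rewrite mem_undup mem_cat => /norP[/cS].
have c2 : supported (undup (S ++ S')) e.
  split=> [|s]; first exact: undup_uniq.
  by rewrite mem_undup mem_cat => /norP[_ /cS'].
have c3 : supported (undup (S ++ S')) (fun s => c s + e s).
  split=> [|s]; first exact: undup_uniq.
  by move=> sS; rewrite c1.2// c2.2// addr0.
apply/funext => u; rewrite (pushE _ _ c1) (pushE _ _ c2) (pushE _ _ c3).
exact: big_split.
Qed.

Lemma pushZ T U (F : T -> U) a (c : T -> rat) : finsupp c ->
  push F (fun s => a * c s) = (fun u => a * push F c u).
Proof.
move=> /finsuppP[S cS].
have c3 : supported S (fun s => a * c s).
  by split=> [|s /cS.2 ->]; [exact: cS.1|rewrite mulr0].
apply/funext => u; rewrite (pushE _ _ cS) (pushE _ _ c3).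
by rewrite mulr_sumr.
Qed.

Lemma push0 T U (F : T -> U) : push F (fun _ => 0) = (fun _ => 0).
Proof. by apply/funext => u; rewrite /push fsbig1. Qed.

Lemma finsupp_sum_seq T (I : Type) (r : seq I) (a : I -> rat) (c : I -> T -> rat) :
  (forall i, finsupp (c i)) -> finsupp (fun s => \sum_(i <- r) a i * c i s).
Proof.
move=> fc; elim: r => [|i r IH].
  by under eq_fun do rewrite big_nil; exact: finsupp0.
under eq_fun do rewrite big_cons; exact: finsuppD (finsuppZ _ (fc i)) IH.
Qed.

Lemma push_sum_seq T U (F : T -> U) (I : Type) (r : seq I) (a : I -> rat)
    (c : I -> T -> rat) : (forall i, finsupp (c i)) ->
  push F (fun s => \sum_(i <- r) a i * c i s) =
  (fun u => \sum_(i <- r) a i * push F (c i) u).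
Proof.
move=> fc; elim: r => [|i r IH].
  rewrite (_ : (fun s => _) = fun=> 0).
    by rewrite push0; apply/funext => u; rewrite big_nil.
  by apply/funext => s; rewrite big_nil.
rewrite (_ : (fun s => _) = fun s => a i * c i s + \sum_(i <- r) a i * c i s).
  rewrite pushD; [|exact: finsuppZ|exact: finsupp_sum_seq].
  by rewrite pushZ// IH; apply/funext => u; rewrite big_cons.
by apply/funext => s; rewrite big_cons.
Qed.

End chain_push.

Lemma cvg_row (R : topologicalType) (T : Type) (F : set_system T) (FF : Filter F)
    (n : nat) (f : T -> 'rV[R]_n) (M : 'rV[R]_n) :
  (forall i, (fun t => f t 0 i) @ F --> M 0 i) -> f @ F --> M.
Proof.
move=> H U [P MP sPU].
have : \forall t \near F, forall i, P 0 i (f t 0 i).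
  by apply: filter_forall => i; exact: (H i _ (MP 0 i)).
apply: filterS => t Pt; apply: sPU => i j /=.
by rewrite (ord1 i).
Qed.

Lemma cvg_set_type (X : topologicalType) (A : set X) (T : Type)
    (F : set_system T) (FF : Filter F) (f : T -> A) (a : A) :
  (fun t => val (f t)) @ F --> val a -> f @ F --> a.
Proof.
move=> H U [_ [[W oW <-] /= Wa WU]].
have H1 : F (fun t => W (val (f t))) := H W (open_nbhs_nbhs (conj oW Wa)).
exact: (@filterS _ F FF _ _ (fun t Wt => WU (f t) Wt) H1).
Qed.

Lemma set_val_continuous (X : topologicalType) (A : set X) :
  continuous (fun a : A => val a : X).
Proof. exact: initial_continuous. Qed.

(** * Cone coordinates on a simplex with apex at vertex 0 *)

Section cone.
Variables (R : realType).
Local Notation std k := (@std_simplex R k).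

Definition simplex_vertex (k : nat) : 'rV[R]_k.+1 := delta_mx 0 0.

Lemma simplex_vertexP k : std k (simplex_vertex k).
Proof.
split=> [i|]; first by rewrite mxE; case: (_ && _).
rewrite (bigD1 0)//= mxE eqxx big1 ?addr0// => i /negbTE i0.
by rewrite mxE i0 andbF.
Qed.

(** Projection from vertex 0 onto the opposite face. At the vertex itself the projection is
    undefined; the value there is arbitrary, and harmless because the contraction at height 0
    depends on the class alone. *)
Definition cone_base_row k (t : 'rV[R]_k.+2) : 'rV[R]_k.+1 :=
  if t 0 0 == 1 then simplex_vertex k
  else \row_i (t 0 (lift ord0 i) / (1 - t 0 0)).

Lemma std_simplex_le1 k (t : 'rV[R]_k.+1) i : std k t -> 0 <= t 0 i <= 1.
Proof.
move=> [t0 t1]; rewrite t0 -t1 (bigD1 i)//= lerDl.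
by apply: sumr_ge0 => j _; exact: t0.
Qed.

Lemma cone_base_rowP k (t : 'rV[R]_k.+2) : std k.+1 t -> std k (cone_base_row t).
Proof.
move=> st; have [t0 t1] := st; rewrite /cone_base_row; case: eqP => [_|/eqP n1].
  exact: simplex_vertexP.
have /andP[_ le1] := std_simplex_le1 0 st.
have p0 : 0 < 1 - t 0 0 by rewrite subr_gt0 lt_neqAle n1.
split=> [i|]; first by rewrite mxE divr_ge0// ltW.
under eq_bigr do rewrite mxE.
have E : 1 - t 0 0 = \sum_i t 0 (lift ord0 i).
  by rewrite -t1 big_ord_recl addrC addKr.
by rewrite -mulr_suml -E divff// gt_eqF.
Qed.

Definition cone_base k (t : std k.+1) : std k :=
  SigSub (mem_set (cone_base_rowP (set_valP t))).

Definition cone_height k (t : std k.+1) : R := 1 - val t 0 0.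

Lemma cone_height_ge0 k (t : std k.+1) : 0 <= cone_height t.
Proof. by have := std_simplex_le1 0 (set_valP t) => /andP[_]; rewrite subr_ge0. Qed.

Lemma simplex_coord_continuous k i :
  continuous (fun t : std k => (val t : 'rV[R]_k.+1) 0 i).
Proof.
move=> t; apply: (@continuous_comp _ _ _ (fun t : std k => val t : 'rV[R]_k.+1)
  (fun v => v 0 i)).
  exact: set_val_continuous.
exact: coord_continuous.
Qed.

Lemma cone_height_continuous k : continuous (@cone_height k).
Proof.
move=> t; apply: (@cvgB R R^o _ (nbhs t) _ (fun=> 1) (fun t : std k.+1 => (val t : 'rV[R]_k.+2) 0 0)).
  exact: cst_continuous.
exact: simplex_coord_continuous.
Qed.

Lemma cone_base_continuous k (t : std k.+1) : cone_height t != 0 ->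
  {for t, continuous (@cone_base k)}.
Proof.
move=> h0; apply: cvg_set_type => /=; first exact: (nbhs_filter t).
have ne : forall t : std k.+1, (val t 0 0 == 1) = (cone_height t == 0).
  by move=> u; rewrite /cone_height subr_eq0 eq_sym.
have hn : \forall u \near t, cone_height u != 0.
  apply: (@cone_height_continuous k t [set y | y != 0]).
  by apply: open_nbhs_nbhs; split => //=; exact: open_neq.
pose g (u : std k.+1) : 'rV[R]_k.+1 :=
  \row_i (val u 0 (lift ord0 i) / cone_height u).
have gE : \forall u \near nbhs t, g u = cone_base_row (val u).
  move: hn; apply: filterS => u hu.
  by rewrite /cone_base_row ne ifN.
apply: (cvg_trans (@near_eq_cvg _ _ (nbhs t) (nbhs_filter t) _ _ gE)).
rewrite /cone_base_row ne (negbTE h0).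
apply: cvg_row => i.
rewrite /g; under eq_fun do rewrite mxE; rewrite mxE.
apply: (@cvgM R _ (nbhs t) _ (fun t : std k.+1 => (val t : 'rV[R]_k.+2) 0 (lift ord0 i)) (fun u => (cone_height u)^-1)).
  exact: simplex_coord_continuous.
apply: cvgV => //; exact: cone_height_continuous.
Qed.

Lemma cone_height_face0 k (t : std k) : cone_height (face_map 0 t) = 1.
Proof. by rewrite /cone_height /= mxE unlift_none subr0. Qed.

Lemma cone_base_face0 k (t : std k) : cone_base (face_map 0 t) = t.
Proof.
apply/val_inj; rewrite /= /cone_base_row /= mxE unlift_none eq_sym oner_eq0.
by apply/rowP => i; rewrite !mxE liftK subr0 divr1.
Qed.

Lemma cone_height_faceS k (i : 'I_k.+2) (t : std k.+1) :
  cone_height (face_map (lift ord0 i) t) = cone_height t.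
Proof.
rewrite /cone_height /= mxE.
have -> : 0 = lift (lift ord0 i) 0 :> 'I_k.+3 by apply/val_inj.
by rewrite liftK.
Qed.

Lemma cone_base_faceS k (i : 'I_k.+2) (t : std k.+1) : cone_height t != 0 ->
  cone_base (face_map (lift ord0 i) t) = face_map i (cone_base t).
Proof.
move=> h0; apply/val_inj => /=; rewrite /cone_base_row.
have E : face_row (lift ord0 i) (val t) 0 0 = val t 0 0.
  rewrite mxE.
  have -> : 0 = lift (lift ord0 i) 0 :> 'I_k.+3 by apply/val_inj.
  by rewrite liftK.
rewrite E; have -> : (val t 0 0 == 1) = false.
  by apply/negbTE; move: h0; rewrite /cone_height subr_eq0 eq_sym.
apply/rowP => j; rewrite !mxE; case: (unliftP i j) => [l ->|->].
  rewrite mxE.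
  have -> : lift ord0 (lift i l) = lift (lift ord0 i) (lift ord0 l).
    by apply/val_inj; rewrite /= /bump /=; case: leqP => ?; case: leqP => ?; lia.
  by rewrite liftK.
by rewrite unlift_none mul0r.
Qed.

End cone.

Definition clamp (R : realType) (t : R) : R := Num.min 1 (Num.max 0 t).

Lemma clamp_itv (R : realType) (t : R) : 0 <= clamp t <= 1.
Proof. by rewrite /clamp le_min ler01 le_max lexx ge_min lexx. Qed.

Lemma clamp_id (R : realType) (t : R) : 0 <= t <= 1 -> clamp t = t.
Proof. by move=> /andP[t0 t1]; rewrite /clamp max_r// min_r. Qed.

Lemma clamp_continuous (R : realType) : continuous (@clamp R).
Proof.
move=> t; apply: (@continuous_min R R (fun=> 1) (fun t => Num.max 0 t)).
  exact: cst_continuous.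
apply: (@continuous_max R R (fun=> 0) (fun t => t)).
  exact: cst_continuous.
exact: cvg_id.
Qed.

Lemma locally_constant_line (R : realType) (I : Type) (g : R -> I) (a b : R) :
  (forall j, open [set s | g s = j]) -> g a = g b.
Proof.
move=> gO; have cR : connected [set: R] by apply/connected_intervalP.
have := cR [set s | g s = g a]; move=> H.
suff E : [set s | g s = g a] = setT.
  by have /= -> : [set s | g s = g a] b by rewrite E.
apply: H; first by exists a.
  by exists [set s | g s = g a]; rewrite ?setTI.
exists [set s | g s = g a]; rewrite ?setTI//.
rewrite -openC (_ : ~` _ = \bigcup_(j in [set j | j <> g a]) [set s | g s = j]).
  by apply: bigcup_open => j _; exact: gO.
apply/seteqP; split => s /=; first by move=> ns; exists (g s).
by move=> [j ja gs] sa; apply: ja; rewrite -gs.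
Qed.

(** * A simplex stays in one class of a partition into open sets *)

Section simplex_connected.
Variables (R : realType) (X : topologicalType) (I : Type) (comp : X -> I).
Hypothesis comp_open : forall j, open [set x | comp x = j].
Local Notation std k := (@std_simplex R k).

Definition segment_row k (t u : 'rV[R]_k.+1) (s : R) :=
  (1 - clamp s) *: t + clamp s *: u.

Lemma segment_rowP k (t u : 'rV[R]_k.+1) s :
  std k t -> std k u -> std k (segment_row t u s).
Proof.
move=> [t0 t1] [u0 u1]; have /andP[s0 s1] := clamp_itv s; split=> [i|].
  by rewrite !mxE addr_ge0// mulr_ge0// subr_ge0.
under eq_bigr do rewrite !mxE.
by rewrite big_split/= -!mulr_sumr t1 u1 !mulr1 subrK.
Qed.

Definition segment k (t u : std k) (s : R) : std k :=
  SigSub (mem_set (segment_rowP s (set_valP t) (set_valP u))).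

Lemma segment_continuous k (t u : std k) : continuous (segment t u).
Proof.
move=> s; apply: cvg_set_type => /=; apply: cvg_row => i.
rewrite /segment_row; under eq_fun do rewrite !mxE; rewrite !mxE.
apply: cvgD; (apply: cvgM; last exact: cvg_cst).
  by apply: cvgB; [exact: cvg_cst|exact: clamp_continuous].
exact: clamp_continuous.
Qed.

Lemma segment0 k (t u : std k) : segment t u 0 = t.
Proof.
apply/val_inj; rewrite /= /segment_row clamp_id ?lexx ?ler01//.
by rewrite subr0 scale1r scale0r addr0.
Qed.

Lemma segment1 k (t u : std k) : segment t u 1 = u.
Proof.
apply/val_inj; rewrite /= /segment_row clamp_id ?lexx ?ler01//.
by rewrite subrr scale1r scale0r add0r.
Qed.

Lemma simplex_comp_constant k (s : singular_simplex R X k) t u :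
  comp (simplex_fun s t) = comp (simplex_fun s u).
Proof.
rewrite -(segment0 t u) -[in RHS](segment1 t u).
apply: (@locally_constant_line _ _ (fun r => comp (simplex_fun s (segment t u r)))).
move=> j.
have cs : continuous (simplex_fun s \o segment t u).
  move=> r; apply: continuous_comp; first exact: segment_continuous.
  exact: (set_valP s).
by have /continuousP /(_ _ (comp_open j)) := cs.
Qed.

End simplex_connected.

(** * Homology of a space contracting onto one point per class *)

Section star_homology.
Variables (R : realType) (X : topologicalType) (b : nat).
Variables (p : 'I_b -> X) (comp : X -> 'I_b) (H : X -> R -> X).
Hypothesis comp_open : forall j, open [set x | comp x = j].
Hypothesis comp_p : forall j, comp (p j) = j.
Hypothesis H1 : forall x, H x 1 = x.
Hypothesis H0 : forall x, H x 0 = p (comp x).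
Hypothesis Hcont : forall x s, 0 < s ->
  {for (x, s), continuous (fun q : X * R => H q.1 q.2)}.
(** Stands in for continuity at [s = 0]. Close to the apex of a cone the projection to the base
    takes values all over the base, so the contraction has to approach the base point uniformly over
    the class. *)
Hypothesis Hunif : forall j (U : set X), nbhs (p j) U ->
  exists2 e, 0 < e & forall x s, comp x = j -> 0 <= s -> s < e -> U (H x s).

Local Notation std k := (@std_simplex R k).
Local Notation simp k := (singular_simplex R X k).

Definition cone_fun k (s : simp k) (t : std k.+1) : X :=
  H (simplex_fun s (cone_base t)) (cone_height t).

Lemma cone_fun_continuous k (s : simp k) : continuous (cone_fun s).
Proof.
move=> t; have [h0|h0] := eqVneq (cone_height t) 0; last first.
  have h1 : 0 < cone_height t by rewrite lt_def h0 cone_height_ge0.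
  apply: (@continuous_comp _ _ _
    (fun t => (simplex_fun s (cone_base t), cone_height t))
    (fun q : X * R => H q.1 q.2)); last exact: Hcont.
  apply: (@cvg_pair _ _ _ (nbhs t) (nbhs (simplex_fun s (cone_base t)))
    (nbhs (cone_height t)) (nbhs_filter t) (nbhs_filter _) (nbhs_filter _)); last exact: cone_height_continuous.
  apply: continuous_comp; first exact: cone_base_continuous.
  exact: (set_valP s).
move=> U; rewrite /cone_fun h0 H0; set j := comp _ => /Hunif[e e0 He].
have : \forall u \near nbhs t, cone_height u < e.
  apply: (@cone_height_continuous R k t [set y | y < e]).
  by apply: open_nbhs_nbhs; split; [exact: open_lt|rewrite /= h0].
apply: filterS => u ue; apply: He => //; last exact: cone_height_ge0.
exact: simplex_comp_constant.
Qed.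

Definition cone k (s : simp k) : simp k.+1 :=
  SigSub (mem_set (@cone_fun_continuous k s : [set f : std k.+1 -> X | continuous f] _)).

Lemma face_map_continuous k (i : 'I_k.+2) : continuous (@face_map R k i).
Proof.
move=> t; apply: cvg_set_type => /=; first exact: (nbhs_filter t).
apply: (@cvg_row R _ (nbhs t) (nbhs_filter t)) => j; rewrite /face_row; under eq_fun do rewrite mxE; rewrite mxE.
case: unlift => [l|]; last exact: (@cvg_cst R (0 : R) _ (nbhs t) (nbhs_filter t)).
exact: simplex_coord_continuous.
Qed.

Lemma face_continuous k (i : 'I_k.+2) (s : simp k.+1) :
  continuous (simplex_fun s \o @face_map R k i).
Proof.
move=> t; apply: continuous_comp; first exact: face_map_continuous.
exact: (set_valP s).
Qed.

Definition face k (i : 'I_k.+2) (s : simp k.+1) : simp k :=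
  SigSub (mem_set (@face_continuous k i s : [set f : std k -> X | continuous f] _)).

Lemma simplex_fun_inj k : injective (@simplex_fun R X k).
Proof. by move=> s t st; apply/val_inj. Qed.

Lemma boundaryE k (c : simp k.+1 -> rat) :
  boundary c = (fun t => \sum_(i < k.+2) (-1) ^+ i * push (face i) c t).
Proof.
apply/funext => t; apply: eq_bigr => i _; congr (_ * _).
rewrite /push (_ : [set s | _] = [set s | face i s = t])//.
apply/seteqP; split => s /=; last by move=> <-.
by move=> E; apply: simplex_fun_inj.
Qed.

Lemma face0_cone k (s : simp k) : face 0 (cone s) = s.
Proof.
apply: simplex_fun_inj; apply/funext => t /=.
by rewrite /cone_fun cone_base_face0 cone_height_face0 H1.
Qed.

Lemma faceS_cone k (i : 'I_k.+2) (s : simp k.+1) :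
  face (lift ord0 i) (cone s) = cone (face i s).
Proof.
apply: simplex_fun_inj; apply/funext => t /=.
rewrite /cone_fun cone_height_faceS.
have [->|h0] := eqVneq (cone_height t) 0; last by rewrite cone_base_faceS.
by rewrite !H0; congr p; exact: simplex_comp_constant.
Qed.

Lemma base_simplex_continuous j : continuous ((fun=> p j) : std 0 -> X).
Proof. exact: cst_continuous. Qed.

Definition base_simplex (j : 'I_b) : simp 0 :=
  SigSub (mem_set (@base_simplex_continuous j : [set f : std 0 -> X | continuous f] _)).

Definition simplex_comp k (s : simp k) : 'I_b :=
  comp (simplex_fun s (SigSub (mem_set (simplex_vertexP R k)))).

Lemma face1_cone (s : simp 0) :
  face 1 (cone s) = base_simplex (simplex_comp s).
Proof.
apply: simplex_fun_inj; apply/funext => t /=.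
rewrite /cone_fun (_ : cone_height _ = 0).
  by rewrite H0; congr p; exact: simplex_comp_constant.
rewrite /cone_height /= mxE.
have -> : 0 = lift 1 0 :> 'I_2 by apply/val_inj.
rewrite liftK; have [_] := set_valP t; rewrite big_ord1 => ->.
by rewrite subrr.
Qed.

Lemma simplex_comp_face k (i : 'I_k.+2) (s : simp k.+1) :
  simplex_comp (face i s) = simplex_comp s.
Proof. exact: (simplex_comp_constant comp_open s). Qed.

(** Face 0 of a cone is the simplex itself, and the other faces are the cones of its faces, with the
    sign shifted by one. A cycle of positive degree is therefore the boundary of its cone. *)
Lemma boundary_coneS k (c : simp k.+1 -> rat) : finsupp c ->
  boundary (push (@cone k.+1) c) =
  (fun t => c t - push (@cone k) (boundary c) t).
Proof.
move=> fc; apply/funext => t; rewrite !boundaryE big_ord_recl expr0 mul1r.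
rewrite push_comp// (_ : face 0 \o _ = id) ?push_id; last first.
  by apply/funext => s /=; exact: face0_cone.
congr (_ + _).
rewrite push_sum_seq; last by move=> i; exact: push_finsupp.
rewrite -sumrN; apply: eq_bigr => i _.
rewrite push_comp// (push_comp (face i))//.
rewrite (_ : face (lift ord0 i) \o _ = @cone k \o face i); last first.
  by apply/funext => s /=; exact: faceS_cone.
by rewrite /= /bump /= add1n exprS mulN1r mulNr.
Qed.

(** In degree 0 the other face of the cone is the base point of the class, so a 0-chain is
    homologous to its total weights per class placed at the base points. *)
Lemma boundary_cone0 (c : simp 0 -> rat) : finsupp c ->
  boundary (push (@cone 0) c) =
  (fun t => c t - push base_simplex (push (@simplex_comp 0) c) t).
Proof.
move=> fc; apply/funext => t; rewrite boundaryE big_ord_recl big_ord1 expr0 mul1r.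
rewrite !push_comp// (_ : face 0 \o _ = id) ?push_id; last first.
  by apply/funext => s /=; exact: face0_cone.
rewrite (_ : face _ \o _ = base_simplex \o @simplex_comp 0).
  by rewrite /= /bump /= addn0 expr1 mulN1r.
apply/funext => s /=; rewrite -face1_cone; congr (face _ _); exact/val_inj.
Qed.

(** Both ends of a 1-simplex lie in the same class and cancel. The total weight per class is thus an
    invariant of homology, which makes the base points independent. *)
Lemma push_comp_boundary (e : simp 1 -> rat) : finsupp e ->
  push (@simplex_comp 0) (boundary e) = (fun=> 0).
Proof.
move=> fe; rewrite boundaryE push_sum_seq; last by move=> i; exact: push_finsupp.
apply/funext => j; rewrite big_ord_recl big_ord1 expr0 mul1r !push_comp//.
rewrite (_ : _ \o face 0 = @simplex_comp 1); last first.
  by apply/funext => s; exact: simplex_comp_face.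
rewrite (_ : _ \o face _ = @simplex_comp 1); last first.
  by apply/funext => s; exact: simplex_comp_face.
by rewrite /= expr1 mulN1r subrr.
Qed.

Lemma star_homologyS k : is_betti R X k.+1 0.
Proof.
exists (fun i _ => 0); split=> [[]//|c [fc bc]|q _ []//].
exists (fun=> 0); exists (push (@cone k.+1) c); first exact: push_finsupp.
move=> s; rewrite big_ord0 subr0 boundary_coneS//.
rewrite (_ : boundary c = fun=> 0) ?push0 ?subr0//.
by apply/funext => t; exact: bc.
Qed.

Definition base_chain (j : 'I_b) (s : simp 0) : rat := (s == base_simplex j)%:R.

Lemma base_chain_finsupp j : finsupp (base_chain j).
Proof.
apply: (@sub_finite_set _ _ [set base_simplex j]) => [s|]; last exact: finite_set1.
by rewrite /base_chain /=; have [//|_] := eqVneq s; rewrite eqxx.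
Qed.

Lemma push_base (c : 'I_b -> rat) :
  push base_simplex c = (fun s => \sum_j c j * base_chain j s).
Proof.
apply/funext => s.
rewrite (@pushE _ _ _ (index_enum 'I_b)); last first.
  by split; [exact: index_enum_uniq|move=> j; rewrite mem_index_enum].
rewrite big_mkcond; apply: eq_bigr => j _; rewrite /base_chain eq_sym.
by case: eqP; rewrite ?mulr1 ?mulr0.
Qed.

Lemma push_comp_base j : push (@simplex_comp 0) (base_chain j) = (fun i => (i == j)%:R).
Proof.
apply/funext => i; rewrite (@pushE _ _ _ [:: base_simplex j]); last first.
  by split=> // s; rewrite inE /base_chain => /negbTE ->.
rewrite big_cons big_nil /base_chain eqxx /simplex_comp /= comp_p eq_sym.
by case: eqP.
Qed.

Lemma star_homology0 : is_betti R X 0 b.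
Proof.
exists base_chain; split=> [j|c fc|q [e fe He] j].
- exact: base_chain_finsupp.
- exists (push (@simplex_comp 0) c); exists (push (@cone 0) c); first exact: push_finsupp.
  by move=> s; rewrite boundary_cone0// push_base.
- have E : (fun s => \sum_j q j * base_chain j s) = boundary e by apply/funext.
  move: (congr1 (push (@simplex_comp 0)) E).
  rewrite push_sum_seq; last exact: base_chain_finsupp.
  rewrite push_comp_boundary// => /(congr1 (fun f => f j)).
  under eq_bigr do rewrite push_comp_base.
  rewrite (bigD1 j)//= eqxx mulr1 big1 ?addr0// => i /negbTE ij.
  by rewrite eq_sym ij mulr0.
Qed.

End star_homology.

(** * Uniqueness of Betti numbers and of the Euler characteristic *)

Section euler.
Variables (R : realType) (X : topologicalType).

Lemma is_boundary_sum k (I : finType) (v : I -> rat)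
    (c : I -> singular_simplex R X k -> rat) :
  (forall i, is_boundary (c i)) -> is_boundary (fun s => \sum_i v i * c i s).
Proof.
move=> /(_ _)/cid2-/all_sig2[e fe He].
exists (fun t => \sum_i v i * e i t); first exact: finsupp_sum_seq.
move=> t; under eq_bigr do rewrite He boundaryE mulr_sumr.
rewrite exchange_big /= boundaryE; apply: eq_bigr => i _.
rewrite push_sum_seq// mulr_sumr; apply: eq_bigr => j _; exact: mulrCA.
Qed.

(** Writing the second basis in terms of the first gives a matrix. A row vector in its left kernel
    would make a combination of independent classes a boundary, so the matrix has free rows and at
    least as many columns. Uniqueness is what lets [xget] return the expected value. *)
Lemma is_betti_le k b b' : is_betti R X k b -> is_betti R X k b' -> (b' <= b)%N.
Proof.
move=> [z [_ span _]] [z' [cz' _ free']].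
have /(_ _)/cid-/all_sig[q Hq] := fun j => span _ (cz' j).
pose A : 'M[rat]_(b', b) := \matrix_(j, i) q j i.
suff /eqP <- : row_free A by exact: rank_leq_col.
rewrite -kermx_eq0; apply/eqP/row_matrixP => r; rewrite row0.
set v := row r _; have vA : v *m A = 0.
  by apply/eqP; rewrite -sub_kermx row_sub.
apply/rowP => j; rewrite [RHS]mxE; move: j; apply: free'.
have := is_boundary_sum (fun j => v 0 j) Hq; congr (is_boundary _).
apply/funext => s; under eq_bigr do rewrite mulrBr.
rewrite sumrB [X in _ - X](_ : _ = 0) ?subr0//.
under eq_bigr do rewrite mulr_sumr.
rewrite exchange_big /= big1// => i _.
under eq_bigr do rewrite mulrA.
rewrite -mulr_suml.
have /(congr1 (fun M : 'rV_b => M 0 i)) := vA; rewrite mxE [RHS]mxE => E.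
rewrite (_ : \sum_j _ = 0) ?mul0r// -[RHS]E; apply: eq_bigr => j _.
by rewrite [A _ _]mxE.
Qed.

Lemma is_betti_unique k b b' : is_betti R X k b -> is_betti R X k b' -> b = b'.
Proof. by move=> B B'; apply/eqP; rewrite eqn_leq !(is_betti_le B B', is_betti_le B' B). Qed.

Lemma euler_char_points b : is_betti R X 0 b ->
  (forall k, is_betti R X k.+1 0) -> euler_char R X = b%:Z.
Proof.
move=> B0 BS; apply: xget_unique.
  exists 1%N, (fun k => if k is _.+1 then 0%N else b); split; [by case|by case|].
  by rewrite big_ord1 expr0 mul1r.
move=> _ [N [c [Bc cN ->]]].
have c0 : c 0%N = b by apply: is_betti_unique B0.
have cS k : c k.+1 = 0%N by apply: is_betti_unique (BS k).
(* With [N = 0] the alternating sum is empty, and [cN] forces [b = 0]. *)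
case: N cN => [|N] cN; first by rewrite big_ord0 -c0 cN.
rewrite big_ord_recl big1 ?addr0 ?expr0 ?mul1r ?c0// => i _.
by rewrite /= cS mulr0.
Qed.

End euler.

Lemma star_euler_char (R : realType) (X : topologicalType) (b : nat)
    (p : 'I_b -> X) (comp : X -> 'I_b) (H : X -> R -> X) :
  (forall j, open [set x | comp x = j]) ->
  (forall j, comp (p j) = j) ->
  (forall x, H x 1 = x) ->
  (forall x, H x 0 = p (comp x)) ->
  (forall x s, 0 < s -> {for (x, s), continuous (fun q : X * R => H q.1 q.2)}) ->
  (forall j (U : set X), nbhs (p j) U -> exists2 e, 0 < e &
     forall x s, comp x = j -> 0 <= s -> s < e -> U (H x s)) ->
  euler_char R X = b%:Z.
Proof.
move=> oc cp H1 H0 Hc Hu; apply: euler_char_points.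
  exact: (star_homology0 oc cp H1 H0 Hc Hu).
by move=> k; apply: (star_homologyS oc H1 H0 Hc Hu).
Qed.

(** * Rotation invariance of the sphere measure *)

Notation pushforward_measure :=
  measure_function_pushforward__canonical__measure_function_Measure.

Lemma measurable_preimage d1 d2 (T1 : measurableType d1) (T2 : measurableType d2)
  (f : T1 -> T2) (A : set T2) :
  measurable_fun setT f -> measurable A -> measurable (f @^-1` A).
Proof. by move=> mf mA; rewrite -[X in measurable X]setTI; exact: mf. Qed.

Section coordinate_update.
Variable R : realType.
Local Notation RR := (measurableTypeR R).
Local Notation leb := (@lebesgue_measure R).

Lemma lebesgue_measure_translation (c : R) (A : set RR) : measurable A ->
  leb ((fun x : R => x + c) @^-1` A) = leb A.
Proof.
move=> mA; have mf : measurable_fun setT (fun x : RR => x + c : RR).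
  by apply: measurable_funD.
rewrite [RHS](@lebesgue_measure_unique R (pushforward_measure leb mf))//.
move=> X [[a b] _ <-] /=; rewrite /pushforward.
rewrite (_ : _ @^-1` _ = `](a - c), (b - c)]%classic).
  rewrite !lebesgue_measure_itv/= !lte_fin ltrD2r.
  by case: ifP => // _; rewrite -!EFinD; congr (_%:E); ring.
by apply/seteqP; split => x /=; rewrite !in_itv/= ltrBlDr lerBrDr.
Qed.

Lemma lebesgue_measure_isometry (e : bool) (c : R) (A : set RR) : measurable A ->
  leb ((fun x : R => (-1) ^+ e * x + c) @^-1` A) = leb A.
Proof.
move=> mA; rewrite -[RHS](lebesgue_measure_translation c)//.
have mB : measurable ((fun x : R => x + c) @^-1` A).
  by apply: measurable_preimage => //; apply: measurable_funD.
case: e; last by congr (leb _); apply/funext => x /=; rewrite mul1r.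
rewrite -[RHS]lebesgue_measureN// /pushforward.
by congr (leb _); apply/funext => x /=; rewrite expr1 mulN1r.
Qed.

(** A change of one coordinate by a sign and a shift. When the shift depends only on the other
    coordinates, it is an isometry on each line parallel to axis [i]. *)
Definition update n (i : 'I_n) (e : bool) (g : n.-tuple RR -> R)
    (t : n.-tuple RR) : n.-tuple RR :=
  [tuple if j == i then (-1) ^+ e * (tnth t i : R) + g t else tnth t j | j < n].

Lemma tnth_update n (i : 'I_n) e g t j :
  tnth (update i e g t) j =
  if j == i then (-1) ^+ e * (tnth t i : R) + g t else tnth t j.
Proof. by rewrite tnth_mktuple. Qed.

Lemma measurable_update n (i : 'I_n) e g : measurable_fun setT g ->
  measurable_fun setT (update i e g).
Proof.
move=> mg; apply/measurable_fun_tnthP => j.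
rewrite (_ : _ \o _ = fun t => if j == i then (-1) ^+ e * (tnth t i : R) + g t
                               else tnth t j).
  case: (j == i); last exact: measurable_tnth.
  by apply: measurable_funD => //; apply: measurable_funM => //; exact: measurable_tnth.
by apply/funext => t /=; rewrite tnth_update.
Qed.

Definition measure_preserving n (f : n.-tuple RR -> n.-tuple RR) :=
  measurable_fun setT f /\ forall A, measurable A ->
    lebesgue_tuple R n (f @^-1` A) = lebesgue_tuple R n A.

Lemma measure_preserving_comp n (f g : n.-tuple RR -> n.-tuple RR) :
  measure_preserving f -> measure_preserving g -> measure_preserving (f \o g).
Proof.
move=> [mf pf] [mg pg]; split; first exact: measurableT_comp mf mg.
move=> A mA; rewrite comp_preimage pg ?pf//.
exact: measurable_preimage.
Qed.

Lemma product_measure12 d1 d2 (T1 : measurableType d1) (T2 : measurableType d2)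
    (m1 : {sigma_finite_measure set T1 -> \bar R})
    (m2 : {sigma_finite_measure set T2 -> \bar R}) (X : set (T1 * T2)) :
  measurable X -> (m1 \x m2)%E X = (m1 \x^ m2)%E X.
Proof.
move=> mX; apply: product_measure_unique => // A B mA mB.
exact: product_measure2E.
Qed.

(** Fubini, following the construction of the measure by adding a first coordinate. If [i] is the
    first one, it is integrated innermost, which is why the two product measures are exchanged;
    otherwise the first coordinate is frozen and the induction hypothesis applies to the rest. *)
Lemma update_preserving n (i : 'I_n) e g : measurable_fun setT g ->
  (forall t t', (forall j, j != i -> tnth t j = tnth t' j) -> g t = g t') ->
  measure_preserving (update i e g).
Proof.
elim: n i g => [[]//|n IH] i g mg gi; split; first exact: measurable_update.
move=> A mA; rewrite /= /lebesgue_cons /pushforward.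
set m := lebesgue_tuple R n.
have mcA : measurable (@cons_pair R n @^-1` A).
  by apply: measurable_preimage => //; exact: measurable_cons_pair.
have mcUA : measurable (@cons_pair R n @^-1` (update i e g @^-1` A)).
  apply: measurable_preimage; first exact: measurable_cons_pair.
  apply: measurable_preimage => //; exact: measurable_update.
have [i0|[j ij]] : i = ord0 \/ exists j, i = lift ord0 j.
  case: (unliftP ord0 i) => [j|] ->; [by right; exists j|by left].
- rewrite !product_measure12//; apply: eq_integral => y _ /=.
  rewrite -[RHS](lebesgue_measure_isometry e (g (cons_pair (0 : RR, y)))); last first.
    exact: measurable_ysection.
  congr (leb _); apply/seteqP; rewrite /ysection.
  have E x : update i e g (cons_pair (x, y)) =
      cons_pair ((-1) ^+ e * (x : R) + g (cons_pair (0 : RR, y)) : RR, y).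
    apply/eq_from_tnth => k; rewrite tnth_update i0.
    case: (unliftP ord0 k) => [j|] ->; last first.
      rewrite eqxx /tnth /=; congr (_ + _); apply: gi => j; rewrite i0.
      by case: (unliftP ord0 j) => [l ->|->]; rewrite ?eqxx// !tnthS.
    by rewrite eq_sym (negbTE (neq_lift _ _)) !tnthS.
  by split => x /=; rewrite !inE /= E.
- apply: eq_integral => x _ /=.
  pose h y := g (cons_pair (x : RR, y)).
  have mh : measurable_fun setT h.
    apply: (measurableT_comp mg).
    by apply: measurable_cons; [exact: measurable_cst|exact: measurable_id].
  have [mU pU] : measure_preserving (update j e h).
    apply: IH => // t t' tt'; apply: gi => k.
    case: (unliftP ord0 k) => [l ->|->//]; rewrite ij => kl.
    rewrite !tnthS; apply: tt'; apply: contraNneq kl => ->; exact: eqxx.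
  rewrite -[RHS]pU; last exact: measurable_xsection.
  congr (m _); rewrite /xsection; apply/seteqP.
  have E y : update i e g (cons_pair (x, y)) = cons_pair (x, update j e h y).
    apply/eq_from_tnth => k; rewrite tnth_update ij.
    case: (unliftP ord0 k) => [l|] ->; last first.
      by rewrite (negbTE (neq_lift _ _)).
    rewrite !tnthS tnth_update (inj_eq lift_inj).
    by [].
  by split => y /=; rewrite !inE /= E.
Qed.

End coordinate_update.

(** * Reflections as products of coordinate updates *)

Section reflection.
Variables (R : realType) (n : nat).
Local Notation RR := (measurableTypeR R).
Implicit Types (t : n.-tuple RR) (v w : 'I_n -> R).

Definition tdot v t : R := \sum_i v i * (tnth t i : R).

Definition tuple_reflect v t : n.-tuple RR :=
  [tuple (tnth t j : R) - 2 * tdot v t * v j | j < n].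

Lemma tnth_tuple_reflect v t j :
  tnth (tuple_reflect v t) j = (tnth t j : R) - 2 * tdot v t * v j.
Proof. by rewrite tnth_mktuple. Qed.

Definition tuple_shear i (s : seq 'I_n) w t : n.-tuple RR :=
  [tuple (tnth t j : R) + (j \in s)%:R * (w j * (tnth t i : R)) | j < n].

Lemma measurable_coord i : measurable_fun setT (fun t => tnth t i : R).
Proof. exact: measurable_tnth. Qed.

(** One update for each entry of [s]. As [i] is not in [s], the coordinate that drives the shifts is
    never changed on the way. *)
Lemma tuple_shear_preserving i s w : uniq s -> i \notin s ->
  measure_preserving (tuple_shear i s w).
Proof.
elim: s => [_ _|k s IH /= /andP[ks us]].
  rewrite (_ : tuple_shear _ _ _ = id); first by split.
  by apply/funext => t; apply/eq_from_tnth => j; rewrite tnth_mktuple mul0r addr0.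
rewrite inE negb_or => /andP[ik is_].
pose g t := w k * (tnth t i : R).
have mg : measurable_fun setT g.
  by apply: measurable_funM => //; exact: measurable_coord.
rewrite (_ : tuple_shear _ _ _ = update k false g \o tuple_shear i s w).
  apply: measure_preserving_comp; last exact: IH.
  by apply: update_preserving => // t t' tt'; rewrite /g tt'.
apply/funext => t; apply/eq_from_tnth => j.
rewrite tnth_update /g !tnth_mktuple inE (negbTE is_) mul0r addr0.
have [->|jk] := eqVneq j k; last by [].
by rewrite (negbTE ks) mul0r addr0 !mul1r.
Qed.

(* Conjugating by the shear fixing the hyperplane [t_i = 0] and sending the
   i-th basis vector to [v / v_i] turns the reflection into a map changing only
   the i-th coordinate. *)
Lemma tuple_reflect_preserving v : \sum_i v i ^+ 2 = 1 ->
  measure_preserving (tuple_reflect v).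
Proof.
move=> v1; have [i vi0] : exists i, v i != 0.
  apply/existsP; apply: contra_eqT v1 => /existsPn v0.
  rewrite big1 1?eq_sym ?oner_neq0// => i _.
  by have := v0 i; rewrite negbK => /eqP ->; rewrite expr0n.
pose s := [seq j <- enum 'I_n | j != i].
pose w j := v j / v i.
have us : uniq s by rewrite filter_uniq ?enum_uniq.
have ins : i \notin s by rewrite mem_filter eqxx.
have mems j : (j \in s) = (j != i) by rewrite mem_filter mem_enum andbT.
pose g t := - (2 * v i) * \sum_(j | j != i) v j * (tnth t j : R).
have mg : measurable_fun setT g.
  apply: measurable_funM => //.
  rewrite (_ : (fun t => \sum_(j | j != i) v j * (tnth t j : R)) =
    (fun t => \sum_(j <- s) v j * (tnth t j : R))).
    apply: measurable_sum => j; apply: measurable_funM => //; exact: measurable_coord.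
  by apply/funext => t; rewrite big_filter big_enum_cond.
rewrite (_ : tuple_reflect v =
  tuple_shear i s w \o (update i true g \o tuple_shear i s (fun j => - w j))).
  apply: measure_preserving_comp; first exact: tuple_shear_preserving.
  apply: measure_preserving_comp; last exact: tuple_shear_preserving.
  apply: update_preserving => // t t' tt'; congr (_ * _).
  by apply: eq_bigr => j ji; rewrite tt'.
apply/funext => t; pose y := tuple_shear i s (fun j => - w j) t.
have yi : tnth y i = tnth t i by rewrite tnth_mktuple (negbTE ins) mul0r addr0.
have yj j : j != i -> tnth y j = (tnth t j : R) - w j * (tnth t i : R).
  by move=> ji; rewrite tnth_mktuple mems ji mul1r mulNr.
have Ei : tnth (update i true g y) i = (tnth t i : R) - 2 * tdot v t * v i.
  rewrite tnth_update eqxx yi expr1 mulN1r /g.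
  under eq_bigr => j ji do rewrite yj// mulrBr mulrA.
  rewrite sumrB -mulr_suml.
  have -> : \sum_(j | j != i) v j * w j = (1 - v i ^+ 2) / v i.
    have -> : 1 - v i ^+ 2 = \sum_(j | j != i) v j ^+ 2.
      by apply/eqP; rewrite subr_eq -v1 (bigD1 i)//= addrC.
    by rewrite mulr_suml; apply: eq_bigr => j _; rewrite /w expr2 mulrA.
  by rewrite /tdot [in RHS](bigD1 i)//=; field.
apply/eq_from_tnth => j; rewrite tnth_tuple_reflect /= -/y.
rewrite [RHS]tnth_mktuple mems Ei.
have [->|ji] := eqVneq j i; first by rewrite Ei mul0r addr0.
by rewrite tnth_update (negbTE ji) yj// mul1r /w; field.
Qed.

Lemma tuple_reflect_norm v t : \sum_i v i ^+ 2 = 1 ->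
  tuple_norm (tuple_reflect v t) = tuple_norm t.
Proof.
move=> v1; congr (Num.sqrt _).
pose c := tdot v t.
transitivity (\sum_i ((tnth t i : R) ^+ 2 - 4 * c * (v i * (tnth t i : R))
    + 4 * c ^+ 2 * v i ^+ 2)).
  by apply: eq_bigr => i _; rewrite tnth_tuple_reflect -/c; ring.
rewrite !big_split/= sumrN -!mulr_sumr v1 -/(tdot v t) -/c; ring.
Qed.

Lemma tuple_reflectZ v t t' (c : R) :
  (forall i, tnth t' i = (tnth t i : R) * c) ->
  forall i, tnth (tuple_reflect v t') i = (tnth (tuple_reflect v t) i : R) * c.
Proof.
move=> tt' i; rewrite !tnth_tuple_reflect tt' mulrBl; congr (_ - _).
rewrite /tdot (eq_bigr (fun i => v i * (tnth t i : R) * c)); last first.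
  by move=> j _; rewrite tt' mulrA.
by rewrite -mulr_suml; ring.
Qed.

Lemma tuple_reflect_normalize v t : \sum_i v i ^+ 2 = 1 ->
  tuple_normalize (tuple_reflect v t) = tuple_reflect v (tuple_normalize t).
Proof.
move=> v1; apply/eq_from_tnth => i.
rewrite (@tuple_reflectZ v t _ (tuple_norm t)^-1); last first.
  by move=> j; rewrite tnth_mktuple.
by rewrite tnth_mktuple tuple_reflect_norm.
Qed.

Lemma measurable_unit_tuple : measurable (@unit_tuple R n).
Proof.
rewrite (_ : unit_tuple R n = @tuple_norm R n @^-1` [set 1]); last by [].
apply: measurable_preimage; first exact: measurable_tuple_norm.
exact: measurable_set1.
Qed.

Lemma sphere_measure_reflect v A : \sum_i v i ^+ 2 = 1 -> measurable A ->
  sphere_measure R n (tuple_reflect v @^-1` A) = sphere_measure R n A.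
Proof.
move=> v1 mA; have [mr pr] := tuple_reflect_preserving v1.
rewrite /sphere_measure /= /mscale; congr (_ * _)%E.
rewrite /cone_measure /= /pushforward /mrestr.
rewrite -[RHS]pr; last first.
  apply: measurableI; last exact: measurable_punctured_ball.
  by apply: measurable_preimage => //; exact: measurable_tuple_normalize.
congr (lebesgue_tuple R n _); apply/seteqP.
by split => t /=; rewrite /punctured_ball/= tuple_reflect_normalize// tuple_reflect_norm.
Qed.

Lemma sphere_integral_reflect v (f : n.-tuple RR -> R) : \sum_i v i ^+ 2 = 1 ->
  (sphere_measure R n).-integrable (unit_tuple R n) (EFin \o f) ->
  (\int[sphere_measure R n]_(t in unit_tuple R n) (f (tuple_reflect v t))%:E =
   \int[sphere_measure R n]_(t in unit_tuple R n) (f t)%:E)%E.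
Proof.
move=> v1 intf; have mU := measurable_unit_tuple.
set S := sphere_measure R n; set D := unit_tuple R n.
have [mr _] := tuple_reflect_preserving v1.
have mfD : measurable_fun D (EFin \o f) by exact: measurable_int intf.
(* Extending [f] by zero off the sphere, which the reflection preserves, allows a change of
   variables on the whole space. *)
pose g : n.-tuple RR -> \bar R := (EFin \o f) \_ D.
have mg : measurable_fun setT g by exact/(measurable_restrictT _ mU).
have Dr : tuple_reflect v @^-1` D = D.
  by apply/seteqP; split => t; rewrite /D /unit_tuple /= tuple_reflect_norm.
have intg : S.-integrable setT g by apply/integrable_restrict; rewrite ?setTI.
pose S' := pushforward_measure S mr.
have SS' A : measurable A -> A `<=` setT -> S A = S' A.
  by move=> mA _; rewrite -(sphere_measure_reflect v1 mA).
have intgr : S.-integrable setT (g \o tuple_reflect v).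
  apply/integrableP; split; first exact: measurableT_comp mg mr.
  have /integrableP[_] := intg.
  rewrite (eq_measure_integral S')//.
  rewrite ge0_integral_pushforward//.
  exact: measurableT_comp.
rewrite [LHS]integral_mkcond [RHS]integral_mkcond.
rewrite -[(fun t => (f t)%:E) \_ D]/g.
rewrite [RHS](eq_measure_integral S')//.
rewrite [RHS](integral_pushforward mr mg intgr)// preimage_setT.
apply: eq_integral => t _; rewrite /g /patch /=.
have -> // : (tuple_reflect v t \in D) = (t \in D).
have Dt : D (tuple_reflect v t) = D t by rewrite -[in RHS]Dr.
by apply/idP/idP => /set_mem tD; apply/mem_set; rewrite ?Dt// -Dt.
Qed.

End reflection.

Section open_measurable.
Variables (R : realType) (n : nat).
Local Notation RR := (measurableTypeR R).

(** Tuples carry the product sigma-algebra, so an open set is written as the union of the countably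
    many cubes with rational centre and radius [1 / (m + 1)] that it contains. *)
Lemma open_measurable_tuple (U : set 'rV[R]_n) : open U ->
  measurable [set t : n.-tuple RR | U (\row_i (tnth t i : R))].
Proof.
move=> oU.
pose B (q : {ffun 'I_n -> rat} * nat) : set (n.-tuple RR) :=
  [set t | forall i, `|(tnth t i : R) - ratr (q.1 i)| < q.2.+1%:R^-1].
have mB q : measurable (B q).
  rewrite (_ : B q = \bigcap_(i in [set: 'I_n])
      [set t | (tnth t i : R) \in `]ratr (q.1 i) - q.2.+1%:R^-1, ratr (q.1 i) + q.2.+1%:R^-1[ ]).
    apply: fin_bigcap_measurable => // i _.
    exact: (measurable_preimage (@measurable_coord R n i) (measurable_itv _)).
  apply/seteqP; split => t /=.
    by move=> Bt i _ /=; rewrite in_itv/= -ltr_distl.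
  by move=> Bt i; have := Bt i Logic.I; rewrite /= in_itv/= -ltr_distl.
rewrite (_ : [set t | _] = \bigcup_(q in [set q | B q `<=` [set t | U (\row_i (tnth t i : R))]]) B q).
  rewrite bigcup_mkcond; apply: countable_bigcupT_measurable => // q.
  by case: ifP.
apply/seteqP; split => t /=; last by move=> [q BU Bt]; exact: BU.
move=> Ut; have := open_nbhs_nbhs (conj oU Ut).
move=> /nbhs_ballP[e /= e0 He].
have [k ke] : exists k, k.+1%:R^-1 < e / 2.
  have e2 : 0 < e / 2 by rewrite divr_gt0.
  have := near_infty_natSinv_lt (PosNum e2) => -[k _ Hk].
  by exists k; apply: Hk => /=.
have hq : forall i : 'I_n, exists q : rat, `|(tnth t i : R) - ratr q| < k.+1%:R^-1.
  move=> i; have lt : (tnth t i : R) - k.+1%:R^-1 < (tnth t i : R) + k.+1%:R^-1.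
    by rewrite ltrBlDr -addrA ltrDl addr_gt0// invr_gt0.
  by have [q] := rat_in_itvoo lt; rewrite in_itv/= -ltr_distl distrC => ?; exists q.
pose q i := sval (cid (hq i)); have Hq i := svalP (cid (hq i)).
exists ([ffun i => q i], k); last by move=> i; rewrite /= ffunE.
move=> u Bu; apply: He; split=> // i j; rewrite !mxE.
rewrite /ball /= -(subrKA (ratr (q j))); apply: le_lt_trans (ler_normD _ _) _.
rewrite (splitr e) ltrD//; first exact: lt_trans (Hq j) ke.
by apply: lt_trans ke; rewrite distrC; have := Bu j; rewrite /= ffunE.
Qed.

Lemma continuous_measurable_tuple (f : 'rV[R]_n -> R) (V : set 'rV[R]_n) :
  open V -> (forall x, V x -> {for x, continuous f}) ->
  measurable_fun [set t : n.-tuple RR | V (\row_i (tnth t i : R))]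
    (fun t => f (\row_i (tnth t i : R))).
Proof.
move=> oV cf; apply: (measurability _ (RGenOInfty.measurableE R)) => //.
move=> _ [_ [a ->] <-].
pose W := V `&` f @^-1` `]a, +oo[%classic.
have oW : open W.
  rewrite openE => x [Vx fx]; apply: filterI.
    exact: (open_nbhs_nbhs (conj oV Vx)).
  apply: (cf x Vx); apply: open_nbhs_nbhs; split => //.
exact: open_measurable_tuple oW.
Qed.

End open_measurable.

(** * Spherical harmonics in coordinates *)

Lemma cvg_sumr (R : realType) (I T : Type) (F : set_system T) (FF : Filter F)
    (r : seq I) (P : pred I) (f : I -> T -> R) (a : I -> R) :
  (forall i, P i -> f i @ F --> a i) ->
  (fun x => \sum_(i <- r | P i) f i x) @ F --> \sum_(i <- r | P i) a i.
Proof.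
move=> fa; elim: r => [|i r IH].
  under eq_fun do rewrite big_nil; rewrite big_nil; exact: cvg_cst.
under eq_fun do rewrite big_cons; rewrite big_cons.
by case: ifP => // Pi; apply: cvgD => //; exact: fa.
Qed.

Section line.
Variables (R : realType) (V : normedModType R).
Implicit Types (f : V -> R) (y v : V).

Lemma is_derive_line f y v (s : R) : derivable f (y + s *: v) v ->
  is_derive s 1 (fun t : R => f (y + t *: v)) ('D_v f (y + s *: v)).
Proof.
move=> df.
have E : (fun h : R => h^-1 *: (((fun t : R => f (y + t *: v)) \o shift s) (h *: 1) -
    f (y + s *: v))) =
  (fun h : R => h^-1 *: ((f \o shift (y + s *: v)) (h *: v) - f (y + s *: v))).
  apply/funext => h /=; congr (_ *: (f _ - _)).
  by rewrite scalerDl addrCA; congr (_ + _); rewrite [h *: 1]mulr1.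
by split; [rewrite /derivable E|rewrite /derive E].
Qed.

Lemma MVT_line f y v (c : R) :
  (forall s, `|s| <= `|c| -> derivable f (y + s *: v) v) ->
  exists2 s, `|s| <= `|c| & f (y + c *: v) - f y = c * 'D_v f (y + s *: v).
Proof.
move=> df; pose g (t : R) := f (y + t *: v).
pose dg (t : R) := 'D_v f (y + t *: v).
have g0 : g 0 = f y by rewrite /g scale0r addr0.
have dgP (s : R) : `|s| <= `|c| -> is_derive s (1 : R) g (dg s).
  by move=> sc; apply: is_derive_line; exact: df.
case: (ltgtP c 0) => [c0|c0|->]; last first.
- exists 0; first by rewrite !normr0.
  by rewrite scale0r addr0 subrr mul0r.
- have sc (s : R) : s \in `[0, c] -> `|s| <= `|c|.
    by rewrite in_itv/= => /andP[s0 sc]; rewrite !ger0_norm// ltW.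
  have [||s sI E] := @MVT R g dg 0 c c0.
  + by move=> s sI; apply/dgP/sc; exact: subset_itv_oo_cc sI.
  + by apply: derivable_within_continuous => s /sc /dgP[].
  exists s; first by apply/sc; exact: subset_itv_oo_cc sI.
  by move: E; rewrite g0 subr0 mulrC.
- have sc (s : R) : s \in `[c, 0] -> `|s| <= `|c|.
    by rewrite in_itv/= => /andP[s0 sc]; rewrite !ler0_norm ?lerN2// ltW.
  have [||s sI E] := @MVT R g dg c 0 c0.
  + by move=> s sI; apply/dgP/sc; exact: subset_itv_oo_cc sI.
  + by apply: derivable_within_continuous => s /sc /dgP[].
  exists s; first by apply/sc; exact: subset_itv_oo_cc sI.
  move: E; rewrite g0 sub0r mulrN => E.
  by rewrite -[LHS]opprB -[X in - X]/(f y - g c) E opprK mulrC.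
Qed.

End line.

Section C1.
Variables (R : realType) (d : nat).
Local Notation E := 'rV[R]_d.+1.
Implicit Types (f : E -> R) (x h : E).

Lemma normr_coord (h : E) i : `|h 0 i| <= `|h|.
Proof.
rewrite [leRHS]/Num.Def.normr/= mx_normrE.
exact: (le_bigmax _ (fun i : 'I_1 * 'I_d.+1 => `|h i.1 i.2|) (0, i)).
Qed.

Lemma normr_row_le (h : E) (c : R) : 0 <= c -> (forall i, `|h 0 i| <= c) -> `|h| <= c.
Proof.
move=> c0 H; rewrite [leLHS]/Num.Def.normr/= mx_normrE.
by apply: bigmax_le => // -[i j] _ /=; rewrite ord1.
Qed.

(** Corners of the path from [x] to [x + h] that moves one coordinate at a time. Applying the mean
    value theorem on each edge shows that continuous partial derivatives imply differentiability. *)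
Definition trunc (k : nat) h : E := \row_i (if (i < k)%N then h 0 i else 0).

Lemma truncS (k : 'I_d.+1) h :
  trunc k.+1 h = trunc k h + h 0 k *: delta_mx 0 k.
Proof.
apply/rowP => i; rewrite !mxE eqxx /= ltnS leq_eqVlt.
have [->|ik] := eqVneq i k; first by rewrite eqxx ltnn add0r mulr1.
by rewrite (_ : (i == k :> nat) = false) ?mulr0 ?addr0//; apply/negbTE.
Qed.

Definition partials_form f x h : R := \sum_i h 0 i * partial i f x.

Lemma partials_form_linear f x : linear (partials_form f x).
Proof.
move=> a u v; rewrite /partials_form scaler_sumr -big_split/=.
by apply: eq_bigr => i _; rewrite !mxE mulrDl /GRing.scale /= mulrA.
Qed.

HB.instance Definition _ f x := GRing.isLinear.Build R E R _ (partials_form f x)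
  (partials_form_linear f x).

Lemma partials_form_continuous f x : continuous (partials_form f x).
Proof.
move=> h; rewrite /partials_form.
apply: (@cvg_sumr R _ _ (nbhs h) (nbhs_filter h)) => i _.
apply: cvgM; last exact: cvg_cst.
exact: coord_continuous.
Qed.

Lemma C1_diff f x :
  (\forall y \near x, forall i, derivable f y (delta_mx 0 i)) ->
  (forall i, {for x, continuous (partial i f)}) ->
  'd f x = partials_form f x :> (E -> R) /\ differentiable f x.
Proof.
move=> df cf.
have exp : (f : E -> R^o) \o shift x =
    cst (f x : R^o) + (partials_form f x : E -> R^o) +o_ (0 : E) id.
  apply/eqaddoP => _/posnumP[e].
  pose e' := e%:num / d.+1%:R.
  have e'0 : 0 < e' by rewrite divr_gt0.
  have : \forall y \near x, (forall i, derivable f y (delta_mx 0 i)) /\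
      forall i, `|partial i f x - partial i f y| <= e'.
    apply: (@filterI _ (nbhs x) (nbhs_filter x)) => //.
    apply: (@filter_forall _ _ _ (nbhs x) (nbhs_filter x)) => i.
    exact: ((@cvgrPdist_le R R^o _ (nbhs x) (nbhs_filter x) _ _).1 (cf i) e' e'0).
  move=> /nbhs_ballP[r /= r0 Hr].
  have : \forall h \near nbhs (0 : E), `|h| < r.
    by apply/nbhs_ballP; exists r => // h; rewrite -ball_normE /= sub0r normrN.
  apply: (@filterS _ (nbhs (0 : E)) (nbhs_filter (0 : E))) => h hr.
  have bnd (y : E) : (forall i, `|y 0 i| <= `|h|) -> ball x r (x + y).
    move=> yh; rewrite -ball_normE /ball_/= opprD addNKr normrN.
    by apply: le_lt_trans hr; exact: normr_row_le.
  have step (k : 'I_d.+1) : `|f (x + trunc k.+1 h) - f (x + trunc k h) -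
      h 0 k * partial k f x| <= e' * `|h|.
    have trb (s : R) : `|s| <= `|h 0 k| ->
        ball x r (x + trunc k h + s *: delta_mx 0 k).
      move=> sh; rewrite -addrA; apply: bnd => i; rewrite !mxE eqxx /=.
      have [->|ik] := eqVneq i k.
        by rewrite ltnn add0r mulr1; exact: le_trans sh (normr_coord _ _).
      rewrite mulr0 addr0; case: ifP => _; first exact: normr_coord.
      by rewrite normr0.
    have [|s sh E] := @MVT_line R E f (x + trunc k h) (delta_mx 0 k) (h 0 k).
      by move=> s /trb /Hr[].
    rewrite truncS addrA E -mulrBr normrM mulrC ler_pM//.
      by have [_ /(_ k)] := Hr _ (trb s sh); rewrite distrC.
    exact: normr_coord.
  change (`|f (h + x) - (f x + partials_form f x h)| <= e%:num * `|h|).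
  rewrite [h + x]addrC.
  have -> : f (x + h) - (f x + partials_form f x h) =
      \sum_(k < d.+1) (f (x + trunc k.+1 h) - f (x + trunc k h) - h 0 k * partial k f x).
    rewrite sumrB -/(partials_form f x h).
    rewrite -(big_mkord xpredT (fun k => f (x + trunc k.+1 h) - f (x + trunc k h))).
    rewrite telescope_sumr//.
    have -> : trunc d.+1 h = h by apply/rowP => i; rewrite mxE ltn_ord.
    have -> : trunc 0 h = 0 by apply/rowP => i; rewrite !mxE.
    by rewrite addr0 opprD addrA.
  apply: le_trans (ler_norm_sum _ _ _) _.
  apply: le_trans (ler_sum _ (fun k _ => step k)) _.
  rewrite sumr_const card_ord -mulrnAl -mulr_natr divfK//.
split; first exact: (diff_unique (@partials_form_continuous f x) exp).
apply/diff_locallyP; rewrite (diff_unique (@partials_form_continuous f x) exp).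
split=> //; exact: partials_form_continuous.
Qed.

End C1.

Lemma trace_form_mul (R : comNzRingType) (m : nat) (A : 'M[R]_m) (c : R)
    (D : 'I_m -> 'I_m -> R) : A^T *m A = c%:M ->
  \sum_i \sum_j \sum_l A i j * A i l * D j l = c * \sum_j D j j.
Proof.
move=> AA; have AAE j l : \sum_i A i j * A i l = c *+ (j == l).
  have := congr1 (fun M : 'M[R]_m => M j l) AA; rewrite !mxE => <-.
  by apply: eq_bigr => i _; rewrite mxE.
rewrite [LHS]exchange_big [RHS]mulr_sumr; apply: eq_bigr => j _.
rewrite [LHS]exchange_big (bigD1 j)//= [X in _ + X]big1 ?addr0 => [|l lj].
  by rewrite -mulr_suml AAE eqxx mulr1n.
by rewrite -mulr_suml AAE eq_sym (negbTE lj) mul0r.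
Qed.

Section C1_on.
Variables (R : realType) (d : nat).
Local Notation E := 'rV[R]_d.+1.
Implicit Types (f g : E -> R) (x y v : E).

Definition C1_on f := forall x, x != 0 -> C1_at f x.

Lemma near_neq0 x : x != 0 -> \forall y \near nbhs x, y != 0.
Proof.
move=> x0; apply/nbhs_ballP; exists `|x|; first by rewrite /= normr_gt0.
move=> y; rewrite -ball_normE /=; apply: contraTneq => ->.
by rewrite subr0 ltxx.
Qed.

Lemma C1_on_diff f x : C1_on f -> x != 0 ->
  'd f x = partials_form f x :> (E -> R) /\ differentiable f x.
Proof.
move=> cf x0; apply: C1_diff => [|i]; last by have [_ /(_ i)[]] := cf x x0.
apply: (@filterS _ (nbhs x) (nbhs_filter x) _ _ _ (near_neq0 x0)) => y y0 i.
by have [_ /(_ i)[]] := cf y y0.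
Qed.

Lemma C1_on_derivable f x v : C1_on f -> x != 0 -> derivable f x v.
Proof. by move=> cf x0; apply: diff_derivable; have [] := C1_on_diff cf x0. Qed.

Lemma C1_on_derive f x v : C1_on f -> x != 0 ->
  'D_v f x = \sum_i v 0 i * partial i f x.
Proof. by move=> cf x0; have [E1 E2] := C1_on_diff cf x0; rewrite deriveE// E1. Qed.

Lemma C1_on_eq f g : (forall x, x != 0 -> f x = g x) -> C1_on f -> C1_on g.
Proof.
move=> fg cf x x0; have [cfx dfx] := cf x x0.
have nfg : forall y, y != 0 -> \forall z \near nbhs y, f z = g z.
  move=> y y0; apply: (@filterS _ (nbhs y) (nbhs_filter y) _ _ _ (near_neq0 y0)).
  by move=> z; exact: fg.
have pfg i y : y != 0 -> partial i f y = partial i g y.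
  by move=> y0; exact: (@near_eq_derive _ _ _ f g y _ (nfg y y0)).
split.
  rewrite /prop_for /continuous_at -fg//; apply: cvg_trans cfx.
  exact: (@near_eq_cvg _ _ (nbhs x) (nbhs_filter x) f g (nfg x x0)).
move=> i; have [di ci] := dfx i; split.
  exact: (@near_eq_derivable _ _ _ f g x _ (nfg x x0)).
rewrite /prop_for /continuous_at -pfg//; apply: cvg_trans ci.
apply: (@near_eq_cvg _ _ (nbhs x) (nbhs_filter x)).
apply: (@filterS _ (nbhs x) (nbhs_filter x) _ _ _ (near_neq0 x0)) => y.
exact: pfg.
Qed.

Lemma partial_eq f g i x : (forall x, x != 0 -> f x = g x) -> x != 0 ->
  partial i f x = partial i g x.
Proof.
move=> fg x0; apply: (@near_eq_derive _ _ _ f g x).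
apply: (@filterS _ (nbhs x) (nbhs_filter x) _ _ _ (near_neq0 x0)) => y.
exact: fg.
Qed.

Lemma partial_sum (I : finType) (c : I -> R) (f : I -> E -> R) i x :
  (forall j, derivable (f j) x (delta_mx 0 i)) ->
  is_derive x (delta_mx 0 i) (fun y => \sum_j c j * f j y) (\sum_j c j * partial i (f j) x).
Proof.
move=> df.
rewrite (_ : (fun y => _) = \sum_j (c j \*: (f j : E -> R))); last first.
  by apply/funext => y; rewrite fct_sumE.
elim/big_ind2 : _ => [|F1 D1 F2 D2 H1 H2|j _].
- exact: is_derive_cst.
- exact: is_deriveD.
- by apply: is_deriveZ; exact/derivableP.
Qed.

Lemma C1_on_sum (I : finType) (c : I -> R) (f : I -> E -> R) :
  (forall j, C1_on (f j)) -> C1_on (fun y => \sum_j c j * f j y).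
Proof.
move=> cf x x0; split.
  apply: (@cvg_sumr R _ _ (nbhs x) (nbhs_filter x)) => j _.
  by apply: cvgM; [exact: cvg_cst|have [] := cf j x x0].
move=> i.
have D y : y != 0 -> is_derive y (delta_mx 0 i : E) (fun y => \sum_j c j * f j y)
    (\sum_j c j * partial i (f j) y).
  by move=> y0; apply: partial_sum => j; exact: C1_on_derivable.
split; first by have [] := D x x0.
have E1 y : y != 0 -> \sum_j c j * partial i (f j) y =
    partial i (fun y => \sum_j c j * f j y) y.
  by move=> y0; have [_ <-] := D y y0.
rewrite /prop_for /continuous_at -E1//.
apply: (@cvg_trans _ ((fun y => \sum_j c j * partial i (f j) y) @ nbhs x)).
  apply: (@near_eq_cvg _ _ (nbhs x) (nbhs_filter x)).
  apply: (@filterS _ (nbhs x) (nbhs_filter x) _ _ _ (near_neq0 x0)) => y.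
  exact: E1.
apply: (@cvg_sumr R _ _ (nbhs x) (nbhs_filter x)) => j _.
by apply: cvgM; [exact: cvg_cst|have [_ /(_ i)[]] := cf j x x0].
Qed.

Lemma partial_sumE (I : finType) (c : I -> R) (f : I -> E -> R) i x :
  (forall j, C1_on (f j)) -> x != 0 ->
  partial i (fun y => \sum_j c j * f j y) x = \sum_j c j * partial i (f j) x.
Proof.
move=> cf x0; have D := @partial_sum I c f i x
  (fun j => (@C1_on_derivable _ x _ (cf j) x0)).
by have [_] := D.
Qed.

Section linear_map.
Variable A : 'M[R]_d.+1.
Hypothesis A0 : forall x, x != 0 -> x *m A != 0.

Lemma is_derive_mulmx f x v : derivable f (x *m A) (v *m A) ->
  is_derive x v (fun y => f (y *m A)) ('D_(v *m A) f (x *m A)).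
Proof.
move=> df.
have EE : (fun h : R => h^-1 *: (((fun y => f (y *m A)) \o shift x) (h *: v) -
    f (x *m A))) =
  (fun h : R => h^-1 *: ((f \o shift (x *m A)) (h *: (v *m A)) - f (x *m A))).
  by apply/funext => h /=; rewrite mulmxDl scalemxAl.
by split; [rewrite /derivable EE|rewrite /derive EE].
Qed.

Lemma mulmx_continuous : continuous (fun y : E => y *m A).
Proof.
move=> y; apply: (@cvg_row R _ (nbhs y) (nbhs_filter y)) => i.
under eq_fun do rewrite mxE; rewrite mxE.
apply: (@cvg_sumr R _ _ (nbhs y) (nbhs_filter y)) => j _.
apply: cvgM; last exact: cvg_cst.
exact: coord_continuous.
Qed.

Lemma partial_mulmx f i x : C1_on f -> x != 0 ->
  is_derive x (delta_mx 0 i) (fun y => f (y *m A))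
    (\sum_j A i j * partial j f (x *m A)).
Proof.
move=> cf x0; have xA0 := A0 x0.
have -> : \sum_j A i j * partial j f (x *m A) = 'D_(delta_mx 0 i *m A) f (x *m A).
  rewrite C1_on_derive//; apply: eq_bigr => j _; congr (_ * _).
  by rewrite -rowE mxE.
by apply: is_derive_mulmx; exact: C1_on_derivable.
Qed.

Lemma partial_mulmxE f i x : C1_on f -> x != 0 ->
  partial i (fun y => f (y *m A)) x = \sum_j A i j * partial j f (x *m A).
Proof. by move=> cf x0; have [] := partial_mulmx i cf x0. Qed.

Lemma C1_on_mulmx f : C1_on f -> C1_on (fun y => f (y *m A)).
Proof.
move=> cf x x0; have [cfx dfx] := cf _ (A0 x0); split.
  apply: (@continuous_comp _ _ _ (fun y : E => y *m A) f).
    exact: mulmx_continuous.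
  exact: cfx.
move=> i; split; first by have [] := partial_mulmx i cf x0.
rewrite /prop_for /continuous_at partial_mulmxE//.
apply: (@cvg_trans _ ((fun y => \sum_j A i j * partial j f (y *m A)) @ nbhs x)).
  apply: (@near_eq_cvg _ _ (nbhs x) (nbhs_filter x)).
  apply: (@filterS _ (nbhs x) (nbhs_filter x) _ _ _ (near_neq0 x0)) => y y0.
  by rewrite partial_mulmxE.
apply: (@cvg_sumr R _ _ (nbhs x) (nbhs_filter x)) => j _.
apply: cvgM; first exact: cvg_cst.
have [_ cj] := dfx j.
apply: (@continuous_comp _ _ _ (fun y : E => y *m A) (partial j f)).
  exact: mulmx_continuous.
exact: cj.
Qed.

(** Two chain rules, then the trace is contracted with [A^T A]. The scalar [c] is there to cover
    both orthogonal maps, with [c = 1], and dilations. *)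
Lemma laplacian_mulmx f (c : R) x : C1_on f -> (forall i, C1_on (partial i f)) ->
  x != 0 -> A^T *m A = c%:M ->
  \sum_i partial i (partial i (fun y => f (y *m A))) x =
  c * \sum_i partial i (partial i f) (x *m A).
Proof.
move=> cf cpf x0 AA.
have E1 i : partial i (partial i (fun y => f (y *m A))) x =
    \sum_j \sum_l (A i j * A i l) * partial l (partial j f) (x *m A).
  rewrite (@partial_eq _ (fun y => \sum_j A i j * partial j f (y *m A)))//; last first.
    by move=> y y0; rewrite partial_mulmxE.
  rewrite (@partial_sumE _ (fun j => A i j) (fun j y => partial j f (y *m A)) i x);
    [|by move=> j; exact: (@C1_on_mulmx (partial j f) (cpf j))|exact: x0].
  apply: eq_bigr => j _; rewrite (@partial_mulmxE (partial j f) i x (cpf j) x0) mulr_sumr.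
  by apply: eq_bigr => l _; rewrite mulrA.
transitivity (\sum_i \sum_j \sum_l (A i j * A i l) * partial l (partial j f) (x *m A)).
  by apply: eq_bigr => i _; exact: E1.
exact: (@trace_form_mul _ _ A c (fun j l => partial l (partial j f) (x *m A)) AA).
Qed.

End linear_map.
End C1_on.

(** * The Euclidean inner product and its reflections *)

Section dot.
Variables (R : realType) (d : nat).
Local Notation E := 'rV[R]_d.
Implicit Types (x y z v : E) (a : R).

Definition dot x y : R := \sum_i x 0 i * y 0 i.

Lemma dotC x y : dot x y = dot y x.
Proof. by apply: eq_bigr => i _; rewrite mulrC. Qed.

Lemma dotDl x y z : dot (x + y) z = dot x z + dot y z.
Proof. by rewrite -big_split; apply: eq_bigr => i _; rewrite mxE mulrDl. Qed.

Lemma dotZl a x y : dot (a *: x) y = a * dot x y.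
Proof. by rewrite mulr_sumr; apply: eq_bigr => i _; rewrite mxE mulrA. Qed.

Lemma dotNl x y : dot (- x) y = - dot x y.
Proof. by rewrite -scaleN1r dotZl mulN1r. Qed.

Lemma dotDr x y z : dot z (x + y) = dot z x + dot z y.
Proof. by rewrite dotC dotDl !(dotC z). Qed.

Lemma dotZr a x y : dot y (a *: x) = a * dot y x.
Proof. by rewrite dotC dotZl dotC. Qed.

Lemma dotNr x y : dot y (- x) = - dot y x.
Proof. by rewrite dotC dotNl dotC. Qed.

Lemma dot_ge0 x : 0 <= dot x x.
Proof. by apply: sumr_ge0 => i _; rewrite -expr2 sqr_ge0. Qed.

Lemma dot_eq0 x : (dot x x == 0) = (x == 0).
Proof.
apply/eqP/eqP => [|->]; last by rewrite /dot big1// => i _; rewrite mxE mul0r.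
move=> /eqP; rewrite psumr_eq0; last by move=> i _; rewrite -expr2 sqr_ge0.
move=> /allP H; apply/rowP => i; rewrite mxE; apply/eqP.
by have := H i (mem_index_enum i); rewrite -expr2 sqrf_eq0.
Qed.

Lemma dot_gt0 x : x != 0 -> 0 < dot x x.
Proof. by move=> x0; rewrite lt_def dot_eq0 x0 dot_ge0. Qed.

Lemma dot_CS x y : dot x y ^+ 2 <= dot x x * dot y y.
Proof.
have [->|y0] := eqVneq y 0.
  have z0 z : dot z 0 = 0 by rewrite /dot big1// => i _; rewrite mxE mulr0.
  by rewrite !z0 expr0n mulr0.
have yy := dot_gt0 y0.
have := dot_ge0 (dot y y *: x - dot x y *: y).
rewrite !(dotDl, dotDr, dotNl, dotNr, dotZl, dotZr) (dotC y x) => H.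
rewrite -subr_ge0 -(pmulr_rge0 _ yy); apply: le_trans H _.
by rewrite le_eqVlt; apply/orP; left; apply/eqP; ring.
Qed.

Lemma dot_delta (x : E) i : dot x (delta_mx 0 i) = x 0 i.
Proof.
rewrite /dot (bigD1 i)//= mxE !eqxx mulr1 big1 ?addr0// => j /negbTE ji.
by rewrite mxE ji andbF mulr0.
Qed.

Lemma dot_line (x y : E) (a : R) :
  dot (x + a *: y) (x + a *: y) = dot x x + 2 * a * dot x y + a ^+ 2 * dot y y.
Proof. rewrite !(dotDl, dotDr, dotZl, dotZr) (dotC y x); ring. Qed.

Lemma dot_continuous x : continuous (dot x).
Proof.
move=> y; apply: (@cvg_sumr R _ _ (nbhs y) (nbhs_filter y)) => i _.
apply: cvgM; [exact: cvg_cst|exact: coord_continuous].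
Qed.

Definition reflection v : 'M[R]_d := 1%:M - 2 *: (v^T *m v).

Lemma mulmx_reflection v x : x *m reflection v = x - (2 * dot x v) *: v.
Proof.
rewrite mulmxBr mulmx1 -scalemxAr mulmxA -scalerA; congr (_ - 2 *: _).
apply/rowP => i; rewrite !mxE big_ord1; congr (_ * _); rewrite mxE.
by apply: eq_bigr => j _; rewrite mxE.
Qed.

Lemma dot_reflection v x y : dot v v = 1 ->
  dot (x *m reflection v) (y *m reflection v) = dot x y.
Proof.
move=> v1; rewrite !mulmx_reflection !(dotDl, dotDr, dotNl, dotNr, dotZl, dotZr) v1.
rewrite (dotC v y); ring.
Qed.

Lemma reflectionK v : dot v v = 1 -> reflection v *m reflection v = 1%:M.
Proof.
move=> v1; apply/row_matrixP => i; rewrite row_mul mulmx_reflection.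
rewrite rowE mulmx_reflection dotDl dotNl dotZl v1 row1.
set a := dot _ v.
rewrite (_ : 2 * (a - 2 * a * 1) = - (2 * a)); last by ring.
by rewrite scaleNr opprK subrK.
Qed.

Lemma reflection_tr v : (reflection v)^T = reflection v.
Proof. by rewrite /reflection linearB linearZ /= trmx1 trmx_mul trmxK. Qed.

(** The reflection along [x - y]; its hyperplane consists of the points having equal inner products
    with [x] and [y]. *)
Lemma reflection_swap x y : dot x x = dot y y -> x != y ->
  exists2 v, dot v v = 1 & x *m reflection v = y /\
    forall z, dot z x = dot z y -> z *m reflection v = z.
Proof.
move=> xy nxy; pose w := x - y.
have w0 : 0 < dot w w by rewrite dot_gt0 ?subr_eq0.
pose c := (Num.sqrt (dot w w))^-1.
have c2 : c * c * dot w w = 1.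
  by rewrite -expr2 exprVn sqr_sqrtr ?ltW// mulVf// gt_eqF.
exists (c *: w); first by rewrite dotZl dotZr mulrA.
split=> [|z zxy].
  rewrite mulmx_reflection dotZr scalerA.
  have -> : 2 * (c * dot x w) * c = 1.
    have e : dot w w = 2 * dot x w.
      by rewrite /w !(dotDl, dotDr, dotNl, dotNr) (dotC y x) -xy; ring.
    by rewrite -[RHS]c2 e; ring.
  by rewrite scale1r /w opprB addrC subrK.
by rewrite mulmx_reflection dotZr /w dotDr dotNr zxy subrr !mulr0 scale0r subr0.
Qed.

End dot.

(** * Extensions constant along rays *)

Section radial.
Variables (R : realType) (d : nat).
Local Notation E := 'rV[R]_d.+1.
Implicit Types (x y : E) (phi : E -> R).

Lemma eucl_normE x : eucl_norm x = Num.sqrt (dot x x).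
Proof. by congr Num.sqrt; apply: eq_bigr => i _; rewrite expr2. Qed.

Lemma unit_sphereE x : unit_sphere R d x <-> dot x x = 1.
Proof.
rewrite /unit_sphere /= eucl_normE; split=> [H|->]; last by rewrite sqrtr1.
by rewrite -[LHS]sqr_sqrtr ?dot_ge0// H expr1n.
Qed.

Lemma unit_sphere_neq0 x : unit_sphere R d x -> x != 0.
Proof. by move=> /unit_sphereE H; rewrite -dot_eq0 H oner_eq0. Qed.

Lemma eucl_norm_gt0 x : x != 0 -> 0 < eucl_norm x.
Proof. by move=> x0; rewrite eucl_normE sqrtr_gt0 dot_gt0. Qed.

Lemma eucl_norm_sqr x : eucl_norm x ^+ 2 = dot x x.
Proof. by rewrite eucl_normE sqr_sqrtr ?dot_ge0. Qed.

Lemma eucl_normZ a x : 0 < a -> eucl_norm (a *: x) = a * eucl_norm x.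
Proof.
move=> a0; rewrite !eucl_normE dotZl dotZr mulrA sqrtrM ?mulr_ge0 ?ltW//.
by rewrite -expr2 sqrtr_sqr gtr0_norm.
Qed.

Lemma normalize_unit x : x != 0 -> unit_sphere R d ((eucl_norm x)^-1 *: x).
Proof.
move=> x0; rewrite /unit_sphere /= eucl_normZ ?invr_gt0 ?eucl_norm_gt0//.
by rewrite mulVf// gt_eqF// eucl_norm_gt0.
Qed.

Lemma radial_ext_unit phi x : unit_sphere R d x -> radial_ext phi x = phi x.
Proof. by rewrite /radial_ext /unit_sphere /= => ->; rewrite invr1 scale1r. Qed.

Lemma radial_extZ phi a x : 0 < a -> radial_ext phi (a *: x) = radial_ext phi x.
Proof.
move=> a0; rewrite /radial_ext eucl_normZ// scalerA invfM; congr phi.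
by rewrite -mulrA mulrCA mulVf ?mulr1// gt_eqF.
Qed.

Lemma radial_ext_mulmx phi (A : 'M[R]_d.+1) :
  (forall x, dot (x *m A) (x *m A) = dot x x) ->
  radial_ext (fun x => phi (x *m A)) = (fun x => radial_ext phi (x *m A)).
Proof.
by move=> HA; apply/funext => x; rewrite /radial_ext !eucl_normE HA scalemxAl.
Qed.

Section harmonics.
Variable n : nat.

Lemma spherical_harmonic_C1 phi : spherical_harmonic n phi ->
  C1_on (radial_ext phi) /\ forall i, C1_on (partial i (radial_ext phi)).
Proof. by move=> [H _]; split=> [x /H[]//|i x /H[_]]. Qed.

Lemma spherical_harmonic_sum (I : finType) (c : I -> R) (phi : I -> E -> R) :
  (forall i, spherical_harmonic n (phi i)) ->
  spherical_harmonic n (fun x => \sum_i c i * phi i x).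
Proof.
move=> H; have C i := (spherical_harmonic_C1 (H i)).1.
have CC j i := (spherical_harmonic_C1 (H j)).2 i.
have E1 i x : x != 0 -> \sum_j c j * partial i (radial_ext (phi j)) x =
    partial i (fun y => \sum_j c j * radial_ext (phi j) y) x.
  by move=> x0; rewrite partial_sumE.
split.
  move=> x x0; split; first exact: C1_on_sum.
  move=> i; apply: C1_on_eq x0; first exact: E1.
  by apply: C1_on_sum => j; exact: CC.
move=> x xS; have x0 := unit_sphere_neq0 xS.
rewrite /sphere_laplacian.
transitivity (\sum_i \sum_j c j * partial i (partial i (radial_ext (phi j))) x).
  apply: eq_bigr => i _.
  rewrite -(@partial_eq _ _ (fun x => \sum_j c j * partial i (radial_ext (phi j)) x) _ i x (E1 i) x0).
  exact: (@partial_sumE _ _ _ c (fun j => partial i (radial_ext (phi j))) i x (fun j => CC j i) x0).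
rewrite [LHS]exchange_big [RHS]mulr_sumr; apply: eq_bigr => j _.
by rewrite -mulr_sumr mulrCA; congr (_ * _); have [_ HL] := H j; exact: (HL x xS).
Qed.

Lemma spherical_harmonic_mulmx phi (A : 'M[R]_d.+1) : A^T *m A = 1%:M ->
  spherical_harmonic n phi -> spherical_harmonic n (fun x => phi (x *m A)).
Proof.
move=> AA H; have [C CC] := spherical_harmonic_C1 H.
have dotA x : dot (x *m A) (x *m A) = dot x x.
  have E0 y : dot y y = (y *m y^T) 0 0.
    by rewrite mxE; apply: eq_bigr => i _; rewrite mxE.
  by rewrite !E0 trmx_mul mulmxA -(mulmxA x) (mulmx1C AA) mulmx1.
have A0 x : x != 0 -> x *m A != 0 by rewrite -!dot_eq0 dotA.
have RE := radial_ext_mulmx phi dotA.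
split.
  move=> x x0; rewrite RE; split; first exact: C1_on_mulmx.
  move=> i; apply: (@C1_on_eq _ _
    (fun y => \sum_j A i j * partial j (radial_ext phi) (y *m A)) _ _ _ x x0).
    by move=> y y0; rewrite partial_mulmxE.
  apply: (@C1_on_sum _ _ _ _ (fun j y => partial j (radial_ext phi) (y *m A))) => j.
  exact: (C1_on_mulmx A0 (CC j)).
move=> x xS; rewrite /sphere_laplacian RE.
rewrite (laplacian_mulmx A0 C CC (unit_sphere_neq0 xS) AA) mul1r.
have [_ HL] := H; apply: (HL (x *m A)).
by apply/unit_sphereE; rewrite dotA; apply/unit_sphereE.
Qed.

(** The eigenvalue equation is given on the unit sphere only. The extension is invariant under
    dilations, whose effect on the Laplacian supplies the factor [1 / |x|^2]. *)
Lemma laplacian_radial_ext phi x : spherical_harmonic n phi -> x != 0 ->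
  \sum_i partial i (partial i (radial_ext phi)) x =
  - (n * (n + d - 1))%:R / dot x x * radial_ext phi x.
Proof.
move=> H x0; have [C CC] := spherical_harmonic_C1 H.
pose c := (eucl_norm x)^-1; have c0 : 0 < c by rewrite invr_gt0 eucl_norm_gt0.
have A0 y : y != 0 -> y *m c%:M != 0.
  by move=> y0; rewrite mul_mx_scalar scaler_eq0 negb_or gt_eqF.
have E1 : (fun y => radial_ext phi (y *m c%:M)) = radial_ext phi.
  by apply/funext => y; rewrite mul_mx_scalar radial_extZ.
have := @laplacian_mulmx _ _ c%:M A0 (radial_ext phi) (c ^+ 2) x C CC x0.
rewrite E1 => ->; last by rewrite tr_scalar_mx -scalar_mxM expr2.
have xS : unit_sphere R d (x *m c%:M) by rewrite mul_mx_scalar; exact: normalize_unit.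
have [_ /(_ _ xS)] := H; rewrite /sphere_laplacian => ->.
rewrite -(radial_ext_unit phi xS) mul_mx_scalar radial_extZ// mulrA.
by rewrite exprVn eucl_norm_sqr [_ * - _]mulrC.
Qed.

End harmonics.
End radial.

(** * Zonal harmonics *)

Section derive_rules.
Variable R : realType.
Implicit Types (f g : R -> R) (x a b c : R).

Lemma is_derive_eqd f x a b : is_derive x 1 f a -> a = b -> is_derive x 1 f b.
Proof. by move=> + <-. Qed.

Lemma is_derive_c c x : is_derive x 1 (fun=> c : R) 0.
Proof. exact: is_derive_cst. Qed.

Lemma is_derive_x x : is_derive x 1 (fun t : R => t) 1.
Proof. exact: is_derive_id. Qed.

Lemma is_derive_add f g x a b : is_derive x 1 f a -> is_derive x 1 g b ->
  is_derive x 1 (fun t => f t + g t) (a + b).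
Proof. by move=> fa gb; exact: (is_deriveD fa gb). Qed.

Lemma is_derive_sub f g x a b : is_derive x 1 f a -> is_derive x 1 g b ->
  is_derive x 1 (fun t => f t - g t) (a - b).
Proof. by move=> fa gb; exact: (is_deriveB fa gb). Qed.

Lemma is_derive_mul f g x a b : is_derive x 1 f a -> is_derive x 1 g b ->
  is_derive x 1 (fun t => f t * g t) (f x * b + a * g x).
Proof.
move=> fa gb; apply: (is_derive_eqd (is_deriveM fa gb)).
by rewrite /GRing.scale /= [g x * a]mulrC.
Qed.

Lemma is_derive_scale c f x a : is_derive x 1 f a ->
  is_derive x 1 (fun t => c * f t) (c * a).
Proof.
move=> fa; apply: (is_derive_eqd (is_derive_mul (is_derive_c c x) fa)).
by rewrite mul0r addr0.
Qed.

Lemma is_derive_exp f x a n : is_derive x 1 f a ->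
  is_derive x 1 (fun t => f t ^+ n) (n%:R * f x ^+ n.-1 * a).
Proof.
move=> fa; rewrite (_ : (fun t => f t ^+ n) = f ^+ n); last first.
  by apply/funext => t; elim: n => [|n IH]; rewrite ?expr0// !exprS IH.
exact: (is_deriveX n fa).
Qed.

Lemma is_derive_inv f x a : f x != 0 -> is_derive x 1 f a ->
  is_derive x 1 (fun t => (f t)^-1) (- a / f x ^+ 2).
Proof.
move=> f0 fa; apply: (is_derive_eqd (is_deriveV f0 fa)).
by rewrite /GRing.scale /=; field.
Qed.

Lemma is_derive_compo f g x a b : is_derive (g x) 1 f a -> is_derive x 1 g b ->
  is_derive x 1 (fun t => f (g t)) (a * b).
Proof. by move=> fa gb; exact: (is_derive1_comp fa gb). Qed.

Lemma is_derive_poly (p : {poly R}) x : is_derive x 1 (fun t => p.[t]) p^`().[x].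
Proof.
have := derivE p; rewrite funeqE => /(_ x) ->.
by rewrite derive1E; apply/derivableP; exact: derivable_horner.
Qed.

Lemma is_derive_1sqr (s : R) : is_derive s (1 : R) (fun t : R => 1 + t ^+ 2) (2 * s).
Proof.
apply: (is_derive_eqd (is_derive_add (is_derive_c 1 s) (is_derive_exp 2 (is_derive_x s)))).
by rewrite /=; ring.
Qed.

Definition hyp (s : R) : R := Num.sqrt (1 + s ^+ 2).

Lemma hyp_gt0 s : 0 < hyp s.
Proof. by rewrite sqrtr_gt0 ltr_pwDl// sqr_ge0. Qed.

Lemma hyp_sqr s : hyp s ^+ 2 = 1 + s ^+ 2.
Proof. by rewrite sqr_sqrtr// addr_ge0// sqr_ge0. Qed.

Lemma is_derive_hyp (s : R) : is_derive s (1 : R) hyp (s / hyp s).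
Proof.
have h0 : 0 < 1 + s ^+ 2 by rewrite ltr_pwDl// sqr_ge0.
apply: (is_derive_eqd (@is_derive_compo Num.sqrt _ s _ _ (is_derive1_sqrt h0) (is_derive_1sqr s))).
by rewrite -/(hyp s); field; rewrite gt_eqF// hyp_gt0.
Qed.

Lemma is_derive_continuous f x a : is_derive x 1 f a -> {for x, continuous f}.
Proof. by move=> [/derivable1_diffP/differentiable_continuous]. Qed.

Lemma is_derive_nondecreasing f df (a b : R) : a <= b ->
  (forall x, a <= x <= b -> is_derive x 1 f (df x)) ->
  (forall x, a < x < b -> 0 <= df x) -> f a <= f b.
Proof.
move=> ab fd dge0.
apply: (@ger0_derive1_ndecr R f a b) => //.
- by move=> x; rewrite in_itv/= => /andP[ax xb]; have [] := fd x; rewrite ?(ltW ax) ?(ltW xb).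
- move=> x; rewrite in_itv/= => /andP[ax xb]; rewrite derive1E.
  by have [|_ ->] := fd x; rewrite ?(ltW ax) ?(ltW xb)// dge0// ax.
- by apply: derivable_within_continuous => x; rewrite in_itv/= => /fd[].
Qed.

End derive_rules.

(** * Uniqueness for the zonal equation on a line *)

Section uniqueness.
Variables (R : realType) (d l : R) (q q1 q2 : R -> R).
Hypothesis d1 : 1 <= d.
Hypothesis l0 : 0 < l.
Hypothesis dq : forall s : R, is_derive s (1 : R) q (q1 s).
Hypothesis dq1 : forall s : R, is_derive s (1 : R) q1 (q2 s).
Hypothesis ode : forall s,
  (1 + s ^+ 2) ^+ 2 * q2 s + (3 - d) * s * (1 + s ^+ 2) * q1 s + l * q s = 0.

(* [q^2 + (1 - z^2) (dq/dz)^2 / l] in the coordinate [s = z / sqrt (1 - z^2)]. *)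
Definition line_energy s := q s ^+ 2 + (1 + s ^+ 2) ^+ 2 * q1 s ^+ 2 / l.

Lemma line_energy_ge s : q s ^+ 2 <= line_energy s.
Proof.
by rewrite /line_energy lerDl divr_ge0 ?(ltW l0)// mulr_ge0// sqr_ge0.
Qed.

Lemma is_derive_line_energy (s : R) :
  is_derive s (1 : R) line_energy (2 * (d - 1) * s * (1 + s ^+ 2) * q1 s ^+ 2 / l).
Proof.
have D1 := is_derive_exp 2 (dq s).
have D2 := is_derive_mul (is_derive_exp 2 (is_derive_1sqr s)) (is_derive_exp 2 (dq1 s)).
have D3 := is_derive_mul D2 (is_derive_c l^-1 s).
apply: (is_derive_eqd (is_derive_add D1 D3)) => /=; rewrite !expr1.
apply/eqP; rewrite -subr_eq0; apply/eqP.
rewrite -[RHS](mulr0 (2 * q1 s / l)) -[in RHS](ode s).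
by field; rewrite gt_eqF.
Qed.

(** For [s >= 0] the energy does not decrease, yet it is arbitrarily small arbitrarily far out. *)
Lemma uniqueness_right :
  (forall e s0, 0 < e -> exists2 s, s0 <= s & line_energy s <= e) ->
  forall s, 0 <= s -> line_energy s = 0.
Proof.
move=> lim s s0; apply/eqP; rewrite eq_le; apply/andP; split; last first.
  exact: le_trans (sqr_ge0 _) (line_energy_ge s).
apply/ler_addgt0Pl => e e0; rewrite addr0; have [t st te] := lim e s e0.
apply: le_trans te.
apply: (@is_derive_nondecreasing R line_energy
  (fun s => 2 * (d - 1) * s * (1 + s ^+ 2) * q1 s ^+ 2 / l) s t st) => [x _|x /andP[sx _]].
  exact: is_derive_line_energy.
have x0 : 0 <= x by apply: le_trans s0 (ltW sx).
apply: divr_ge0 (ltW l0); apply: mulr_ge0 (sqr_ge0 _).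
apply: mulr_ge0; last by rewrite addr_ge0// sqr_ge0.
by apply: mulr_ge0 x0; rewrite mulr_ge0// subr_ge0.
Qed.

(** For [s <= 0] the energy varies in the wrong direction to carry the zero at [0] to the left.
    Dividing it by [(1 + s^2)^(d - 1)] cancels the terms in [q1] of the derivative and leaves a
    multiple of [- s q^2], so the quotient is nondecreasing there. *)
Lemma uniqueness_left (m : nat) : m%:R = d - 1 -> line_energy 0 = 0 ->
  forall s, s <= 0 -> line_energy s = 0.
Proof.
move=> md E0 s s0; apply/eqP; rewrite eq_le; apply/andP; split; last first.
  exact: le_trans (sqr_ge0 _) (line_energy_ge s).
pose W t := line_energy t * ((1 + t ^+ 2) ^+ m)^-1.
have p0 t : 0 < 1 + t ^+ 2 :> R by rewrite ltr_pwDl// sqr_ge0.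
have pm0 t : 0 < (1 + t ^+ 2) ^+ m :> R by rewrite exprn_gt0.
suff : W s <= W 0.
  by rewrite /W E0 mul0r pmulr_lle0// invr_gt0.
pose dW t := - (2 * (d - 1) * t * q t ^+ 2) / ((1 + t ^+ 2) * (1 + t ^+ 2) ^+ m).
apply: (@is_derive_nondecreasing R W dW s 0 s0) => [t _|t /andP[_ t0]].
  have D1 := is_derive_exp m (is_derive_1sqr t).
  have D2 := @is_derive_inv R (fun t => (1 + t ^+ 2) ^+ m) t _ (lt0r_neq0 (pm0 t)) D1.
  apply: (is_derive_eqd (is_derive_mul (is_derive_line_energy t) D2)).
  rewrite /dW /line_energy.
  have := lt0r_neq0 (pm0 t); have := lt0r_neq0 (p0 t); have l0' := lt0r_neq0 l0.
  rewrite -md; case: (m) => [|m'] /= p1 p2.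
    by rewrite expr0; field; rewrite p1.
  rewrite exprS in p2 *; have p3 : (1 + t ^+ 2) ^+ m' != 0.
    by move: p2; rewrite mulf_eq0 negb_or => /andP[].
  by field; rewrite p1 p3.
rewrite /dW divr_ge0//; last by rewrite mulr_ge0// ltW.
rewrite -mulNr mulr_ge0 ?sqr_ge0// oppr_ge0.
by rewrite mulr_ge0_le0 ?(ltW t0)// mulr_ge0// subr_ge0.
Qed.

Lemma ode_uniqueness (m : nat) : m%:R = d - 1 ->
  (forall e s0, 0 < e -> exists2 s, s0 <= s & line_energy s <= e) ->
  forall s, q s = 0.
Proof.
move=> md lim s; have HR := uniqueness_right lim.
have E0 : line_energy s = 0.
  case: (leP 0 s) => [/HR//|/ltW s0]; exact: (uniqueness_left md (HR 0 (lexx _))).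
by apply/eqP; rewrite -sqrf_eq0 eq_le sqr_ge0 andbT -E0 line_energy_ge.
Qed.

End uniqueness.

Section second_derivative.
Variables (R : realType) (d : nat).
Local Notation E := 'rV[R]_d.+1.

Lemma near0_lt (r : R) (P : R -> Prop) : 0 < r -> (forall t, `|t| < r -> P t) ->
  \forall t \near nbhs (0 : R), P t.
Proof.
move=> r0 H; apply/nbhs_ballP; exists r => //= t.
by rewrite /ball /= sub0r normrN => /H.
Qed.

Lemma is_derive_partial_line (f : E -> R) (x : E) i (t : R) : C1_on f ->
  x + t *: delta_mx 0 i != 0 ->
  is_derive t (1 : R) (fun t => f (x + t *: delta_mx 0 i))
    (partial i f (x + t *: delta_mx 0 i)).
Proof. by move=> cf x0; apply: is_derive_line; exact: C1_on_derivable. Qed.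

Lemma near_is_derive_unique (f g : R -> R) (x a b : R) :
  is_derive x (1 : R) f a -> is_derive x (1 : R) g b ->
  (\forall t \near nbhs x, f t = g t) -> a = b.
Proof. by move=> [_ <-] [_ <-] fg; exact: near_eq_derive. Qed.

Lemma second_partial (f : E -> R) (x : E) i (k k1 : R -> R) (k2 r : R) :
  C1_on f -> C1_on (partial i f) -> 0 < r ->
  (forall t : R, `|t| < r -> [/\ x + t *: delta_mx 0 i != 0,
     f (x + t *: delta_mx 0 i) = k t & is_derive t (1 : R) k (k1 t)]) ->
  is_derive (0 : R) (1 : R) k1 k2 ->
  partial i (partial i f) x = k2.
Proof.
move=> cf cpf r0 H dk1.
have E1 t : `|t| < r -> partial i f (x + t *: delta_mx 0 i) = k1 t.
  move=> tr; have [x0 _ dk] := H t tr.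
  apply: (near_is_derive_unique (is_derive_partial_line cf x0) dk).
  apply/nbhs_ballP; exists (r - `|t|); first by rewrite /= subr_gt0.
  move=> u; rewrite /ball /= => tu; have [|_ -> //] := H u.
  rewrite -(subrK t u); apply: le_lt_trans (ler_normD _ _) _.
  by rewrite -ltrBrDr distrC.
have x00 : x + 0 *: delta_mx 0 i != 0 by have [] := H 0; rewrite ?normr0.
have := near_is_derive_unique (is_derive_partial_line cpf x00) dk1.
rewrite scale0r addr0; apply.
exact: near0_lt r0 E1.
Qed.

Lemma continuous_eq0 (D : R -> R) : {for 0, continuous D} ->
  (forall t, 0 < t -> D t = 0) -> D 0 = 0.
Proof.
move=> cD D0; apply/eqP; rewrite -normr_le0; apply/ler_addgt0Pl => e e0.
rewrite addr0; have /cvgrPdist_le/(_ e e0) := cD.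
move=> /nbhs_ballP[r /= r0 /(_ (r / 2))]; rewrite /ball /= sub0r normrN.
rewrite (D0 (r / 2)) ?divr_gt0// subr0; apply.
by rewrite gtr0_norm ?divr_gt0// ltr_pdivrMr// ltr_pMr// ltr1n.
Qed.

End second_derivative.

Section zonal.
Variables (R : realType) (d n : nat).
Local Notation E := 'rV[R]_d.+1.
Variables (psi : E -> R) (G : {poly R}).
Hypothesis hd : (1 < d)%N.
Hypothesis hn : (0 < n)%N.
Let l : R := n%:R * (n%:R + d%:R - 1).
Hypothesis Hpsi : spherical_harmonic n psi.
Hypothesis zon : forall x y, unit_sphere R d x -> unit_sphere R d y ->
  x 0 0 = y 0 0 -> psi x = psi y.
Hypothesis HG : gegenbauer_eq d%:R l G.
Hypothesis G1 : G.[1] = 1.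

Let F := radial_ext psi.
Let C : C1_on F := (spherical_harmonic_C1 Hpsi).1.
Let CC i : C1_on (partial i F) := (spherical_harmonic_C1 Hpsi).2 i.

Let i1 : 'I_d.+1 := Ordinal (leqW hd).
Let i10 : i1 != 0. Proof. by []. Qed.
Let i01 : (0 == i1) = false. Proof. by []. Qed.
Let e0 : E := delta_mx 0 0.
Let e1 : E := delta_mx 0 i1.
(** The tangent line at [e1] in the direction of the pole [e0]. Its radial projection is the open
    half great circle through [e1] between the poles, at height [s / sqrt (1 + s^2)]. *)
Let pt (s : R) : E := e1 + s *: e0.

Let e00 i : e0 0 i = (i == 0)%:R. Proof. by rewrite mxE eqxx. Qed.
Let e10 i : e1 0 i = (i == i1)%:R. Proof. by rewrite mxE eqxx. Qed.

Lemma radial_zonal (x y : E) : x != 0 -> y != 0 ->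
  x 0 0 / eucl_norm x = y 0 0 / eucl_norm y -> F x = F y.
Proof.
move=> x0 y0 xy; apply: zon; [exact: normalize_unit..|].
by rewrite !mxE ![_^-1 * _]mulrC.
Qed.

Lemma dot_pt (s : R) : dot (pt s) (pt s) = 1 + s ^+ 2.
Proof.
rewrite /pt !(dotDl, dotDr, dotZl, dotZr) !dot_delta !e00 !e10 !eqxx.
by rewrite (negbTE i10) i01 /=; ring.
Qed.

Lemma pt_neq0 (s : R) : pt s != 0.
Proof. by rewrite -dot_eq0 dot_pt gt_eqF// ltr_pwDl// sqr_ge0. Qed.

Lemma eucl_norm_pt (s : R) : eucl_norm (pt s) = hyp s.
Proof. by rewrite eucl_normE dot_pt. Qed.

Lemma pt0 (s : R) : pt s 0 0 = s.
Proof. by rewrite !mxE !eqxx /= mulr1 add0r. Qed.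

Let L s := F (pt s).
Let L1 s := partial 0 F (pt s).
Let L2 s := partial 0 (partial 0 F) (pt s).

Lemma is_derive_L (s : R) : is_derive s (1 : R) L (L1 s).
Proof. exact: (is_derive_partial_line C (pt_neq0 s)). Qed.

Lemma is_derive_L1 (s : R) : is_derive s (1 : R) L1 (L2 s).
Proof. exact: (is_derive_partial_line (CC 0) (pt_neq0 s)). Qed.

(** Moving [pt s] along [e1] gives [1 + t] times [pt (s / (1 + t))], and the extension ignores the
    factor. The second derivative thus reduces to derivatives along the line. *)
Lemma second_partial1 (s : R) :
  partial i1 (partial i1 F) (pt s) = 2 * s * L1 s + s ^+ 2 * L2 s.
Proof.
pose u (t : R) := s * (1 + t)^-1.
pose u1 (t : R) := - s * ((1 + t) ^+ 2)^-1.
have half (t : R) : `|t| < 1 / 2 -> 0 < 1 + t by rewrite ltr_norml; lra.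
have d1t (t : R) : is_derive t (1 : R) (fun t => 1 + t) 1.
  by apply: (is_derive_eqd (is_derive_add (is_derive_c 1 t) (is_derive_x t))); rewrite add0r.
have du t : `|t| < 1 / 2 -> is_derive t (1 : R) u (u1 t).
  move=> /half t0.
  apply: (is_derive_eqd (is_derive_scale s (is_derive_inv (lt0r_neq0 t0) (d1t t)))).
  by rewrite /u1; field; rewrite gt_eqF.
apply: (@second_partial R d F (pt s) i1 (fun t => L (u t))
  (fun t => L1 (u t) * u1 t) _ (1 / 2) C (CC i1)).
- by rewrite divr_gt0.
- move=> t tr; have t0 := half t tr.
  have E1 : pt s + t *: delta_mx 0 i1 = (1 + t) *: pt (u t).
    rewrite /pt -/e1 scalerDr scalerA /u mulrCA divff ?gt_eqF// mulr1.
    by rewrite scalerDl scale1r addrAC.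
  split.
  + by rewrite E1 scaler_eq0 gt_eqF// pt_neq0.
  + by rewrite E1 /F radial_extZ.
  + exact: (is_derive_compo (is_derive_L (u t)) (du t tr)).
have h0 : `|0 : R| < 1 / 2 by rewrite normr0 divr_gt0.
have D2 : is_derive (0 : R) (1 : R) u1 (2 * s).
  have := is_derive_exp 2 (d1t 0) => D.
  have nz : (1 + 0 : R) ^+ 2 != 0 by rewrite addr0 expr1n oner_neq0.
  apply: (is_derive_eqd (is_derive_scale (- s) (@is_derive_inv R (fun t => (1 + t) ^+ 2) 0 _ nz D))).
  by rewrite /= addr0 !expr1n; field.
apply: (is_derive_eqd (is_derive_mul (is_derive_compo (is_derive_L1 (u 0)) (du 0 h0)) D2)).
by rewrite /u /u1 addr0 expr1n invr1 mulr1; ring.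
Qed.

(** Moving sideways leaves the plane of the line, but by zonality the value is that at the point of
    the line of the same normalized height, namely [pt (s / hyp t)]. *)
Lemma second_partialS (s : R) j : j != 0 -> j != i1 ->
  partial j (partial j F) (pt s) = - s * L1 s.
Proof.
move=> j0 j1; pose u (t : R) := s * (hyp t)^-1.
pose u1 (t : R) := s * (- (t / hyp t) / hyp t ^+ 2).
have hyp0 t := lt0r_neq0 (@hyp_gt0 R t).
have du (t : R) : is_derive t (1 : R) u (u1 t).
  exact: (is_derive_scale s (@is_derive_inv R (@hyp R) t _ (hyp0 t) (is_derive_hyp t))).
have dotp (t : R) : dot (pt s + t *: delta_mx 0 j) (pt s + t *: delta_mx 0 j) = 1 + s ^+ 2 + t ^+ 2.
  rewrite dot_line dot_pt !dot_delta.
  by rewrite !mxE !eqxx (negbTE j0) (negbTE j1) /=; ring.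
have pos (t : R) : 0 < 1 + s ^+ 2 + t ^+ 2.
  by rewrite -addrA ltr_pwDl// addr_ge0// sqr_ge0.
have nz (t : R) : pt s + t *: delta_mx 0 j != 0 by rewrite -dot_eq0 dotp gt_eqF.
apply: (@second_partial R d F (pt s) j (fun t => L (u t))
  (fun t => L1 (u t) * u1 t) _ 1 C (CC j)).
- exact: ltr01.
- move=> t _; split => //.
  + apply: radial_zonal => //; first exact: pt_neq0.
    rewrite eucl_norm_pt pt0 eucl_normE dotp.
    have -> : (pt s + t *: delta_mx 0 j) 0 0 = s.
      by rewrite mxE pt0 !mxE eq_sym (negbTE j0) andbF mulr0 addr0.
    have -> : Num.sqrt (1 + s ^+ 2 + t ^+ 2) = hyp (u t) * hyp t.
      rewrite /hyp -sqrtrM ?addr_ge0 ?sqr_ge0//; congr (Num.sqrt _).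
      by rewrite /u exprMn exprVn hyp_sqr; field; rewrite gt_eqF// ltr_pwDl// sqr_ge0.
    by rewrite /u invfM [_^-1 * _]mulrC mulrA.
  + exact: (is_derive_compo (is_derive_L (u t)) (du t)).
have hyp00 : hyp (0 : R) = 1 by rewrite /hyp expr0n addr0 sqrtr1.
pose w (t : R) := - s * (hyp t ^+ 3)^-1.
have nz3 : hyp (0 : R) ^+ 3 != 0 by rewrite hyp00 expr1n oner_neq0.
have Dw := is_derive_scale (- s) (@is_derive_inv R (fun t => hyp t ^+ 3) 0 _ nz3
  (is_derive_exp 3 (is_derive_hyp 0))).
have D := is_derive_mul (is_derive_compo (is_derive_L1 (u 0)) (du 0))
  (is_derive_mul Dw (is_derive_x 0)).
rewrite (_ : (fun t => L1 (u t) * u1 t) =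
  (fun t => L1 (u t) * ((- s / hyp t ^+ 3) * t))); last first.
  by apply/funext => t; congr (_ * _); rewrite /u1; field.
apply: (is_derive_eqd D).
by rewrite /u1 /u !(hyp00, expr1n, invr1, mulr0, mul0r, mulr1); ring.
Qed.

Lemma ode_L (s : R) :
  (1 + s ^+ 2) ^+ 2 * L2 s + (3 - d%:R) * s * (1 + s ^+ 2) * L1 s + l * L s = 0.
Proof.
have := laplacian_radial_ext Hpsi (pt_neq0 s).
rewrite (bigD1 0)//= (bigD1 i1)//= second_partial1 -/F -/(L2 s) dot_pt.
have -> : \sum_(i | (i != 0) && (i != i1)) partial i (partial i F) (pt s) =
    (d%:R - 1) * (- s * L1 s).
  transitivity (\sum_(i : 'I_d.+1 | (i != 0) && (i != i1)) (- s * L1 s)).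
    by apply: eq_bigr => i /andP[i0 ii1]; exact: second_partialS.
  have : \sum_(i < d.+1) (- s * L1 s) = d.+1%:R * (- s * L1 s).
    by rewrite sumr_const card_ord mulr_natl.
  rewrite (bigD1 0)//= (bigD1 i1)//= -natr1 => H.
  by apply: (addrI (- s * L1 s)); apply: (addrI (- s * L1 s)); rewrite H; ring.
have -> : (n * (n + d - 1))%:R = l by rewrite /l natrM natrB ?natrD//; lia.
have p0 : 1 + s ^+ 2 != 0 by rewrite gt_eqF// ltr_pwDl// sqr_ge0.
rewrite -/(L s) => H.
have -> : l * L s = - ((1 + s ^+ 2) * (- l / (1 + s ^+ 2) * L s)) by field.
by rewrite -H; ring.
Qed.

Let hyp0 (s : R) : hyp s != 0. Proof. by rewrite gt_eqF// hyp_gt0. Qed.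

Let z (s : R) := s / hyp s.
Let M1 (s : R) := G^`().[z s] * (hyp s ^+ 3)^-1.
Let M2 (s : R) := G^`()^`().[z s] * (hyp s ^+ 6)^-1
  - 3 * s * (hyp s ^+ 5)^-1 * G^`().[z s].

Lemma is_derive_z (s : R) : is_derive s (1 : R) z (hyp s ^+ 3)^-1.
Proof.
apply: (is_derive_eqd (is_derive_mul (is_derive_x s)
  (@is_derive_inv R (@hyp R) s _ (hyp0 s) (is_derive_hyp s)))).
have -> : (hyp s ^+ 3)^-1 = (hyp s ^+ 2 - s ^+ 2) / hyp s ^+ 3.
  by rewrite hyp_sqr addrK mul1r.
by field.
Qed.

Lemma is_derive_M (s : R) : is_derive s (1 : R) (fun s => G.[z s]) (M1 s).
Proof. exact: (is_derive_compo (is_derive_poly G (z s)) (is_derive_z s)). Qed.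

Lemma is_derive_M1 (s : R) : is_derive s (1 : R) M1 (M2 s).
Proof.
have nz : hyp s ^+ 3 != 0 by rewrite expf_neq0.
apply: (is_derive_eqd (is_derive_mul
  (is_derive_compo (is_derive_poly G^`() (z s)) (is_derive_z s))
  (@is_derive_inv R (fun s => hyp s ^+ 3) s _ nz (is_derive_exp 3 (is_derive_hyp s))))).
by rewrite /M2 /=; field.
Qed.

Lemma ode_M (s : R) :
  (1 + s ^+ 2) ^+ 2 * M2 s + (3 - d%:R) * s * (1 + s ^+ 2) * M1 s + l * G.[z s] = 0.
Proof.
rewrite -(gegenbauer_eqE (z s) HG).
have -> : 1 - z s ^+ 2 = (hyp s ^+ 2)^-1.
  have -> : (hyp s ^+ 2)^-1 = (hyp s ^+ 2 - s ^+ 2) / hyp s ^+ 2.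
    by rewrite hyp_sqr addrK mul1r.
  by rewrite /z; field.
rewrite -hyp_sqr /M2 /M1 /z.
set g := G.[_]; set g1 := G^`().[_]; set g2 := G^`()^`().[_].
by field.
Qed.

Let c := psi e0.
Let q s := L s - c * G.[z s].
Let q1 s := L1 s - c * M1 s.
Let q2 s := L2 s - c * M2 s.

Let dq (s : R) : is_derive s (1 : R) q (q1 s).
Proof. exact: (is_derive_sub (is_derive_L s) (is_derive_scale c (is_derive_M s))). Qed.

Let dq1 (s : R) : is_derive s (1 : R) q1 (q2 s).
Proof. exact: (is_derive_sub (is_derive_L1 s) (is_derive_scale c (is_derive_M1 s))). Qed.

Let ode_q (s : R) :
  (1 + s ^+ 2) ^+ 2 * q2 s + (3 - d%:R) * s * (1 + s ^+ 2) * q1 s + l * q s = 0.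
Proof.
transitivity (
  ((1 + s ^+ 2) ^+ 2 * L2 s + (3 - d%:R) * s * (1 + s ^+ 2) * L1 s + l * L s) - c *
  ((1 + s ^+ 2) ^+ 2 * M2 s + (3 - d%:R) * s * (1 + s ^+ 2) * M1 s + l * G.[z s])).
  by rewrite /q /q1 /q2; ring.
by rewrite ode_L ode_M mulr0 subr0.
Qed.

(* The limit [s -> +oo] of the energy in the chart [pt] is read off in the chart
   [pole] around [e0], where [psi] is differentiable. *)
Let pole (t : R) : E := e0 + t *: e1.
Let H t := F (pole t).
Let H1 t := partial i1 F (pole t).

Lemma dot_pole t : dot (pole t) (pole t) = 1 + t ^+ 2.
Proof.
rewrite /pole dot_line !dot_delta !e00 !e10 !eqxx (negbTE i10) /=; ring.
Qed.

Lemma pole_neq0 t : pole t != 0.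
Proof. by rewrite -dot_eq0 dot_pole gt_eqF// ltr_pwDl// sqr_ge0. Qed.

Lemma eucl_norm_pole t : eucl_norm (pole t) = hyp t.
Proof. by rewrite eucl_normE dot_pole. Qed.

Lemma pole00 t : pole t 0 0 = 1.
Proof. by rewrite !mxE !eqxx /= mulr0 addr0. Qed.

Lemma is_derive_H (t : R) : is_derive t (1 : R) H (H1 t).
Proof. exact: (is_derive_partial_line C (pole_neq0 t)). Qed.

Let hypN (t : R) : hyp (- t) = hyp t. Proof. by rewrite /hyp sqrrN. Qed.

Lemma H_even t : H (- t) = H t.
Proof.
apply: radial_zonal; [exact: pole_neq0..|].
by rewrite !eucl_norm_pole !pole00 hypN.
Qed.

(** By zonality [H] is even, so its derivative vanishes at the pole. This removes the gradient term
    from the limit of the energy. *)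
Lemma H1_0 : H1 0 = 0.
Proof.
have D := @is_derive_compo R H (fun t : R => -1 * t) 0 _ _ (is_derive_H (-1 * 0))
  (is_derive_scale (-1) (is_derive_x 0)).
have E1 : H1 (-1 * 0) * (-1 * 1) = H1 0.
  apply: (near_is_derive_unique D (is_derive_H 0)).
  by apply: nearW => t; rewrite mulN1r H_even.
by move: E1; rewrite mulr0; lra.
Qed.

Lemma L_pole (s : R) : 0 < s -> L s = H s^-1.
Proof.
move=> s0; rewrite /L /H /F.
have -> : pt s = s *: pole s^-1.
  by rewrite /pole scalerDr scalerA divff ?gt_eqF// scale1r addrC.
by rewrite radial_extZ.
Qed.

Lemma L1_pole (s : R) : 0 < s -> L1 s = - H1 s^-1 / s ^+ 2.
Proof.
move=> s0.
have D := @is_derive_compo R H (fun t : R => t^-1) s _ _ (is_derive_H s^-1)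
  (@is_derive_inv R (fun t => t) s _ (lt0r_neq0 s0) (is_derive_x s)).
rewrite (near_is_derive_unique (is_derive_L s) D) ?mulrN1 ?mulN1r; first by field; rewrite gt_eqF.
apply/nbhs_ballP; exists s => // t; rewrite /ball /= => ts.
by apply: L_pole; move: ts; rewrite ltr_norml; lra.
Qed.

Let l0 : 0 < l.
Proof.
rewrite mulr_gt0 ?ltr0n// -addrA ltr_pwDl ?ltr0n// subr_ge0 ler1n.
exact: ltnW.
Qed.

(** The energy at [s = 1 / t], in a form that still makes sense at [t = 0]. It is continuous there,
    with value 0 because [H 0 = c], [G(1) = 1] and [H1 0 = 0]. *)
Let Et (t : R) := (H t - c * G.[(hyp t)^-1]) ^+ 2 +
  ((1 + t ^+ 2) * (H1 t + c * (G^`().[(hyp t)^-1] * (t * (hyp t ^+ 3)^-1)))) ^+ 2 * l^-1.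

Let EtP (t : R) : 0 < t -> line_energy l q q1 t^-1 = Et t.
Proof.
move=> t0; have t1 : 0 < t^-1 by rewrite invr_gt0.
have hV : hyp t^-1 = hyp t / t.
  have -> : hyp t / t = Num.sqrt ((hyp t / t) ^+ 2).
    by rewrite sqrtr_sqr gtr0_norm// divr_gt0// hyp_gt0.
  congr (Num.sqrt _); rewrite exprMn hyp_sqr exprVn; field.
  by rewrite gt_eqF.
have zV : z t^-1 = (hyp t)^-1 by rewrite /z hV; field; rewrite hyp0 gt_eqF.
rewrite /line_energy /q /q1 L_pole// L1_pole// invrK /M1 zV hV /Et.
set g := G.[_]; set g1 := G^`().[_]; set h := H t; set h1 := H1 t.
by field; rewrite hyp0 !gt_eqF.
Qed.

Let Et_continuous : {for 0, continuous Et}.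
Proof.
have DV := @is_derive_inv R (@hyp R) 0 _ (hyp0 0) (is_derive_hyp 0).
have nz : hyp (0 : R) ^+ 3 != 0 by rewrite expf_neq0.
have DV3 := @is_derive_inv R (fun t => hyp t ^+ 3) 0 _ nz (is_derive_exp 3 (is_derive_hyp 0)).
have DG := @is_derive_compo R (fun t => G.[t]) (fun t => (hyp t)^-1) 0 _ _ (is_derive_poly G (hyp 0)^-1) DV.
have DG1 := @is_derive_compo R (fun t => G^`().[t]) (fun t => (hyp t)^-1) 0 _ _
  (is_derive_poly G^`() (hyp 0)^-1) DV.
have DH1 := is_derive_partial_line (CC i1) (pole_neq0 0).
have A1 := is_derive_exp 2 (is_derive_sub (is_derive_H 0) (is_derive_scale c DG)).
have A2 := is_derive_add DH1 (is_derive_scale c (is_derive_mul DG1 (is_derive_mul (is_derive_x 0) DV3))).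
have A3 := is_derive_mul (is_derive_exp 2 (is_derive_mul (is_derive_1sqr 0) A2)) (is_derive_c l^-1 0).
exact: (is_derive_continuous (is_derive_add A1 A3)).
Qed.

Let Et0 : Et 0 = 0.
Proof.
have h0 : hyp (0 : R) = 1 by rewrite /hyp expr0n addr0 sqrtr1.
have Hc : H 0 = c.
  rewrite /H /pole scale0r addr0 /F radial_ext_unit//.
  by apply/unit_sphereE; rewrite dot_delta e00 eqxx.
by rewrite /Et h0 invr1 G1 H1_0 Hc mulr1 subrr mul0r !mulr0 addr0 mulr0 expr0n mul0r addr0.
Qed.

Lemma zonal_line (s : R) : L s = c * G.[s / hyp s].
Proof.
apply/eqP; rewrite -subr_eq0; apply/eqP.
have d1 : 1 <= d%:R :> R by rewrite ler1n ltnW.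
apply: (@ode_uniqueness R d%:R l q q1 q2 d1 l0 dq dq1 ode_q d.-1).
  by rewrite -subn1 natrB// ltnW.
move=> e s0 e0'; have /cvgrPdist_le/(_ e e0') := Et_continuous.
move=> /nbhs_ballP[r /= r0 Hr].
(* The first bound keeps [t] within the radius of continuity at 0; the second makes [1 / t] exceed
   [s0]. *)
pose t := Num.min (r / 2) (`|s0| + 1)^-1.
have p1 : 0 < `|s0| + 1 by rewrite ltr_wpDl.
have t0 : 0 < t by rewrite lt_min divr_gt0//= invr_gt0.
exists t^-1.
  apply: le_trans (ler_norm _) _; apply: (@le_trans _ _ (`|s0| + 1)); first by rewrite lerDl.
  by rewrite -[X in X <= _]invrK lef_pV2 ?posrE ?invr_gt0// ge_min lexx orbT.
rewrite EtP//; have := Hr t; rewrite /ball /= sub0r normrN gtr0_norm// Et0 sub0r normrN.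
move=> H'; apply: le_trans (ler_norm _) (H' _).
apply: (@le_lt_trans _ _ (r / 2)); first by rewrite ge_min lexx.
by rewrite ltr_pdivrMr// ltr_pMr// ltr1n.
Qed.

Lemma zonal_harmonicE (y : E) : unit_sphere R d y -> psi y = c * G.[y 0 0].
Proof.
move=> yS; rewrite -(radial_ext_unit psi yS) -/F.
have y1 : `|y 0 0| <= 1.
  rewrite -(@expr_le1 _ 2)// real_normK ?num_real//.
  have := dot_CS y e0; rewrite !dot_delta e00 eqxx mulr1.
  by rewrite (unit_sphereE y).1.
have ny : eucl_norm y = 1 by rewrite eucl_normE (unit_sphereE y).1// sqrtr1.
have y0 := unit_sphere_neq0 yS.
have [y2|y2] := eqVneq (y 0 0 ^+ 2) 1; last first.
  have lt1 : y 0 0 ^+ 2 < 1.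
    by rewrite lt_neqAle y2 -real_normK ?num_real// expr_le1.
  pose r := Num.sqrt (1 - y 0 0 ^+ 2).
  have r0 : 0 < r by rewrite sqrtr_gt0 subr_gt0.
  have r2 : r ^+ 2 = 1 - y 0 0 ^+ 2 by rewrite sqr_sqrtr// subr_ge0 ltW.
  have hr : hyp (y 0 0 / r) = r^-1.
    transitivity (Num.sqrt (r^-1 ^+ 2)); last first.
      by rewrite sqrtr_sqr gtr0_norm// invr_gt0.
    congr (Num.sqrt _); rewrite exprMn !exprVn.
    have r20 : r ^+ 2 != 0 by rewrite expf_neq0// gt_eqF.
    by apply: (mulIf r20); rewrite mulrDl mul1r divfK// mulVf// r2 subrK.
  have zr : y 0 0 / r / hyp (y 0 0 / r) = y 0 0 by rewrite hr invrK divfK// gt_eqF.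
  rewrite -[in RHS]zr -zonal_line; apply: radial_zonal => //; first exact: pt_neq0.
  by rewrite ny divr1 pt0 eucl_norm_pt zr.
have /orP[/eqP y11|/eqP y1N] : (y 0 0 == 1) || (y 0 0 == -1).
- by rewrite -eqf_sqr y2 expr1n.
- rewrite y11 G1 mulr1 /c -(radial_ext_unit psi (x := e0)) -/F; last first.
    by apply/unit_sphereE; rewrite dot_delta e00 eqxx.
  apply: radial_zonal => //; first by rewrite -dot_eq0 dot_delta e00 eqxx oner_neq0.
  by rewrite ny y11 eucl_normE dot_delta e00 eqxx sqrtr1.
(* The half great circle does not contain [- e0]. This line through it meets the projected half
   circle for [t > 0], and the value at [t = 0] follows by continuity. *)
pose opole (t : R) : E := - e0 + t *: e1.
have dop t : dot (opole t) (opole t) = 1 + t ^+ 2.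
  by rewrite /opole dot_line !(dotNl, dotNr) !dot_delta !e00 !e10 !eqxx (negbTE i10) /=; ring.
have nop t : opole t != 0 by rewrite -dot_eq0 dop gt_eqF// ltr_pwDl// sqr_ge0.
have op00 t : opole t 0 0 = -1 by rewrite !mxE !eqxx /= mulr0 addr0.
have enop t : eucl_norm (opole t) = hyp t by rewrite eucl_normE dop.
pose D t := F (opole t) - c * G.[0 - (hyp t)^-1].
have D0 : D 0 = 0.
  apply: continuous_eq0 => [|t t0].
    have DV := @is_derive_inv R (@hyp R) 0 _ (hyp0 0) (is_derive_hyp 0).
    have DNV := is_derive_sub (is_derive_c 0 0) DV.
    have DG := @is_derive_compo R (fun t => G.[t]) (fun t => 0 - (hyp t)^-1) 0 _ _
      (is_derive_poly G (0 - (hyp 0)^-1)) DNV.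
    exact: (is_derive_continuous (is_derive_sub (is_derive_partial_line C (nop 0)) (is_derive_scale c DG))).
  have hV : hyp (- t^-1) = hyp t / t.
    rewrite hypN.
    have -> : hyp t / t = Num.sqrt ((hyp t / t) ^+ 2).
      by rewrite sqrtr_sqr gtr0_norm// divr_gt0// hyp_gt0.
    congr (Num.sqrt _); rewrite exprMn hyp_sqr exprVn; field.
    by rewrite gt_eqF.
  have zt : - t^-1 / hyp (- t^-1) = - (hyp t)^-1.
    by rewrite hV; field; rewrite hyp0 gt_eqF.
  apply/eqP; rewrite subr_eq0 sub0r -zt -zonal_line; apply/eqP/radial_zonal => //.
    exact: pt_neq0.
  by rewrite op00 enop pt0 eucl_norm_pt zt mulN1r.
have h0 : hyp (0 : R) = 1 by rewrite /hyp expr0n addr0 sqrtr1.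
move: D0; rewrite /D h0 invr1 sub0r => /eqP; rewrite subr_eq0 y1N => /eqP <-.
apply: (radial_zonal y0 (nop 0)).
by rewrite op00 enop h0 y1N ny.
Qed.

End zonal.

(** * The reproducing kernel *)

Lemma Rintegral_lin d (T : measurableType d) (R : realType)
    (mu : {measure set T -> \bar R}) (D : set T) (I : Type) (r : seq I)
    (c : I -> R) (g : I -> T -> R) : measurable D ->
  (forall i, mu.-integrable D (EFin \o g i)) ->
  mu.-integrable D (EFin \o (fun t => \sum_(i <- r) c i * g i t)) /\
  \int[mu]_(t in D) (\sum_(i <- r) c i * g i t) =
  \sum_(i <- r) c i * \int[mu]_(t in D) g i t.
Proof.
move=> mD ig; elim: r => [|i r [IH1 IH2]].
  rewrite (_ : (fun t => _) = fun=> 0); last by apply/funext => t; rewrite big_nil.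
  by split; [exact: integrable0|rewrite Rintegral_cst// big_nil mul0r].
rewrite (_ : (fun t => _) = fun t => c i * g i t + \sum_(i <- r) c i * g i t); last first.
  by apply/funext => t; rewrite big_cons.
have igi : mu.-integrable D (EFin \o (fun t => c i * g i t)).
  by have := integrableZl mD (c i) (ig i).
split; first by have := integrableD mD igi IH1.
by rewrite RintegralD// RintegralZl// IH2 big_cons.
Qed.

Section kernel.
Variables (R : realType) (d n k : nat).
Local Notation E := 'rV[R]_d.+1.
Local Notation T := (d.+1.-tuple (measurableTypeR R)).
Local Notation S := (sphere_measure R d.+1).
Local Notation U := (unit_tuple R d.+1).
Local Notation row := (@row_of_tuple R d).
Variable phi : 'I_k -> E -> R.
Hypothesis Hphi : orthonormal_harmonic_basis n phi.
Hypothesis k0 : (0 < k)%N.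

Lemma row_unit (t : T) : U t -> unit_sphere R d (row t).
Proof.
rewrite /unit_tuple /unit_sphere /= /tuple_norm /eucl_norm => <-.
by congr (Num.sqrt _); apply: eq_bigr => i _; rewrite mxE.
Qed.

Lemma harmonic_measurable psi : spherical_harmonic n psi ->
  measurable_fun U (fun t => psi (row t)).
Proof.
move=> H; have [C _] := spherical_harmonic_C1 H.
apply: (@eq_measurable_fun _ _ _ _ _ (fun t => radial_ext psi (row t))).
  by move=> t /set_mem Ut; rewrite radial_ext_unit//; exact: row_unit.
have oV : open [set x : E | x != 0].
  by rewrite openE => x /near_neq0.
have mf := @continuous_measurable_tuple R d.+1 (radial_ext psi) _ oV
  (fun x x0 => (C x x0).1).
apply: measurable_funS mf; first exact: open_measurable_tuple oV.
by move=> t /row_unit /unit_sphere_neq0.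
Qed.

Local Notation inner := (@sphere_inner R d).

Lemma inner_basis i j : inner (phi i) (phi j) = (i == j)%:R.
Proof. by have [_ -> _] := Hphi. Qed.

Lemma basis_harmonic i : spherical_harmonic n (phi i).
Proof. by have [H _ _] := Hphi; exact: H. Qed.

Let mU : measurable U := @measurable_unit_tuple R d.+1.

Lemma sqr_integrable i : S.-integrable U (EFin \o (fun t => phi i (row t) * phi i (row t))).
Proof.
have mf := harmonic_measurable (basis_harmonic i).
have mf2 : measurable_fun U (fun t => phi i (row t) * phi i (row t)).
  exact: measurable_funM.
apply/integrableP; split; first exact/measurable_EFinP.
(* An infinite integral would have real value 0 under [fine], whereas the basis function has norm
   1. *)
rewrite ltNge leye_eq; apply/negP => /eqP H.
have := inner_basis i i; rewrite /sphere_inner /Rintegral eqxx.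
have -> : (\int[S]_(t in U) (phi i (row t) * phi i (row t))%:E = +oo)%E.
  rewrite -[RHS]H; apply: eq_integral => t _ /=.
  by rewrite ger0_norm// -expr2 sqr_ge0.
by move=> /esym/eqP; rewrite /= oner_eq0.
Qed.

Lemma mul_integrable i j : S.-integrable U (EFin \o (fun t => phi i (row t) * phi j (row t))).
Proof.
have mf i := harmonic_measurable (basis_harmonic i).
pose sq i (t : T) := phi i (row t) * phi i (row t).
apply: (@le_integrable _ _ _ S U mU _ ((EFin \o sq i) \+ (EFin \o sq j))%E).
- by apply/measurable_EFinP; exact: measurable_funM.
- move=> t _; rewrite [leRHS]/= [leLHS]/= lee_fin /sq.
  rewrite [leRHS]ger0_norm; last by rewrite addr_ge0// -expr2 sqr_ge0.
  set a := phi i _; set b := phi j _.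
  rewrite ler_norml; have := sqr_ge0 (a + b); have := sqr_ge0 (a - b).
  have := sqr_ge0 a; have := sqr_ge0 b; rewrite !expr2; lra.
- by apply: integrableD => //; exact: sqr_integrable.
Qed.

Lemma inner_span (c e : 'I_k -> R) :
  inner (fun x => \sum_l c l * phi l x) (fun x => \sum_m e m * phi m x) =
  \sum_l c l * e l.
Proof.
rewrite /sphere_inner.
have := @Rintegral_lin _ _ _ S U ('I_k * 'I_k)%type (index_enum _)
  (fun p => c p.1 * e p.2) (fun p t => phi p.1 (row t) * phi p.2 (row t)) mU
  (fun p => mul_integrable p.1 p.2).
move=> [_]; rewrite -(pair_bigA _ (fun l m => c l * e m *
  (\int[S]_(t in U) (phi l (row t) * phi m (row t)))))/=.
under [X in _ = X -> _]eq_bigr => l _.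
  under eq_bigr => m _ do rewrite [X in _ * X]inner_basis.
  rewrite (bigD1 l)//= eqxx mulr1 big1 ?addr0 => [|m /negbTE]; last first.
    by rewrite eq_sym => ->; rewrite mulr0.
  over.
move=> <-; apply: eq_Rintegral => t _.
rewrite -(pair_bigA _ (fun l m => c l * e m * (phi l (row t) * phi m (row t))))/=.
rewrite mulr_suml; apply: eq_bigr => l _; rewrite mulr_sumr.
by apply: eq_bigr => m _; ring.
Qed.

Lemma inner_reflection (v : E) psi1 psi2 : dot v v = 1 ->
  S.-integrable U (EFin \o (fun t => psi1 (row t) * psi2 (row t))) ->
  inner (fun x => psi1 (x *m reflection v)) (fun x => psi2 (x *m reflection v)) =
  inner psi1 psi2.
Proof.
move=> v1 ig; rewrite /sphere_inner /Rintegral; congr fine.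
have v1' : \sum_i v 0 i ^+ 2 = 1 by rewrite -[RHS]v1; apply: eq_bigr => i _; rewrite expr2.
rewrite -(sphere_integral_reflect v1' ig); apply: eq_integral => t _ /=.
have -> // : row (tuple_reflect (v 0) t) = row t *m reflection v.
rewrite mulmx_reflection; apply/rowP => i; rewrite !mxE tnth_tuple_reflect.
have -> // : tdot (v 0) t = dot (row t) v.
by apply: eq_bigr => j _; rewrite mxE mulrC.
Qed.

Lemma eq_inner psi1 psi2 chi1 chi2 :
  (forall x, unit_sphere R d x -> psi1 x = chi1 x) ->
  (forall x, unit_sphere R d x -> psi2 x = chi2 x) ->
  inner psi1 psi2 = inner chi1 chi2.
Proof.
move=> e1 e2; apply: eq_Rintegral => t /set_mem /row_unit tS.
by rewrite e1// e2.
Qed.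

Definition kernel x y : R := \sum_j phi j x * phi j y.

(** The reflected basis functions are harmonics again and remain orthonormal, so their coordinates
    form an orthogonal matrix, which drops out of the sum of products. *)
Lemma kernel_reflection v x y : dot v v = 1 -> unit_sphere R d x -> unit_sphere R d y ->
  kernel (x *m reflection v) (y *m reflection v) = kernel x y.
Proof.
move=> v1 xS yS; have [_ _ span] := Hphi.
have rO : (reflection v)^T *m reflection v = 1%:M.
  by rewrite reflection_tr reflectionK.
have /choice[c Hc] : forall j, exists c : 'I_k -> R, forall x, unit_sphere R d x ->
    phi j (x *m reflection v) = \sum_l c l * phi l x.
  move=> j; apply: span; exact: spherical_harmonic_mulmx (basis_harmonic j).
pose C : 'M[R]_k := \matrix_(j, l) c j l.
have CC : C *m C^T = 1%:M.
  apply/matrixP => i j; rewrite mxE [RHS]mxE -inner_basis.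
  rewrite -(inner_reflection v1 (mul_integrable i j)).
  rewrite (eq_inner (Hc i) (Hc j)) inner_span.
  by apply: eq_bigr => l _; rewrite !mxE.
have C'C := mulmx1C CC.
have CE l m : \sum_j c j l * c j m = (l == m)%:R.
  have := congr1 (fun M : 'M[R]_k => M l m) C'C; rewrite mxE [RHS]mxE => <-.
  by apply: eq_bigr => j _; rewrite !mxE.
rewrite /kernel; under eq_bigr do rewrite !Hc// mulr_suml.
rewrite exchange_big /=; apply: eq_bigr => l _.
transitivity (\sum_j \sum_m (c j l * c j m) * (phi l x * phi m y)).
  by apply: eq_bigr => j _; rewrite mulr_sumr; apply: eq_bigr => m _; ring.
rewrite exchange_big (bigD1 l)//= [X in _ + X]big1 ?addr0 => [|m ml].
  by rewrite -mulr_suml CE eqxx mul1r.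
by rewrite -mulr_suml CE eq_sym (negbTE ml) mul0r.
Qed.

Lemma kernel_diag x y : unit_sphere R d x -> unit_sphere R d y ->
  kernel x x = kernel y y.
Proof.
move=> xS yS; have [->//|xy] := eqVneq x y.
have dxy : dot x x = dot y y by rewrite (unit_sphereE x).1// (unit_sphereE y).1.
have [v v1 [xv _]] := reflection_swap dxy xy.
by rewrite -(kernel_reflection v1 xS xS) xv.
Qed.

(** The reflection exchanging [y] and [z] fixes [x]. *)
Lemma kernel_zonal x y z : unit_sphere R d x -> unit_sphere R d y ->
  unit_sphere R d z -> dot x y = dot x z -> kernel x y = kernel x z.
Proof.
move=> xS yS zS xyz; have [->//|yz] := eqVneq y z.
have dyz : dot y y = dot z z by rewrite (unit_sphereE y).1// (unit_sphereE z).1.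
have [v v1 [yv xv]] := reflection_swap dyz yz.
by rewrite -(kernel_reflection v1 xS yS) yv xv.
Qed.

(** The diagonal is constant, as reflections act transitively on the sphere, and its integral is [k]
    by orthonormality. *)
Lemma kernel_area x : unit_sphere R d x -> kernel x x * sphere_area R d.+1 = k%:R.
Proof.
move=> xS; set K := kernel x x.
have K0 : 0 <= K by apply: sumr_ge0 => j _; rewrite -expr2 sqr_ge0.
have kE : \int[S]_(t in U) (\sum_j 1 * (phi j (row t) * phi j (row t))) = k%:R.
  rewrite (Rintegral_lin _ _ mU (fun j => mul_integrable j j)).2.
  under eq_bigr do rewrite [X in _ * X]inner_basis eqxx mulr1.
  by rewrite sumr_const card_ord.
have KE : \int[S]_(t in U) (\sum_j 1 * (phi j (row t) * phi j (row t))) = K * fine (S U).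
  rewrite -Rintegral_cst//; apply: eq_Rintegral => t /set_mem /row_unit tS.
  by rewrite /K (kernel_diag xS tS); apply: eq_bigr => j _; rewrite mul1r.
by rewrite /sphere_area -KE kE.
Qed.

Lemma unit_sphere_delta : unit_sphere R d (delta_mx 0 0).
Proof. by apply/unit_sphereE; rewrite dot_delta mxE !eqxx. Qed.

(** Read off from the previous identity: a zero area would give [k = 0]. No volume has to be
    computed. *)
Lemma sphere_area_gt0 : 0 < sphere_area R d.+1.
Proof.
rewrite lt_def fine_ge0// andbT; apply/eqP => a0.
have := kernel_area unit_sphere_delta; rewrite a0 mulr0 => /esym /eqP.
by rewrite pnatr_eq0; case: (k) k0.
Qed.

Lemma kernel_diagE x : unit_sphere R d x -> kernel x x = k%:R / sphere_area R d.+1.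
Proof. by move=> xS; rewrite -(kernel_area xS) mulfK// gt_eqF// sphere_area_gt0. Qed.

End kernel.

Lemma harmonic_dim_gt0 d n : (1 < d)%N -> (0 < n)%N -> (0 < harmonic_dim d n)%N.
Proof.
move=> d1 n0; rewrite /harmonic_dim divn_gt0; last by lia.
apply: leq_trans (leq_pmulr _ _); first by lia.
by rewrite bin_gt0; lia.
Qed.

Section addition.
Variables (R : realType) (d n k : nat).
Hypotheses (hd : (1 < d)%N) (hn : (2 < n)%N) (k0 : (0 < k)%N).
Local Notation E := 'rV[R]_d.+1.
Variable phi : 'I_k -> E -> R.
Hypothesis Hphi : orthonormal_harmonic_basis n phi.
Local Notation K0 := (k%:R / sphere_area R d.+1).
Local Notation G := (gegenbauer R d n).
Local Notation e0 := (delta_mx 0 0 : E).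

(** The addition theorem. With one argument at the pole the kernel is a zonal harmonic, hence a
    multiple of [G]; a reflection brings any point to the pole. *)
Lemma kernel_gegenbauer x y : unit_sphere R d x -> unit_sphere R d y ->
  kernel phi x y = K0 * G.[dot x y].
Proof.
move=> xS yS.
have e0S : unit_sphere R d e0 by exact: unit_sphere_delta.
have He0 z : unit_sphere R d z -> kernel phi e0 z = K0 * G.[dot e0 z].
  move=> zS; have Hpsi : spherical_harmonic n (kernel phi e0).
    exact: spherical_harmonic_sum (basis_harmonic Hphi).
  rewrite (@zonal_harmonicE _ _ _ _ G hd _ Hpsi _ _ _ _ zS).
  - by rewrite (kernel_diagE Hphi k0)// dotC dot_delta.
  - by lia.
  - by move=> u v uS vS uv; apply: (kernel_zonal Hphi) => //; rewrite !(dotC e0) !dot_delta.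
  - exact: gegenbauerP.
  - exact: gegenbauer1.
have [->|xe0] := eqVneq x e0; first exact: He0.
have dxx : dot x x = dot e0 e0 by rewrite (unit_sphereE x).1// (unit_sphereE e0).1.
have [v v1 [xv _]] := reflection_swap dxx xe0.
rewrite -(kernel_reflection Hphi v1 xS yS) xv He0.
  by rewrite -{1}xv dot_reflection.
by apply/unit_sphereE; rewrite dot_reflection//; apply/unit_sphereE.
Qed.

Lemma kernel_diag_gt0 : 0 < K0.
Proof. by rewrite divr_gt0 ?ltr0n// (sphere_area_gt0 Hphi k0). Qed.
End addition.

(** * Excursion sets near the maximum *)

(** Cosine and sine of a step so small that the points [c p + s q] and [c p - s q] of [wave_arc]
    stay in the cone spanned by the ends of the arc; the last two bounds are the signs of their
    coordinates. *)
Lemma cone_perturbation (R : realType) (z r b e : R) :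
  0 <= z <= 1 -> 0 < r -> 0 < b -> 0 < e ->
  exists c s : R, [/\ c ^+ 2 + s ^+ 2 = 1, 1 - e <= c < 1, 0 < s,
    s * z / r <= c & s / r <= b * (c + s * z / r)].
Proof.
move=> /andP[z0 z1] r0 b0 e0.
(* Half-angle parameter of the circle. The four bounds give, in order, [c >= 1/2], [c >= 1 - e],
   [s / r <= 1/2] and [s / r <= b / 2]. *)
pose h := Num.min (Num.min (4^-1) (e / 2)) (Num.min (r / 4) (r * b / 4)).
have h0 : 0 < h by rewrite !lt_min invr_gt0 !divr_gt0 ?mulr_gt0 ?ltr0n.
have h1 : h <= 4^-1 by rewrite !ge_min lexx.
have h2 : h <= e / 2 by rewrite !ge_min lexx orbT.
have h3 : h <= r / 4 by rewrite !ge_min lexx !orbT.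
have h4 : h <= r * b / 4 by rewrite !ge_min lexx !orbT.
have p0 : 0 < 1 + h ^+ 2 by have := sqr_ge0 h; lra.
have hh : h ^+ 2 <= h / 4 by rewrite expr2 ler_wpM2l// ltW.
have hh0 : 0 < h ^+ 2 by rewrite exprn_gt0.
exists ((1 - h ^+ 2) / (1 + h ^+ 2)), (2 * h / (1 + h ^+ 2)).
have s2 : 2 * h / (1 + h ^+ 2) <= 2 * h by rewrite ler_pdivrMr//; nra.
have s0 : 0 < 2 * h / (1 + h ^+ 2) by rewrite divr_gt0// mulr_gt0.
have c2 : 1 - 2 * h ^+ 2 <= (1 - h ^+ 2) / (1 + h ^+ 2).
  by rewrite ler_pdivlMr//; nra.
have sr x : 0 <= x -> 2 * h <= r * x -> 2 * h / (1 + h ^+ 2) / r <= x.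
  by move=> x0 H; rewrite ler_pdivrMr//; lra.
have c0 : 2^-1 <= (1 - h ^+ 2) / (1 + h ^+ 2) by apply: le_trans c2; lra.
have sz0 : 0 <= 2 * h / (1 + h ^+ 2) * z / r.
  exact: divr_ge0 (mulr_ge0 (ltW s0) z0) (ltW r0).
split => //.
- by field; rewrite gt_eqF//; exact: N0.
- rewrite ltr_pdivrMr//; apply/andP; split; last by lra.
  by apply: le_trans c2; lra.
- apply: le_trans c0; rewrite mulrAC.
  apply: le_trans (_ : 2^-1 * 1 <= _); last by rewrite mulr1.
  apply: ler_pM => //; first exact: divr_ge0 (ltW s0) (ltW r0).
  by apply: sr; lra.
- apply: sr; first by apply: mulr_ge0; [exact: ltW|lra].
  apply: (@le_trans _ _ (r * b / 2)); first by lra.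
  by rewrite -mulrA ler_pM2l// ler_pM2l//; lra.
Qed.

Section excursion.
Variables (R : realType) (d n k : nat).
Hypotheses (hd : (1 < d)%N) (hn : (2 < n)%N) (k0 : (0 < k)%N).
Local Notation E := 'rV[R]_d.+1.
Variable phi : 'I_k -> E -> R.
Hypothesis Hphi : orthonormal_harmonic_basis n phi.
Local Notation K0 := (k%:R / sphere_area R d.+1).
Local Notation G := (gegenbauer R d n).
Local Notation S := (unit_sphere R d).
Variables l N : R.
Hypotheses (hl : l = n%:R * (n%:R + d%:R - 1)) (hN : N = Num.sqrt K0).

Let N0 : 0 < N.
Proof. by rewrite hN sqrtr_gt0 (kernel_diag_gt0 k0 Hphi). Qed.

Let NN : N ^+ 2 = K0.
Proof. by rewrite hN sqr_sqrtr// ltW// (kernel_diag_gt0 k0 Hphi). Qed.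

Let d0 : 0 < d%:R :> R. Proof. by rewrite ltr0n; lia. Qed.

Let l0 : 0 < l.
Proof.
rewrite hl mulr_gt0 ?ltr0n; [by []|by lia|].
have : 3 <= n%:R :> R by rewrite ler_nat.
by move: d0; lra.
Qed.

Let G1 : G.[1] = 1. Proof. exact: (gegenbauer1 hd hn hl). Qed.

Definition embedding (x : E) : 'rV[R]_k := \row_j phi j x.

Lemma dot_embedding x y : S x -> S y ->
  dot (embedding x) (embedding y) = K0 * G.[dot x y].
Proof.
move=> xS yS; rewrite -(kernel_gegenbauer hd hn k0 Hphi xS yS).
by apply: eq_bigr => j _; rewrite !mxE.
Qed.

Lemma dot_le1 x y : S x -> S y -> `|dot x y| <= 1.
Proof.
move=> /unit_sphereE xS /unit_sphereE yS.
rewrite -(@expr_le1 _ 2)// real_normK ?num_real//.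
by have := dot_CS x y; rewrite xS yS mulr1.
Qed.

(** The squared norm of the difference is a combination of values of [G] at [1] and [-1], and the
    parity of [G] makes it vanish. *)
Lemma embeddingN x : S x -> embedding (- x) = (-1) ^+ n *: embedding x.
Proof.
move=> xS; have nxS : S (- x).
  by apply/unit_sphereE; rewrite dotNl dotNr opprK; apply/unit_sphereE.
apply/eqP; rewrite -subr_eq0 -dot_eq0.
rewrite !(dotDl, dotDr, dotNl, dotNr, dotZl, dotZr) !dot_embedding//.
rewrite !(dotNl, dotNr) opprK (unit_sphereE x).1// gegenbauerN G1.
have := signr_odd R n; case: (odd n) => <- /=; apply/eqP; rewrite ?expr0 ?expr1; ring.
Qed.

Variables (a : 'rV[R]_k) (u eta : R).
(** [eta] is half the gap of [gegenbauer_gap], and [1 - eta^2 / 2] is the inner product of two unit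
    vectors at distance [eta]. *)
Hypotheses (ha : dot a a = 1) (heta : eta = (320 * d%:R)^-1)
  (hu : N * (1 - eta ^+ 2 / 2) <= u).

Definition wave (x : E) : R := dot a (embedding x).

Let eta0 : 0 < eta. Proof. by rewrite heta invr_gt0 mulr_gt0. Qed.

Let etad : eta * d%:R = 320^-1.
Proof. by rewrite heta invfM mulfVK// gt_eqF. Qed.

Let eta_le : eta <= 640^-1.
Proof.
have : 2 <= d%:R :> R by rewrite ler_nat.
move: etad eta0; nra.
Qed.

Let eta2 : eta ^+ 2 <= eta / 640.
Proof. by rewrite expr2 ler_wpM2l// ltW. Qed.

Lemma threshold_gt0 : 0 < u.
Proof. by apply: lt_le_trans hu; rewrite mulr_gt0//; move: eta2 eta_le; lra. Qed.

(* [a] is within [eta] of [embedding x / N]. *)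
Lemma wave_close x (v : 'rV[R]_k) (m : R) : S x -> u < wave x ->
  dot v v <= m ^+ 2 -> 0 <= m ->
  dot a v <= dot (embedding x) v / N + eta * m.
Proof.
move=> xS ux vm m0; pose w := a - N^-1 *: embedding x.
have ww : dot w w <= eta ^+ 2.
  have -> : dot w w = 2 - 2 * (wave x / N).
    rewrite /w !(dotDl, dotDr, dotNl, dotNr, dotZl, dotZr) ha.
    rewrite (dotC (embedding x) a) -/(wave x) dot_embedding//.
    by rewrite (unit_sphereE x).1// G1 -NN; field; rewrite gt_eqF//; exact: N0.
  have : 1 - eta ^+ 2 / 2 <= wave x / N.
    by rewrite ler_pdivlMr// mulrC ltW// (le_lt_trans hu ux).
  by lra.
have -> : dot a v = dot (embedding x) v / N + dot w v.
  by rewrite /w dotDl dotNl dotZl [_ / N]mulrC addrC subrK.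
rewrite lerD2l; apply: le_trans (ler_norm _) _.
rewrite -(@ler_pXn2r _ 2)// ?nnegrE ?mulr_ge0// ?(ltW eta0)//.
rewrite real_normK ?num_real// exprMn; apply: le_trans (dot_CS _ _) _.
by rewrite ler_pM// dot_ge0.
Qed.

Lemma wave_le x y : S x -> S y -> u < wave x -> wave y <= N * (G.[dot x y] + eta).
Proof.
move=> xS yS ux; apply: le_trans (wave_close xS ux _ (ltW N0)) _.
  by rewrite dot_embedding// (unit_sphereE y).1// G1 mulr1 NN.
rewrite dot_embedding// -NN le_eqVlt; apply/orP; left; apply/eqP.
by field; rewrite gt_eqF//; exact: N0.
Qed.

(** Outside the window [G] is at most [1 - 2 eta], so the wave at [y] is at most [N (1 - eta)],
    which is below the threshold. *)
Lemma excursion_gap x y : S x -> S y -> u < wave x -> u < wave y ->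
  1 - (10 * l)^-1 < `|dot x y|.
Proof.
move=> xS yS ux uy; rewrite ltNge; apply/negP => H.
have := gegenbauer_gap hd hn hl H; move=> /(le_trans (ler_norm _)) gap.
have : u < N * (G.[dot x y] + eta) := lt_le_trans uy (wave_le xS yS ux).
apply/negP; rewrite -leNgt; apply: le_trans hu; rewrite ler_pM2l//.
have e2 : (160 * d%:R)^-1 = 2 * eta :> R by rewrite heta; field; rewrite gt_eqF.
by move: gap eta2 eta_le eta0; rewrite e2; lra.
Qed.

(** Near the antipode of [x] an odd [G] is nonpositive, which leaves at most [N eta] for the
    wave. *)
Lemma excursion_odd x y : odd n -> S x -> S y -> u < wave x -> u < wave y ->
  1 - (10 * l)^-1 < dot x y.
Proof.
move=> on xS yS ux uy; have := excursion_gap xS yS ux uy.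
rewrite lter_normr => /orP[//|H].
have : u < N * (G.[dot x y] + eta) := lt_le_trans uy (wave_le xS yS ux).
have : 0 <= G.[- dot x y].
  have := dot_le1 xS yS; rewrite ler_norml => /andP[H1 _].
  have [|//] := gegenbauer_near1 hd hn hl (z := - dot x y).
  by rewrite (ltW H) /=; lra.
rewrite gegenbauerN -signr_odd on expr1 mulN1r oppr_ge0 => G0.
move=> uN; exfalso; move: uN; apply/negP; rewrite -leNgt; apply: le_trans hu; rewrite ler_pM2l//; move: eta2 eta_le; lra.
Qed.

Lemma waveN x : S x -> wave (- x) = (-1) ^+ n * wave x.
Proof. by move=> xS; rewrite /wave embeddingN// dotZr. Qed.

Lemma near_threshold_ge0 : 0 <= 1 - (10 * l)^-1.
Proof.
rewrite subr_ge0 invf_le1; last by rewrite mulr_gt0.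
have n3 : 3 <= n%:R :> R by rewrite ler_nat.
by have := d0; rewrite hl; nra.
Qed.

Lemma unit_comb p q c s : S p -> S q -> dot p q = 0 -> c ^+ 2 + s ^+ 2 = 1 ->
  S (c *: p + s *: q).
Proof.
move=> /unit_sphereE p1 /unit_sphereE q1 pq cs; apply/unit_sphereE.
rewrite !(dotDl, dotDr, dotZl, dotZr) (dotC q) pq p1 q1 -[RHS]cs; ring.
Qed.

(** The condition on [dot x q] puts [x] in the plane of the arc through [p] with direction [q]. By
    [wave_close] for the second difference of [embedding], the main term is at most
    [- N (l / d) (1 - c)] and the error at most [3 eta N l (1 - c)], where [3 eta d = 3 / 320]. The
    factor 3 comes from [7 <= 3^2] in [gegenbauer_diff2_norm]. *)
Lemma wave_diff2 x p q c s : S x -> S p -> S q -> dot p q = 0 ->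
  c ^+ 2 + s ^+ 2 = 1 -> 1 - (10 * l)^-1 <= c < 1 ->
  1 - (10 * l)^-1 <= dot x p -> dot x q ^+ 2 = 1 - dot x p ^+ 2 -> u < wave x ->
  wave (c *: p + s *: q) + wave (c *: p - s *: q) < 2 * wave p.
Proof.
move=> xS pS qS pq cs c1 xp xq ux; have /andP[c0 c1'] := c1.
have z0 := near_threshold_ge0.
have c00 : 0 <= c by lra.
have [p1 q1] := ((unit_sphereE p).1 pS, (unit_sphereE q).1 qS).
have qp : dot q p = 0 by rewrite dotC.
pose pp := c *: p + s *: q; pose pm := c *: p - s *: q.
have ppS : S pp by exact: unit_comb.
have pmS : S pm by rewrite /pm -scaleNr; apply: unit_comb; rewrite ?sqrrN.
have ppm : dot pp pm = 2 * c ^+ 2 - 1.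
  rewrite /pp /pm !(dotDl, dotDr, dotNl, dotNr, dotZl, dotZr).
  by rewrite pq qp p1 q1; transitivity (c ^+ 2 - s ^+ 2); [ring|move: cs; lra].
have ppp : dot pp p = c by rewrite /pp dotDl !dotZl p1 qp; ring.
have pmp : dot pm p = c by rewrite /pm dotDl dotNl !dotZl p1 qp; ring.
have xpp : dot x pp = dot x p * c + s * dot x q.
  by rewrite /pp dotDr !dotZr; ring.
have xpm : dot x pm = dot x p * c - s * dot x q.
  by rewrite /pm dotDr dotNr !dotZr; ring.
pose v := embedding pp + embedding pm - 2 *: embedding p.
have vv : dot v v <= (N * (3 * l * (1 - c))) ^+ 2.
  have -> : dot v v = K0 * (6 - 8 * G.[c] + 2 * G.[2 * c ^+ 2 - 1]).
    rewrite /v !(dotDl, dotDr, dotNl, dotNr, dotZl, dotZr) !dot_embedding//.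
    rewrite !(dotC p) (dotC pm pp) ppm ppp pmp p1.
    rewrite (unit_sphereE pp).1// (unit_sphereE pm).1// G1; ring.
  rewrite exprMn NN ler_wpM2l -?NN ?sqr_ge0//.
  apply: le_trans (gegenbauer_diff2_norm hd hn hl _) _; first by rewrite c00 ltW.
  rewrite !exprMn; apply: ler_wpM2r; first exact: sqr_ge0.
  by apply: ler_wpM2r; [exact: sqr_ge0|lra].
have c10 : 0 < 1 - c by lra.
have := wave_close xS ux vv.
have -> : dot a v = wave pp + wave pm - 2 * wave p.
  by rewrite /v !(dotDr, dotNr, dotZr).
have -> : dot (embedding x) v / N =
    N * (G.[dot x p * c + s * dot x q] + G.[dot x p * c - s * dot x q] - 2 * G.[dot x p]).
  rewrite /v !(dotDr, dotNr, dotZr) !dot_embedding// xpp xpm -NN.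
  by field; rewrite gt_eqF//; exact: N0.
have zz : 1 - (10 * l)^-1 <= dot x p <= 1.
  by rewrite xp; have := dot_le1 xS pS; rewrite ler_norml => /andP[].
have cc : 1 - (10 * l)^-1 <= c <= 1 by rewrite c0 ltW.
have ww : (s * dot x q) ^+ 2 = (1 - dot x p ^+ 2) * (1 - c ^+ 2).
  by rewrite exprMn xq -cs; ring.
move: (gegenbauer_diff2 hd hn hl zz cc ww).
set g := (X in X <= _) => gle H; rewrite -subr_lt0.
apply: le_lt_trans (H _) _.
  by rewrite !mulr_ge0 ?(ltW N0) ?(ltW l0)// ltW.
have e3 : 3 * eta * d%:R < 1 by rewrite -mulrA etad; lra.
have : N * g + eta * (N * (3 * l * (1 - c))) <=
    N * l * (1 - c) / d%:R * (3 * eta * d%:R - 1).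
  have -> : N * l * (1 - c) / d%:R * (3 * eta * d%:R - 1) =
      N * (- (l / d%:R) * (1 - c)) + eta * (N * (3 * l * (1 - c))).
    by field; rewrite gt_eqF//; exact: d0.
  by rewrite lerD2r ler_pM2l.
move=> /le_lt_trans; apply; rewrite pmulr_rlt0 ?subr_lt0//.
by rewrite divr_gt0// !mulr_gt0.
Qed.

Lemma wave_harmonic : spherical_harmonic n wave.
Proof.
rewrite (_ : wave = fun x => \sum_j a 0 j * phi j x); last first.
  by apply/funext => x; apply: eq_bigr => j _; rewrite mxE.
exact: spherical_harmonic_sum (basis_harmonic Hphi).
Qed.

Local Notation F := (radial_ext wave).

Lemma wave_ext_continuous x : x != 0 -> {for x, continuous F}.
Proof. by move=> x0; exact: ((spherical_harmonic_C1 wave_harmonic).1 x x0).1. Qed.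

Lemma segment_dot x y t : S x -> S y ->
  dot ((1 - t) *: x + t *: y) ((1 - t) *: x + t *: y) =
  1 - 2 * t * (1 - t) * (1 - dot x y).
Proof.
move=> /unit_sphereE x1 /unit_sphereE y1.
by rewrite !(dotDl, dotDr, dotZl, dotZr) (dotC y) x1 y1; ring.
Qed.

Lemma segment_neq0 x y t : S x -> S y -> 0 < dot x y -> 0 <= t <= 1 ->
  (1 - t) *: x + t *: y != 0.
Proof.
move=> xS yS xy /andP[t0 t1]; rewrite -dot_eq0 segment_dot// gt_eqF//.
have t2 : 2 * t * (1 - t) <= 2^-1.
  by have := sqr_ge0 (t - 2^-1); rewrite expr2; lra.
have t3 : 0 <= 2 * t * (1 - t) by rewrite !mulr_ge0//; lra.
by nra.
Qed.

(* At an interior minimum [p] of the arc, moving symmetrically along the arc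
   would strictly decrease the sum of the two values, by [wave_diff2]. *)
Lemma wave_arc x y t : S x -> S y -> 1 - (10 * l)^-1 < dot x y ->
  u < wave x -> u < wave y -> 0 <= t <= 1 ->
  u < F ((1 - t) *: x + t *: y).
Proof.
move=> xS yS xy ux uy t01; have [exy|nxy] := eqVneq x y.
  by rewrite exy -scalerDl subrK scale1r radial_ext_unit.
have xy0 : 0 < dot x y by apply: le_lt_trans xy; exact: near_threshold_ge0.
have xy1 : dot x y < 1.
  have : 0 < dot (x - y) (x - y) by rewrite dot_gt0 ?subr_eq0.
  rewrite !(dotDl, dotDr, dotNl, dotNr) (dotC y x).
  by rewrite (unit_sphereE x).1// (unit_sphereE y).1//; lra.
pose g s := (1 - s) *: x + s *: y.
have cg : continuous g.
  move=> s; apply: cvgD.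
    by apply: cvgZr_tmp; apply: cvgB; [exact: cvg_cst|exact: cvg_id].
  by apply: cvgZr_tmp; exact: cvg_id.
have cF : {within `[0, 1], continuous (F \o g)}.
  apply: continuous_in_subspaceT => s; rewrite inE /= in_itv /= => s01.
  apply: continuous_comp; first exact: cg.
  by apply: wave_ext_continuous; exact: segment_neq0.
have [t0 t0_in tmin0] := EVT_min ler01 cF.
move: t0_in; rewrite in_itv /= => t01'.
have tmin s : 0 <= s <= 1 -> F (g t0) <= F (g s).
  by move=> s01; apply: tmin0; rewrite in_itv.
apply: lt_le_trans (tmin t t01); move: t01' => /andP[].
rewrite le_eqVlt => /orP[/eqP <- _|t00].
  by rewrite /g subr0 scale1r scale0r addr0 radial_ext_unit.
rewrite le_eqVlt => /orP[/eqP ->|t10].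
  by rewrite /g subrr scale1r scale0r add0r radial_ext_unit.
exfalso.
(* The extension is constant along rays, so a minimum on the chord is a minimum on the whole cone
   spanned by [x] and [y]. *)
have cone A B : 0 <= A -> 0 <= B -> 0 < A + B -> F (g t0) <= F (A *: x + B *: y).
  move=> A0 B0 AB.
  rewrite (_ : A *: x + B *: y = (A + B) *: g (B / (A + B))).
    rewrite radial_extZ// tmin// divr_ge0 ?(ltW AB)//= ler_pdivrMr// mul1r.
    by rewrite lerDr.
  rewrite /g scalerDr !scalerA; congr (_ *: _ + _ *: _).
    by field; rewrite gt_eqF.
  by field; rewrite gt_eqF.
have t0' : 0 <= t0 <= 1 by rewrite !ltW.
pose m := eucl_norm (g t0).
have m0 : 0 < m by rewrite eucl_norm_gt0// segment_neq0.
have mm : m ^+ 2 = 1 - 2 * t0 * (1 - t0) * (1 - dot x y).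
  by rewrite /m eucl_norm_sqr segment_dot.
have m1 : m <= 1.
  rewrite -(@expr_le1 _ 2)// ?(ltW m0)// mm.
  have : 0 <= 2 * t0 * (1 - t0) * (1 - dot x y) by rewrite !mulr_ge0//; lra.
  by lra.
pose p := m^-1 *: g t0.
have pS : S p by apply: normalize_unit; exact: segment_neq0.
pose z := dot x p.
have zE : z = (1 - t0 * (1 - dot x y)) / m.
  rewrite /z /p /g !(dotDr, dotZr) (unit_sphereE x).1//.
  by rewrite mulrC; congr (_ / _); ring.
have xyz : dot x y <= z.
  rewrite zE ler_pdivlMr//; apply: (@le_trans _ _ (dot x y * 1)).
    by rewrite ler_pM2l.
  by nra.
have z0 : 0 <= z by lra.
have zz : 0 < 1 - z ^+ 2.
  have -> : 1 - z ^+ 2 = t0 ^+ 2 * (1 - dot x y) * (1 + dot x y) / m ^+ 2.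
    rewrite zE; have : m ^+ 2 != 0 by rewrite expf_neq0// gt_eqF.
    move=> m20; apply: (mulIf m20); rewrite mulfVK// mulrBl mul1r expr_div_n.
    by rewrite mulfVK// mm; ring.
  by rewrite divr_gt0 ?exprn_gt0// !mulr_gt0 ?exprn_gt0//; lra.
pose r := Num.sqrt (1 - z ^+ 2).
have r0 : 0 < r by rewrite sqrtr_gt0.
have rr : r ^+ 2 = 1 - z ^+ 2 by rewrite sqr_sqrtr// ltW.
pose q := r^-1 *: (x - z *: p).
have [x1 p1] := ((unit_sphereE x).1 xS, (unit_sphereE p).1 pS).
have px : dot p x = z by rewrite dotC.
have pq : dot p q = 0 by rewrite /q dotZr dotDr dotNr dotZr p1 px; ring.
have xq : dot x q = r.
  rewrite /q dotZr dotDr dotNr dotZr x1 -/z -expr2 -rr expr2 mulKf//.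
  by rewrite gt_eqF.
have qS : S q.
  apply/unit_sphereE; rewrite {1}/q dotZl dotDl dotNl dotZl xq pq mulr0 subr0.
  by rewrite mulVf// gt_eqF.
have e0 : 0 < (10 * l)^-1 by rewrite invr_gt0 mulr_gt0.
have b0 : 0 < (1 - t0) / m by rewrite divr_gt0// subr_gt0.
have z01 : 0 <= z <= 1 by rewrite z0; nra.
(* [p] and [q] are combinations of [x] and [y], and [(1 - t0) / m] is the coordinate of [p] on [x].
   Then [sc] and [sb] make the coordinates of both displaced points nonnegative, so [cone]
   contradicts [wave_diff2]. *)
have [c [s [cs c1 s0 sc sb]]] := cone_perturbation z01 r0 b0 e0.
have sr0 : 0 < s / r by rewrite divr_gt0.
have cz0 : 0 < c + s * z / r.
  by rewrite -(pmulr_rgt0 _ b0); apply: lt_le_trans sb.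
have := wave_diff2 xS pS qS pq cs c1 (ltW (lt_le_trans xy xyz)) _ ux.
rewrite xq rr -/z => /(_ erefl); apply/negP; rewrite -leNgt.
have ppS : S (c *: p + s *: q) by exact: unit_comb.
have pmS : S (c *: p - s *: q).
  by rewrite -scaleNr; apply: unit_comb; rewrite ?sqrrN.
rewrite -(radial_ext_unit wave ppS) -(radial_ext_unit wave pmS).
rewrite mulr_natl mulr2n; apply: lerD.
  have -> : c *: p + s *: q =
      ((c - s * z / r) * ((1 - t0) / m) + s / r) *: x +
      ((c - s * z / r) * (t0 / m)) *: y.
    apply/rowP => i; rewrite /q /p /g !mxE; ring.
  have cz : 0 <= c - s * z / r by rewrite subr_ge0.
  apply: cone.
  - by rewrite addr_ge0 ?(ltW sr0)// mulr_ge0// ltW.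
  - by rewrite mulr_ge0// divr_ge0// ltW.
  - by rewrite addrAC ltr_wpDl// addr_ge0// mulr_ge0// ?(ltW b0)// divr_ge0// ltW.
have -> : c *: p - s *: q =
    ((c + s * z / r) * ((1 - t0) / m) - s / r) *: x +
    ((c + s * z / r) * (t0 / m)) *: y.
  apply/rowP => i; rewrite /q /p /g !mxE; ring.
apply: cone.
- by rewrite subr_ge0 [leRHS]mulrC.
- by rewrite mulr_ge0// ?(ltW cz0)// divr_ge0// ltW.
- by rewrite ltr_wpDl ?subr_ge0 1?[leRHS]mulrC// mulr_gt0// divr_gt0.
Qed.

End excursion.

(** * Contracting an excursion set along great arcs *)

Section star.
Variables (R : realType) (d : nat).
Local Notation E := 'rV[R]_d.+1.
Local Notation S := (unit_sphere R d).

Definition normalize (v : E) : E := (eucl_norm v)^-1 *: v.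

Lemma eucl_norm_continuous : continuous (@eucl_norm R d).
Proof.
move=> x; rewrite (_ : @eucl_norm R d = Num.sqrt \o (fun x => dot x x)); last first.
  by apply/funext => y; rewrite eucl_normE.
apply: continuous_comp; last exact: sqrt_continuous.
apply: (@cvg_sumr R _ _ (nbhs x) (nbhs_filter x)) => i _.
by apply: cvgM; exact: coord_continuous.
Qed.

Lemma normalize_continuous v : v != 0 -> {for v, continuous normalize}.
Proof.
move=> v0; apply: (@cvgZ _ _ _ (nbhs v) (nbhs_filter v) (fun v => (eucl_norm v)^-1) id _ v); last exact: cvg_id.
by apply: cvgV; [rewrite gt_eqF// eucl_norm_gt0|exact: eucl_norm_continuous].
Qed.

Lemma normalize_id v : S v -> normalize v = v.
Proof. by rewrite /normalize /unit_sphere /= => ->; rewrite invr1 scale1r. Qed.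

Lemma unit_entry_le1 v i : S v -> `|v 0 i| <= 1.
Proof.
move=> vS; rewrite -(@expr_le1 _ 2)// real_normK ?num_real//.
rewrite -(unit_sphereE v).1// /dot (bigD1 i)//= -expr2 lerDl.
by apply: sumr_ge0 => j _; rewrite -expr2 sqr_ge0.
Qed.

Variables (f : E -> R) (u z0 : R) (b : nat).
Let A : set E := excursion_set f u.
Variables (p : 'I_b -> A) (comp : A -> 'I_b).
Hypotheses (z00 : 0 <= z0)
  (near_p : forall x : A, z0 < dot (val (p (comp x))) (val x))
  (comp_p : forall j, comp (p j) = j)
  (comp_open : forall j, open [set x | comp x = j])
  (arc : forall x y t, S x -> S y -> z0 < dot x y -> u < f x -> u < f y ->
     0 <= t <= 1 -> u < radial_ext f ((1 - t) *: x + t *: y)).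

Let AP (x : A) : S (val x) /\ u < f (val x).
Proof. exact: (set_valP x). Qed.

(** Chord from the base point of the class to [x]. It avoids the origin because its ends have
    positive inner product, so it projects to a great arc. Clamping lets the parameter range over
    all reals, as the homology lemmas expect. *)
Definition star_segment (x : A) (t : R) : E :=
  (1 - clamp t) *: val (p (comp x)) + clamp t *: val x.

Lemma star_segment_neq0 x t : star_segment x t != 0.
Proof.
apply: segment_neq0; [exact: (AP _).1|exact: (AP _).1| |exact: clamp_itv].
exact: le_lt_trans (near_p x).
Qed.

Lemma star_contractionP x t : A (normalize (star_segment x t)).
Proof.
split; first exact: normalize_unit (star_segment_neq0 x t).
by apply: arc; [exact: (AP _).1|exact: (AP _).1|exact: near_p|exact: (AP _).2|
  exact: (AP _).2|exact: clamp_itv].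
Qed.

Definition star_contraction (x : A) (t : R) : A :=
  SigSub (mem_set (star_contractionP x t)).

Lemma star_segment_continuous (x : A) (s : R) :
  (fun q : A * R => star_segment q.1 q.2) @ (x, s) --> star_segment x s.
Proof.
have cs : (fun q : A * R => clamp q.2) @ (x, s) --> clamp s.
  by apply: (@continuous_comp (A * R)%type R R snd (@clamp R) (x, s));
    [exact: cvg_snd|exact: clamp_continuous].
have cx : (fun q : A * R => val q.1) @ (x, s) --> val x.
  by apply: (@continuous_comp (A * R)%type A E fst (fun a => val a) (x, s));
    [exact: cvg_fst|exact: set_val_continuous].
have cp : (fun q : A * R => val (p (comp q.1))) @ (x, s) --> val (p (comp x)).
  apply: (@cvg_trans _ ((fun=> val (p (comp x))) @ (x, s))); last exact: (@cvg_cst _ _ _ (nbhs (x, s)) (nbhs_filter (x, s))).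
  apply: near_eq_cvg.
  have H : nbhs x [set y | comp y = comp x] by apply: open_nbhs_nbhs.
  have : \forall q \near (x, s), comp q.1 = comp x.
    exact: (@cvg_fst A R (nbhs x) (nbhs s) _ _ H).
  by apply: filterS => q ->.
pose FF : Filter (nbhs (x, s)) := nbhs_filter (x, s).
apply: (@cvgD R E (A * R)%type (nbhs (x, s)) FF
  (fun q => (1 - clamp q.2) *: val (p (comp q.1))) (fun q => clamp q.2 *: val q.1)).
  apply: (@cvgZ R E (A * R)%type _ FF (fun q => 1 - clamp q.2)
    (fun q => val (p (comp q.1))) _ _ _ cp).
  exact: (@cvgB R R (A * R)%type _ FF (fun=> 1) (fun q => clamp q.2) _ _ (cvg_cst _) cs).
exact: (@cvgZ R E (A * R)%type _ FF (fun q => clamp q.2) (fun q => val q.1) _ _ cs cx).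
Qed.

Lemma excursion_euler_char : euler_char R A = b%:Z.
Proof.
apply: (@star_euler_char R A b p comp star_contraction) => //.
- move=> x; apply: val_inj; rewrite /= /star_segment clamp_id ?lexx ?ler01//.
  by rewrite subrr scale0r scale1r add0r; apply: normalize_id; exact: (AP x).1.
- move=> x; apply: val_inj; rewrite /= /star_segment clamp_id ?lexx ?ler01//.
  by rewrite subr0 scale0r scale1r addr0; apply: normalize_id; exact: (AP _).1.
- move=> x s _; apply: cvg_set_type => /=.
  apply: (@continuous_comp (A * R)%type E E (fun q => star_segment q.1 q.2) normalize (x, s)).
    exact: star_segment_continuous.
  exact: normalize_continuous (star_segment_neq0 x s).
move=> j U [_ [[W oW <-] /= Wp WU]].
have pS : S (val (p j)) by exact: (AP _).1.
have : nbhs (val (p j)) (normalize @^-1` W).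
  apply: normalize_continuous; first exact: unit_sphere_neq0.
  by rewrite normalize_id//; exact: open_nbhs_nbhs.
move=> /nbhs_ballP[e /= e0 He].
(* Coordinates of unit vectors differ by at most 2, so the chord at parameter [s] is within [2 s] of
   the base point in every coordinate, uniformly in [x]. *)
exists (Num.min 1 (e / 2)); first by rewrite lt_min ltr01 divr_gt0.
move=> x s xj s0; rewrite lt_min => /andP[s1 se]; apply: WU; apply: He.
split=> // i i'; rewrite /ball /= (ord1 i) !mxE clamp_id ?s0 ?ltW// xj.
rewrite (_ : _ - _ = s * (val (p j) 0 i' - val x 0 i')); last by ring.
rewrite normrM ger0_norm//; apply: (@le_lt_trans _ _ (s * 2)).
  apply: ler_wpM2l => //; apply: le_trans (ler_normB _ _) _.
  by rewrite (_ : 2 = 1 + 1)//; apply: lerD; apply: unit_entry_le1 => //; exact: (AP x).1.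
by rewrite -ltr_pdivlMr.
Qed.

End star.

(** The case of zero classes. *)
Lemma empty_euler_char (R : realType) (X : topologicalType) :
  (X -> False) -> euler_char R X = 0.
Proof.
move=> X0; pose p (j : 'I_0) : X := False_rect X (notF (ltn_ord j)).
pose comp (x : X) : 'I_0 := False_rect _ (X0 x).
by apply: (@star_euler_char R X 0 p comp (fun x _ => x)) => [[]//|[]//|//|x|x|[]//];
  case: (X0 x).
Qed.

Section wave_euler.
Variables (R : realType) (d n k : nat).
Hypotheses (hd : (1 < d)%N) (hn : (2 < n)%N) (k0 : (0 < k)%N).
Local Notation E := 'rV[R]_d.+1.
Local Notation S := (unit_sphere R d).
Variable phi : 'I_k -> E -> R.
Hypothesis Hphi : orthonormal_harmonic_basis n phi.
Variables (a : 'rV[R]_k) (u eta : R).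
Hypotheses (ha : dot a a = 1) (heta : eta = (320 * d%:R)^-1)
  (hu : Num.sqrt (k%:R / sphere_area R d.+1) * (1 - eta ^+ 2 / 2) <= u).
Local Notation f := (wave phi a).
Let l : R := n%:R * (n%:R + d%:R - 1).
Let z0 : R := 1 - (10 * l)^-1.
Let hl : l = n%:R * (n%:R + d%:R - 1) := erefl.
Let N := Num.sqrt (k%:R / sphere_area R d.+1).
Let hN : N = Num.sqrt (k%:R / sphere_area R d.+1) := erefl.
Let A : set E := excursion_set f u.

Let arc : forall x y t, S x -> S y -> z0 < dot x y -> u < f x -> u < f y ->
  0 <= t <= 1 -> u < radial_ext f ((1 - t) *: x + t *: y).
Proof. by move=> x y t; exact: (wave_arc hd hn k0 Hphi hl hN ha heta hu). Qed.

Let z00 : 0 <= z0.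
Proof. exact: (near_threshold_ge0 hd hn k0 Hphi hl hN). Qed.

Let AP (x : A) : S (val x) /\ u < f (val x).
Proof. exact: (set_valP x). Qed.

(** Any point [x0] of the set can serve as centre. For odd [n] there is one class. For even [n] the
    base points are [x0] and [- x0], and the class of [x] is the sign of [dot x0 x], which
    [excursion_gap] keeps away from 0, so that both classes are open. *)
Lemma wave_euler_char x0 : S x0 -> u < f x0 ->
  euler_char R A = if odd n then 1 else 2.
Proof.
move=> xS ux; have xA : A x0 by split.
have [on|en] := boolP (odd n).
  apply: (@excursion_euler_char R d f u z0 1 (fun=> SigSub (mem_set xA)) (fun=> ord0) z00) => //.
  - by move=> x; have [? ?] := AP x; apply: (excursion_odd hd hn k0 Hphi hl hN ha heta hu).
  - by move=> j; rewrite (ord1 j).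
  - move=> j; rewrite (_ : [set x : A | _] = setT); first exact: openT.
    by apply/seteqP; split => // x _ /=; rewrite (ord1 j).
have nxA : A (- x0).
  split; first by apply/unit_sphereE; rewrite dotNl dotNr opprK; apply/unit_sphereE.
  by rewrite (waveN hd hn k0 Hphi hl)// -signr_odd (negbTE en) expr0 mul1r.
have gap (x : A) : z0 < `|dot x0 (val x)|.
  by have [? ?] := AP x; apply: (excursion_gap hd hn k0 Hphi hl hN ha heta hu).
pose p (j : 'I_2) : A := if j == 0 then SigSub (mem_set xA) else SigSub (mem_set nxA).
pose comp (x : A) : 'I_2 := if 0 < dot x0 (val x) then 0 else 1.
have x01 : dot x0 x0 = 1 by apply/unit_sphereE.
have ov (P : set R) : open P -> open [set x : A | P (dot x0 (val x))].
  move=> oP; apply: (@open_comp A R (fun x => dot x0 (val x)) P) => // x _.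
  apply: (@continuous_comp A E R (fun x => val x) (dot x0) x).
    exact: set_val_continuous.
  exact: dot_continuous.
apply: (@excursion_euler_char R d f u z0 2 p comp z00) => //.
- move=> x; have := gap x; rewrite lter_normr /comp /p.
  case: (ltP 0 (dot x0 (val x))) => [xx|xx]; rewrite /= ?dotNl.
    by move=> /orP[//|] H; move: z00; lra.
  by move=> /orP[H|//]; move: z00; lra.
- move=> j; rewrite /p /comp; case: eqP => [->|/eqP j0] /=.
    by rewrite x01 ltr01.
  rewrite dotNr x01 oppr_gt0 ltr10.
  by apply/val_inj => /=; case: j j0 => -[|[|]].
- move=> j; rewrite /comp; have [->|j0] := eqVneq j 0.
    rewrite (_ : [set x : A | _] = [set x : A | [set r | 0 < r] (dot x0 (val x))]).
      exact/ov/open_gt.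
    by apply/seteqP; split => x /=; case: ifP.
  rewrite (_ : [set x : A | _] = [set x : A | [set r | r < 0] (dot x0 (val x))]).
    exact/ov/open_lt.
  apply/seteqP; split => x /=; have [xx|xx] := ltP 0 (dot x0 (val x)).
  + by move=> e; move: j0; rewrite -e.
  + by move=> _; have := gap x; rewrite lter_normr => /orP[H|H]; move: z00; lra.
  + by move=> H1; have := lt_trans xx H1; rewrite ltxx.
  + by move=> _; apply/val_inj => /=; case: j j0 => -[|[|]].
Qed.

End wave_euler.

(** * The random harmonic *)

Import HBNNSimple.

Section null_set.
Context d (T : measurableType d) (R : realType) (mu : {measure set T -> \bar R}).
Local Open Scope ereal_scope.

(* Unlike [ae_eq_integral], no measurability of the integrands is required:
   the integral is a supremum over the simple functions below them. *)
Lemma eq_integral_off_null (D : set T) (f g : T -> \bar R) :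
  measurable D -> mu (~` D) = 0 -> (forall x, D x -> f x = g x) ->
  \int[mu]_x f x = \int[mu]_x g x.
Proof.
have le (f1 g1 : T -> \bar R) : measurable D -> mu (~` D) = 0 ->
    (forall x, 0 <= f1 x) -> (forall x, 0 <= g1 x) ->
    (forall x, D x -> f1 x = g1 x) -> \int[mu]_x f1 x <= \int[mu]_x g1 x.
  move=> mD D0 f0 g0 fg; rewrite !ge0_integralTE//.
  apply: ge_ereal_sup => _ [h /= hf <-]; apply: ereal_sup_ubound.
  have hE x : proj_nnsfun h mD x = if x \in D then h x else 0%R.
    by rewrite -mrestrict patchE.
  exists (proj_nnsfun h mD).
    move=> x; rewrite hE; case: ifPn => [/set_mem Dx|_]; last exact: g0.
    by rewrite -fg.
  rewrite -!integralT_nnsfun; apply: ae_eq_integral => //.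
  - exact/measurable_EFinP.
  - exact/measurable_EFinP.
  exists (~` D); split => //; first exact: measurableC.
  move=> x H Dx; apply: H => _.
  by congr EFin; rewrite hE mem_set.
move=> mD D0 fg; rewrite [LHS]integralE [RHS]integralE.
congr (_ - _); apply/eqP; rewrite eq_le; apply/andP; split; apply: le => //;
  by move=> x Dx; rewrite ?funeposE ?funenegE fg.
Qed.

End null_set.

Section uniform.
Variables (R : realType) (k : nat).
Local Notation RR := (measurableTypeR R).
Local Notation T := (k.-tuple RR).
Local Notation mu := (uniform_sphere R k).

(** The zero vector accounts for the Dirac fallback of [mnormalize]. Its wave is zero, hence below
    the positive threshold, so the mass being normalized never has to be computed. *)
Definition unit_or_zero : set T := [set t | tuple_norm t = 1 \/ tuple_norm t = 0].

Lemma measurable_unit_or_zero : measurable unit_or_zero.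
Proof.
rewrite (_ : unit_or_zero = @tuple_norm R k @^-1` ([set 1] `|` [set 0])) //.
rewrite -[X in measurable X]setTI; apply: measurable_tuple_norm => //.
exact: measurableU.
Qed.

Lemma uniform_sphere_support : mu (~` unit_or_zero) = 0%E.
Proof.
have s0 : sphere_measure R k (~` unit_or_zero) = 0%E.
  rewrite /sphere_measure /= /mscale /= /cone_measure /pushforward /mrestr /=.
  rewrite (_ : _ `&` _ = set0) ?measure0 ?mule0//.
  apply/seteqP; split => // t [/= H /andP[t0 t1]]; apply: H; left.
  rewrite {1}/tuple_norm; under eq_bigr do rewrite tnth_mktuple expr_div_n.
  rewrite -mulr_suml sqrtrM; last by apply: sumr_ge0 => i _; exact: sqr_ge0.
  by rewrite sqrtrV ?sqr_ge0// sqrtr_sqr ger0_norm ?ltW// divff// gt_eqF.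
rewrite /uniform_sphere /= /mnormalize; case: ifPn => _.
  rewrite [LHS]diracE memNset //= => H; apply: H; right.
  by rewrite /tuple_norm big1 ?sqrtr0// => i _; rewrite tnth_nseq expr0n.
by rewrite [X in (X * _)%E]s0 mul0e.
Qed.

End uniform.

Section random.
Variables (R : realType) (d n k : nat).
Hypotheses (hd : (1 < d)%N) (hn : (2 < n)%N) (k0 : (0 < k)%N).
Local Notation E := 'rV[R]_d.+1.
Local Notation S := (unit_sphere R d).
Local Notation T := (k.-tuple (measurableTypeR R)).
Variable phi : 'I_k -> E -> R.
Hypothesis Hphi : orthonormal_harmonic_basis n phi.
Variables (u eta : R).
Hypotheses (heta : eta = (320 * d%:R)^-1)
  (hu : Num.sqrt (k%:R / sphere_area R d.+1) * (1 - eta ^+ 2 / 2) <= u).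

Definition coefficients (t : T) : 'rV[R]_k := \row_i (tnth t i : R).

Definition exceeds : set T := [set t | exists2 x, S x & u < random_harmonic phi t x].

Lemma random_harmonicE t : random_harmonic phi t = wave phi (coefficients t).
Proof. by apply/funext => x; apply: eq_bigr => j _; rewrite !mxE. Qed.

Lemma tuple_normE t : tuple_norm t = Num.sqrt (dot (coefficients t) (coefficients t)).
Proof. by congr Num.sqrt; apply: eq_bigr => i _; rewrite !mxE expr2. Qed.

(** For fixed [x] the condition on the coefficients is open, so the uncountable union over the
    sphere is open as well. *)
Lemma measurable_exceeds : measurable exceeds.
Proof.
pose U : set 'rV[R]_k := \bigcup_(x in S) [set a | [set r | u < r] (dot (embedding phi x) a)].
have oU : open U.
  apply: bigcup_open => x _; apply: open_comp; last exact: open_gt.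
  by move=> a _; exact: dot_continuous.
rewrite (_ : exceeds = [set t | U (coefficients t)]); first exact: open_measurable_tuple.
by apply/seteqP; split => t [x xS H]; exists x => //; move: H;
  rewrite random_harmonicE /wave /= dotC.
Qed.

Lemma sup_random_harmonic t :
  u < sup [set random_harmonic phi t x | x in S] <-> exceeds t.
Proof.
split=> [/sup_gt[]|[x xS ux]].
- by exists (random_harmonic phi t (delta_mx 0 0)), (delta_mx 0 0) => //; exact: unit_sphere_delta.
- by move=> _ [x xS <-] ux; exists x.
apply: lt_le_trans ux _; apply: ub_le_sup; last by exists x.
(* Cauchy-Schwarz bounds the square of the wave, and [w <= 1 + w^2] yields a bound free of square
   roots. An upper bound is required for [sup] to be a true supremum. *)
exists (1 + dot (coefficients t) (coefficients t) * (k%:R / sphere_area R d.+1)).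
move=> _ [y yS <-]; rewrite random_harmonicE.
have := dot_CS (coefficients t) (embedding phi y).
rewrite (dot_embedding hd hn k0 Hphi)//.
rewrite (unit_sphereE y).1// (gegenbauer1 hd hn (l := n%:R * (n%:R + d%:R - 1)))// mulr1.
rewrite -/(wave phi (coefficients t) y) => H.
have := sqr_ge0 (wave phi (coefficients t) y - 2^-1); move: H; rewrite !expr2; lra.
Qed.

Lemma random_euler_char t : unit_or_zero t ->
  euler_char R (excursion_set (random_harmonic phi t) u) =
  if t \in exceeds then (if odd n then 1 else 2) else 0.
Proof.
move=> ht; case: ifPn => [/set_mem[x xS ux]|/negP tB]; last first.
  apply: empty_euler_char => x; apply: tB; rewrite inE.
  by have [xS ux] := set_valP x; exists (val x).
case: ht => ht; last first.
  exfalso; move: ux; apply/negP; rewrite -leNgt.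
  apply: le_trans (ltW (threshold_gt0 hd hn k0 Hphi erefl heta hu)).
  rewrite random_harmonicE /wave; move: ht; rewrite tuple_normE => /eqP.
  rewrite sqrtr_eq0 => t0; have : coefficients t == 0.
    by rewrite -dot_eq0 eq_le t0 dot_ge0.
  by move=> /eqP ->; rewrite /dot big1// => i _; rewrite mxE mul0r.
rewrite random_harmonicE in ux *.
apply: (wave_euler_char hd hn k0 Hphi _ heta hu xS ux).
by rewrite -[LHS]sqr_sqrtr ?dot_ge0// -tuple_normE ht expr1n.
Qed.

(** Off a null set the Euler characteristic is a constant times the indicator of [exceeds], so its
    mean is that constant times a probability. *)
Lemma expectation_euler_char :
  ('E_(uniform_sphere R k)[fun t =>
     (euler_char R (excursion_set (random_harmonic phi t) u))%:~R] =
   (if odd n then 1 else 2 : R)%:E * uniform_sphere R k exceeds)%E.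
Proof.
rewrite unlock -[exceeds in RHS](setIT) -integral_indic//; last exact: measurable_exceeds.
rewrite -(@integralZl_indic _ _ _ _ _ _ (fun=> exceeds)) //; last 2 first.
- by case: (odd n); rewrite ltNge ?ler01 ?ler0n.
- exact: measurable_exceeds.
apply: (@eq_integral_off_null _ _ _ (uniform_sphere R k) _ _ _ (@measurable_unit_or_zero R k)).
  exact: uniform_sphere_support.
move=> t ht; rewrite random_euler_char// indicE.
by case: ifP => _; [rewrite mulr1; case: ifP|rewrite mulr0].
Qed.

End random.

Theorem theorem1p2 (R : realType) (d : nat) (hd : (2 <= d)%N) :
  exists (rho : R) (n0 : nat), 0 < rho < pi / 2 /\
    forall n : nat, (0 < n)%N -> (n0 <= n)%N ->
    forall phi : 'I_(harmonic_dim d n) -> 'rV[R]_d.+1 -> R,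
    orthonormal_harmonic_basis n phi ->
    forall u : R,
    Num.sqrt ((harmonic_dim d n)%:R / sphere_area R d.+1) * cos rho < u ->
    let mu := uniform_sphere R (harmonic_dim d n) in
    let kappa : R := if odd n then 1 else 2^-1 in
    mu [set a | u < sup [set random_harmonic phi a x | x in unit_sphere R d]] =
    (kappa%:E *
      'E_mu[fun a =>
        (euler_char R (excursion_set (random_harmonic phi a) u))%:~R])%E.
Proof.
pose eta : R := (320 * d%:R)^-1.
have d0 : 2 <= d%:R :> R by rewrite ler_nat.
have eta0 : 0 < eta by rewrite invr_gt0; lra.
have eta1 : eta <= 1 by rewrite invf_le1; lra.
pose c := 1 - eta ^+ 2 / 2.
have c01 : 0 < c < 1 by rewrite /c; apply/andP; split; nra.
have cK : cos (acos c) = c by rewrite acosK// in_itv /=; lra.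
have c_gt0 : 0 < acos c by apply: acos_gt0; lra.
have c_ltpi : acos c < pi by apply: acos_ltpi; lra.
(* [rho] is the angle between unit vectors at distance [eta]; it is below [pi / 2] because [c > 0].
   The degree 3 is the least one for which the energy bound on [G''] is available. *)
exists (acos c), 3%N; split.
  rewrite c_gt0 -ltr_cos ?in_itv /= ?cos_pihalf ?cK.
  - by case/andP: c01.
  - by rewrite !ltW.
  - by have := pi_gt0 R; lra.
move=> n n1 hn phi Hphi u hu /=.
have k0 := harmonic_dim_gt0 hd n1.
rewrite cK in hu.
rewrite (expectation_euler_char hd hn k0 Hphi (eta := eta) erefl (ltW hu)).
rewrite (_ : [set a | _] = exceeds phi u); last first.
  by apply/seteqP; split => t /(sup_random_harmonic hd hn k0 Hphi).
rewrite muleA -EFinM; case: (odd n); first by rewrite mulr1 mul1e.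
by rewrite mulVf// mul1e.
Qed.
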